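(* The planar knotoid invariant $K\mapsto H_K(t,y,z)$ is a Vassiliev invariant of order one.
   Context: **Planar knotoid diagrams.** A planar knotoid diagram $D$ is a generic immersion of the oriented interval $[0,1]$ into $\mathbb{R}^2$ with finitely many transverse double points (crossings), each carrying over/under information. It is oriented from $0$ to $1$. The images of $0$ and $1$ are the tail and the head; they are distinct from the double points. The sign $\operatorname{sgn}(c)=\pm1$ of a crossing $c$ is the usual one: $+1$ if the over-strand direction is rotated counterclockwise (by less than $\pi$) to the under-strand direction, and $-1$ otherwise. Two diagrams are equivalent if they are related by a finite sequence of planar isotopies and oriented Reidemeister moves $\Omega_1,\Omega_2,\Omega_3$ performed away from the tail and head; pulling an endpoint over or under an arc is forbidden. Equivalence classes are planar knotoids. **Gauss diagram.** $G(D)$ is a counterclockwise oriented arc of a circle (the circle minus a gap between head and tail), running from the tail to the head, with a chord joining the two preimages of each crossing. Each chord $c$ is directed from the overcrossing to the undercrossing and carries the sign $\operatorname{sgn}(c)$ of its crossing. $C(G(D))$ is the set of chords. For a chord $c$, let $r(c)$ (resp. $\ell(c)$) be the set of chords $e\ne c$ intersecting $c$ and passing through $c$ from left to right (resp. from right to left) with respect to the direction of $c$, where $e$ is traversed in its own direction. Thus $e\in r(c)$ means that the starting point of $e$ is on the left of $c$ and its end point on the right. Let $r^{\pm}(c)$ and $\ell^{\pm}(c)$ be the subsets of chords of sign $\pm$. **Degree.** $d(c)=|r^+(c)|-|r^-(c)|-|\ell^+(c)|+|\ell^-(c)|$. **Index functions.** For a chord $c$ put $R_{|d(c)|}=\mathbb{Z}[z^{\pm1}]/(z^{|d(c)|}-1)$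 (so $R_0=\mathbb{Z}[z^{\pm1}]$ and $R_1=\mathbb{Z}$), and $\phi_c(k)=k \bmod |d(c)|$, with $\phi_c=\mathrm{id}$ if $d(c)=0$. For $n\in\mathbb{N}=\{0,1,2,\dots\}$ let $r^n(c)=\{e\in r(c):\gcd(d(c),d(e))=n\}$ and $\ell^n(c)=\{e\in\ell(c):\gcd(d(c),d(e))=n\}$, where $\gcd(a,0)=|a|$ and $\gcd(0,0)=0$. The $n$-th index function is $$\operatorname{Ind}_c^n(z)=\sum_{e\in r^n(c)}\operatorname{sgn}(e)\,z^{\phi_c(d(e))}-\sum_{e\in\ell^n(c)}\operatorname{sgn}(e)\,z^{\phi_c(-d(e))}\in R_{|d(c)|}.$$ **The function $H_D$.** $$H_D(t,y,z)=\sum_{c\in C(G(D)),\,n\in\mathbb{N}}\operatorname{sgn}(c)\left(t^{\operatorname{Ind}_c^n(z)}-1\right)y^n,$$ a finite sum since $\operatorname{Ind}_c^n(z)\neq0$ for only finitely many pairs $(c,n)$. Here $t^f$ (for $f\in R_k$, $k\ge0$) is a formal symbol, with $t^0=1$ for the zero of every $R_k$. So $H_D$ is a polynomial in $y$ with coefficients in the free abelian group on the symbols $t^f$, where $f$ runs over the disjoint union of the $R_k$ ($k\geq 0$) with all zero elements identified. $H_D$ depends only on the planar knotoid $K$ represented by $D$, and is then written $H_K$. **Singular planar knotoids.** A singular planar knotoid diagram is an oriented planar knotoid diagram in which finitely many double points are marked as singular crossings (no over/under information). Singular planar knotoids are equivalence classes of such diagrams under planar isotopy, oriented Reidemeister moves,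 and singular Reidemeister moves, all performed away from the endpoints. The singular moves are: passing an arc entirely over or entirely under a singular crossing, and sliding a real crossing between two strands through an adjacent singular crossing of the same two strands. **Vassiliev extension and order.** An invariant $v$ of planar knotoids with values in an abelian group extends to singular planar knotoids by repeatedly applying $v(K(\times))=v(K(\times^+))-v(K(\times^-))$, where $K(\times^{+})$ and $K(\times^-)$ are obtained from $K(\times)$ by replacing a singular crossing $\times$ by a positive, respectively negative, crossing. The invariant $v$ is a Vassiliev invariant of order $n$ if its extension vanishes on all singular planar knotoids with more than $n$ singular crossings and is non-zero on some singular planar knotoid with exactly $n$ singular crossings. *)

(* Defs.v *)
From Stdlib Require Export Relations.
From HB Require Export structures.
From mathcomp Require Export all_boot all_order all_algebra finmap.
From mathcomp Require Export boolp classical_sets functions fsbigop reals.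
From mathcomp Require Export topology normedtype derive.
From mathcomp Require Export freeg.

Set Implicit Arguments.
Unset Strict Implicit.
Unset Printing Implicit Defensive.

Import Order.TTheory GRing.Theory Num.Theory.
Import numFieldNormedType.Exports.

Local Open Scope classical_set_scope.
Local Open Scope fset_scope.
Local Open Scope ring_scope.

(* Between finite-dimensional spaces, [Ck k] is the usual class C^k: it asks   *)
(* for iterated Frechet derivatives in all directions, up to order k, the last *)
(* ones being continuous.                                                      *)
Fixpoint Ck (R : realType) (V W : normedModType R) (k : nat) (f : V -> W) :
    Prop :=
  if k is k'.+1 then
    (forall x, differentiable f x) /\ (forall v, Ck k' (fun x => 'd f x v))
  else continuous f.

Definition smooth (R : realType) (V W : normedModType R) (f : V -> W) : Prop :=
  forall k, Ck k f.

Section Diagrams.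
Variable R : realType.
Local Notation plane := (R * R)%type.

Definition det2 (v w : plane) : R := v.1 * w.2 - v.2 * w.1.

Definition velocity (g : R -> plane) : R -> plane := derive1 g.

(* The immersed interval is the restriction of [g] to [0, 1] (every smooth map *)
(* on [0, 1] extends to R, and only that restriction is ever used).  [X] lists *)
(* the double points, each given by its two parameters in increasing order.    *)
Record generic_immersion (g : R -> plane) (X : {fset R * R}) : Prop := {
  gi_smooth : smooth g;
  gi_immersion : forall t, 0 <= t <= 1 -> velocity g t != 0;
  gi_double : forall s t,
    (s, t) \in X <-> [/\ 0 <= s, s < t, t <= 1 & g s = g t];
  gi_transverse : forall c, c \in X ->
    det2 (velocity g c.1) (velocity g c.2) != 0;
  gi_no_triple : forall c e, c \in X -> e \in X -> g c.1 = g e.1 -> c = e;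
  gi_ends : forall c, c \in X -> 0 < c.1 /\ c.2 < 1 }.

(* [mark c] is [Some true] if the passage at the first parameter c.1 of the    *)
(* double point c is the over one, [Some false] if it is the under one, and    *)
(* [None] if c is singular.  Its values outside [double_points] are junk.      *)
Record sdiagram := SDiagram {
  curve : R -> plane;
  double_points : {fset R * R};
  mark : R * R -> option bool;
  curve_generic : generic_immersion curve double_points }.

Definition singular (D : sdiagram) : {fset R * R} :=
  [fset c in double_points D | mark D c == None].

Record diagram := Diagram {
  sdiagram_of :> sdiagram;
  nonsingular : singular sdiagram_of = fset0 }.

(* The parameters of a double point, the one of the overpass first.            *)
Definition over_under (D : sdiagram) (c : R * R) : R * R :=
  if mark D c == Some true then c else (c.2, c.1).

(* The sign of the crossing whose overpass is at o and underpass is at u.      *)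
Definition crossing_sign (g : R -> plane) (o u : R) : int :=
  if 0 < det2 (velocity g o) (velocity g u) then 1 else -1.

(* Replace c by a positive (e = true) or negative (e = false) crossing.        *)
Definition resolve (D : sdiagram) (c : R * R) (e : bool) : sdiagram :=
  SDiagram
    (fun x => if x == c
              then Some ((crossing_sign (curve D) c.1 c.2 == 1) == e)
              else mark D x)
    (curve_generic D).

(* Planar isotopy: an ambient isotopy F of the plane, G being the inverse,     *)
(* followed by an orientation-preserving reparametrization phi of [0, 1].      *)
Definition planar_isotopy (D D' : sdiagram) : Prop :=
  exists (F G : R * (R * R) -> R * R) (phi : R -> R),
  [/\ smooth F /\ smooth G,
      (forall p, F (0, p) = p) /\
      (forall s p, 0 <= s <= 1 -> G (s, F (s, p)) = p /\ F (s, G (s, p)) = p),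
      [/\ smooth phi, phi 0 = 0, phi 1 = 1
        & forall t, 0 <= t <= 1 -> 0 < derive1 phi t],
      forall t, 0 <= t <= 1 -> curve D' (phi t) = F (1, curve D t)
    & forall c, c \in double_points D ->
        mark D' (phi c.1, phi c.2) = mark D c].

(* Every move takes place in the square [-1, 1]^2, and replaces the pieces of  *)
(* the curve over finitely many parameter segments L.  A move performed in     *)
(* another disc is obtained by composing with planar isotopies.                *)

Definition segment := (R * R)%type.
Definition in_segment (s : segment) (t : R) : bool := s.1 <= t <= s.2.
Definition in_interior (s : segment) (t : R) : bool := s.1 < t < s.2.

Definition in_square (p : plane) : bool := (`|p.1| <= 1) && (`|p.2| <= 1).
Definition in_open_square (p : plane) : bool := (`|p.1| < 1) && (`|p.2| < 1).

Definition meets_square_along (L : seq segment) (g : R -> plane) : Prop :=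
  forall t, 0 <= t <= 1 ->
    in_square (g t) = has (in_segment^~ t) L /\
    (has (in_interior^~ t) L -> in_open_square (g t)).

Record local_change (L : seq segment) (D D' : sdiagram) : Prop := {
  lc_segments : all (fun s => [&& 0 < s.1, s.1 < s.2 & s.2 < 1]) L;
  lc_disjoint : pairwise (fun s s' => (s.2 < s'.1) || (s'.2 < s.1)) L;
  lc_square : meets_square_along L (curve D);
  lc_square' : meets_square_along L (curve D');
  lc_curve : forall t, 0 <= t <= 1 -> ~~ has (in_interior^~ t) L ->
    curve D' t = curve D t;
  lc_mark : forall c, c \in double_points D -> ~~ has (in_segment^~ c.1) L ->
    mark D' c = mark D c }.

(* The double points of D in the square.                                       *)
Definition inner (L : seq segment) (D : sdiagram) : {fset R * R} :=
  [fset c in double_points D | has (in_segment^~ c.1) L].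

(* The piece of g over s crosses the square from one vertical side to the      *)
(* other one (in either direction) as a graph over the x-axis.                 *)
Definition strand (g : R -> plane) (s : segment) : Prop :=
  [/\ `|(g s.1).1| = 1, `|(g s.2).1| = 1
    & forall t, in_segment s t -> (velocity g t).1 != 0 /\ `|(g t).2| < 1].

Definition strands (L : seq segment) (D : sdiagram) : Prop :=
  forall s, s \in L -> strand (curve D) s.

(* At c, the strand s passes over the strand s'; resp. meets s' singularly.    *)
Definition over_at (D : sdiagram) (s s' : segment) (c : R * R) : bool :=
  [&& c \in double_points D, mark D c != None,
      in_segment s (over_under D c).1 & in_segment s' (over_under D c).2].

Definition sing_at (D : sdiagram) (s s' : segment) (c : R * R) : bool :=
  [&& c \in double_points D, mark D c == None
    & (in_segment s c.1 && in_segment s' c.2)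
      || (in_segment s' c.1 && in_segment s c.2)].

(* The parameter at which the strand s goes through c.                         *)
Definition param_on (s : segment) (c : R * R) : R :=
  if in_segment s c.1 then c.1 else c.2.

Definition before (s : segment) (c e : R * R) : bool :=
  param_on s c < param_on s e.

(* The arc in the square has exactly one double point, a crossing, in D, and   *)
(* none in D': by Schoenflies this is a kink, of any of the four types.        *)
Definition Omega1 (D D' : sdiagram) : Prop :=
  exists (s : segment) (c : R * R),
  [/\ local_change [:: s] D D', inner [:: s] D = [fset c],
      mark D c != None & inner [:: s] D' = fset0].

Definition Omega2 (D D' : sdiagram) : Prop :=
  exists (s1 s2 : segment) (c e : R * R), let L := [:: s1; s2] in
  [/\ local_change L D D', strands L D /\ strands L D',
      c != e /\ inner L D = [fset c; e],
      over_at D s1 s2 c && over_at D s1 s2 e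
    & inner L D' = fset0].

(* Three strands pairwise meeting once, the kind of the three double points    *)
(* being prescribed; the move is the passage of each strand across the double  *)
(* point of the other two, so that it meets these in the opposite order.       *)
Definition triangle_move
    (k12 k13 k23 : sdiagram -> segment -> segment -> R * R -> bool)
    (D D' : sdiagram) : Prop :=
  exists (s1 s2 s3 : segment) (c12 c13 c23 c12' c13' c23' : R * R),
  let L := [:: s1; s2; s3] in
  [/\ local_change L D D', strands L D /\ strands L D',
      [/\ inner L D = [fset c12; c13; c23],
          k12 D s1 s2 c12, k13 D s1 s3 c13 & k23 D s2 s3 c23],
      [/\ inner L D' = [fset c12'; c13'; c23'],
          k12 D' s1 s2 c12', k13 D' s1 s3 c13' & k23 D' s2 s3 c23']
    & [/\ before s1 c12 c13 = before s1 c13' c12',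
          before s2 c12 c23 = before s2 c23' c12'
        & before s3 c13 c23 = before s3 c23' c13']].

Definition Omega3 := triangle_move over_at over_at over_at.

Definition sing_under_arc := triangle_move over_at over_at sing_at.
Definition sing_over_arc := triangle_move sing_at over_at over_at.

(* Two strands bounding a bigon with one crossing and one singular corner; the *)
(* crossing goes to the other side of the singular one.  Turning the singular  *)
(* crossing over exchanges the two strands there, hence the overpassing one    *)
(* changes while the sign of the crossing does not.                            *)
Definition sing_slide (D D' : sdiagram) : Prop :=
  exists (s1 s2 : segment) (c e c' e' : R * R), let L := [:: s1; s2] in
  [/\ local_change L D D', strands L D /\ strands L D',
      [/\ inner L D = [fset c; e], over_at D s1 s2 c & sing_at D s1 s2 e],
      [/\ inner L D' = [fset c'; e'], over_at D' s2 s1 c' & sing_at D' s1 s2 e']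
    & before s1 c e = before s1 e' c'].

Definition reidemeister_move (D D' : sdiagram) : Prop :=
  [\/ planar_isotopy D D', Omega1 D D', Omega2 D D' | Omega3 D D'].

Definition sing_move (D D' : sdiagram) : Prop :=
  [\/ reidemeister_move D D', sing_under_arc D D', sing_over_arc D D'
    | sing_slide D D'].

Definition knotoid_equiv : diagram -> diagram -> Prop :=
  clos_refl_sym_trans diagram (fun D D' => reidemeister_move D D').

Definition sing_knotoid_equiv : sdiagram -> sdiagram -> Prop :=
  clos_refl_sym_trans sdiagram sing_move.

(* [w] is the extension of the knotoid invariant [v] to singular knotoids; the *)
(* second and third conditions determine it from [v].                          *)
Definition vassiliev_of_order (A : zmodType) (v : diagram -> A) (n : nat) :
    Prop :=
  (forall D D', knotoid_equiv D D' -> v D = v D') /\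
  exists w : sdiagram -> A,
  [/\ (forall D D', sing_knotoid_equiv D D' -> w D = w D'),
      (forall D : diagram, w D = v D),
      (forall D c, c \in singular D ->
         w D = w (resolve D c true) - w (resolve D c false)),
      (forall D, (n < #|` singular D|)%N -> w D = 0)
    & exists D, #|` singular D| = n /\ w D != 0].

(* The arc of the circle is [0, 1], and a chord is the pair of its starting    *)
(* (over) and end (under) points.                                              *)
Record gauss_diagram := GaussDiagram {
  chords : {fset R * R};
  chord_sign : R * R -> int }.

Definition gauss_of (D : diagram) : gauss_diagram :=
  GaussDiagram [fset over_under D c | c in double_points D]
    (fun c => crossing_sign (curve D) c.1 c.2).

(* As the arc is oriented counterclockwise, the right side of a chord c is     *)
(* bounded by the part of the circle going counterclockwise from c.1 to c.2.   *)
Definition on_right (c : R * R) (x : R) : bool :=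
  if c.1 < c.2 then c.1 < x < c.2 else (x < c.2) || (c.1 < x).

Definition on_left (c : R * R) (x : R) : bool := on_right (c.2, c.1) x.

Section Index.
Variable G : gauss_diagram.
Local Notation sgn := (chord_sign G).

Definition r_set (c : R * R) : {fset R * R} :=
  [fset e in chords G | [&& e != c, on_left c e.1 & on_right c e.2]].

Definition l_set (c : R * R) : {fset R * R} :=
  [fset e in chords G | [&& e != c, on_right c e.1 & on_left c e.2]].

Definition degree (c : R * R) : int :=
  #|` [fset e in r_set c | sgn e == 1%R]|%:Z
  - #|` [fset e in r_set c | sgn e == (-1)%R]|%:Z
  - #|` [fset e in l_set c | sgn e == 1%R]|%:Z
  + #|` [fset e in l_set c | sgn e == (-1)%R]|%:Z.

(* [<< a *g m >>] stands for a z^m.  An element of Z[z,1/z]/(z^k - 1) is       *)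
(* represented by its unique representative with exponents in {0, ..., k-1}    *)
(* (in Z if k = 0).                                                            *)
Definition laurent := {freeg int / int}.

(* [modz m 0] is m.                                                            *)
Definition phi_mod (c : R * R) (m : int) : int := modz m `|degree c|.

Definition ind_fun (c : R * R) (n : nat) : laurent :=
  \sum_(e <- r_set c | gcdz (degree c) (degree e) == n)
    << sgn e *g phi_mod c (degree e) >>
  - \sum_(e <- l_set c | gcdz (degree c) (degree e) == n)
      << sgn e *g phi_mod c (- degree e) >>.

End Index.

(* The symbols t^f: [Some (k, f)] for a non-zero element f of                  *)
(* Z[z,1/z]/(z^k - 1), and [None] for the common zero of all these groups.     *)
Definition t_symbol := option (nat * laurent).

Definition t_pow (k : nat) (f : laurent) : t_symbol :=
  if f == 0 then None else Some (k, f).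

(* Polynomials in y with coefficients in the free abelian group on the t^f:    *)
(* the free abelian group on the pairs (t^f, n), which stand for t^f y^n.      *)
Definition H_values := {freeg (t_symbol * nat) / int}.

Definition H_gauss (G : gauss_diagram) : H_values :=
  \sum_(c <- chords G) \sum_(n \in [set: nat])
    (<< (t_pow `|degree G c|%N (ind_fun G c n), n) >> - << (None, n) >> : H_values)
      *~ chord_sign G c.

Definition H_diagram (D : diagram) : H_values := H_gauss (gauss_of D).

End Diagrams.

(* Main.v *)
(* The index functions of a crossing c depend only on the flat curve and on which *)
(* of the two passages of c is the over one.  Indeed, let tau e be the sign that  *)
(* the double point e gets when its first passage is the over one, let om e = 1   *)
(* or -1 according to whether it is or not, and let lk c e be the signed linking  *)
(* number of the chords of c and e directed from the first to the second passage. *)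
(* Then sgn e = om e * tau e, the chord of e links that of c with                 *)
(* om c * om e * lk c e, and om e cancels in every term of d(c) and Ind_c.  Hence *)
(* H_D is the sum of om c * tau c * W (om c) c, where W (om c) c is a function of *)
(* the flat curve.  Resolving a singular crossing c both ways leaves              *)
(* W 1 c + W (-1) c, which no longer sees the other crossings, so that second     *)
(* differences vanish.  The extension to singular diagrams is therefore H itself, *)
(* W 1 c + W (-1) c, or 0 according to the number of singular crossings, and its  *)
(* invariance amounts to that of W under flat moves.                              *)
(* For the latter the strands of a move are graphs of functions over [-1, 1], the *)
(* sign of a crossing is that of the derivative of a difference of two of them,   *)
(* and all that is needed follows from the intermediate value theorem.  For       *)
(* Omega3 the degrees of the three crossings satisfy d(13) = d(12) + d(23), hence *)
(* have the same pairwise gcds, and two of them agree up to sign modulo the third *)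
(* one.                                                                           *)
Require Import Defs.
From mathcomp Require Import reals cardinality realfun.
From mathcomp Require Import lra ring.

Set Implicit Arguments.
Unset Strict Implicit.
Unset Printing Implicit Defensive.

Import Order.TTheory GRing.Theory Num.Theory.
Import numFieldNormedType.Exports.

Local Open Scope fset_scope.
Local Open Scope ring_scope.

(** * Linking numbers, flat indices and the formula for H *)

Section FlatIndex.
Variable R : realType.
Implicit Types c e : R * R.

(** Write H as a sum over crossings of sign times weight ([H_diagramE]). The weight of a crossing is
    built from linking numbers and from the signs of flat crossings, and involves over/under
    information only through the crossing itself ([gauss_degree], [gauss_ind]). Changing one
    crossing therefore changes one summand only: the skein difference at [c] is the sum of the two
    weights of [c], and it ignores the other crossings ([H_extension_skein]). Hence the order is at
    most one. It is exactly one because two linked chords, one of them singular, give a value whose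
    coefficient at [t^0 y] is -2 ([linked_pair_extension]), and an explicit polynomial curve has
    such a pair.

    The work lies in the invariance of the extension under all moves. [H_extension_local] reduces a
    move to two facts: the weights of the crossings outside the square do not change, and the
    crossings inside contribute the same total. The combinatorial reasons are these. The chord of a
    kink links nothing. The corners of a bigon are parallel chords of opposite flat signs, so they
    cancel in every other degree and index, and they have equal weights ([bigon_outer], [bigon_sym],
    [bigon_slide]). In a triangle one degree is the sum of the other two. In the index of one corner
    the other two corners thus come with the same gcd and congruent exponents. They merge into one
    monomial, whose coefficient the move preserves ([triangle_a], [triangle_b], [triangle_c]).

    The geometric input is that a flat sign is, up to the directions of the two strands, the sign of
    the slope of their height difference ([crossingP]). Consecutive zeros then have opposite signs,
    and the leftmost crossing keeps its sign because the move fixes the strands at their ends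
    ([first_flat_sign]). Under a planar isotopy the Jacobian determinant starts at 1 and never
    vanishes ([slice_det_gt0]), so flat signs are preserved. *)

Definition reverse_chord c : R * R := (c.2, c.1).

Definition disjoint_ends c e : bool :=
  [&& c.1 != e.1, c.1 != e.2, c.2 != e.1 & c.2 != e.2].

(* [e in r(c)] - [e in l(c)].  The guard, which only matters for e equal to c    *)
(* or to its reverse, makes this antisymmetric without any assumption.           *)
Definition linking c e : int :=
  if disjoint_ends c e then
    (c.1 < e.2)%R%:Z - (c.2 < e.2)%R%:Z - (c.1 < e.1)%R%:Z + (c.2 < e.1)%R%:Z
  else 0.

Lemma linking_revl c e : linking (reverse_chord c) e = - linking c e.
Proof.
rewrite /linking /disjoint_ends /=.
by do 4 case: (_ != _) => //=; ring.
Qed.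

Lemma linking_revr c e : linking c (reverse_chord e) = - linking c e.
Proof.
rewrite /linking /disjoint_ends /=.
by do 4 case: (_ != _) => //=; ring.
Qed.

Lemma linkingC c e : linking e c = - linking c e.
Proof.
rewrite /linking /disjoint_ends.
rewrite (eq_sym e.1 c.1) (eq_sym e.1 c.2) (eq_sym e.2 c.1) (eq_sym e.2 c.2).
by case: (ltgtP c.1 e.1) => // _; case: (ltgtP c.1 e.2) => // _;
  case: (ltgtP c.2 e.1) => // _; case: (ltgtP c.2 e.2).
Qed.

Lemma linking_self c : linking c c = 0.
Proof. by rewrite /linking /disjoint_ends eqxx. Qed.

Section Data.
Variables (X : seq (R * R)) (tau : R * R -> int).
Implicit Types s : int.

(** Up to the over sign of [c] this is the degree in the Gauss diagram: the over sign of [e] enters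
    both the linking number and the sign of [e], and squares to 1. *)
Definition flat_degree c : int := \sum_(e <- X) linking c e * tau e.

(* Here s stands for the over_sign of c.                                          *)
Definition flat_term s c e : laurent :=
  << s * (linking c e * tau e)
     *g modz (s * (linking c e * flat_degree e)) `|flat_degree c| >>.

Definition flat_ind s c (n : nat) : laurent :=
  \sum_(e <- X | gcdz (flat_degree c) (flat_degree e) == n) flat_term s c e.

(** A summand with zero index is [t^0 - 1 = 0], so only the finitely many [n] occurring as gcds can
    contribute. *)
Definition flat_weight s c : H_values :=
  \sum_(n \in [set: nat])
    (<< (t_pow `|flat_degree c|%N (flat_ind s c n), n) >> - << (None, n) >>
     : H_values).

Lemma flat_degree_rev c : flat_degree (reverse_chord c) = - flat_degree c.
Proof.
rewrite /flat_degree -sumrN; apply: eq_bigr => e _.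
by rewrite linking_revl mulNr.
Qed.

Lemma flat_term_revl s c e : flat_term s (reverse_chord c) e = flat_term (- s) c e.
Proof.
by rewrite /flat_term linking_revl flat_degree_rev normrN !mulNr !mulrN.
Qed.

Lemma flat_term_revr s c e : tau (reverse_chord e) = - tau e ->
  flat_term s c (reverse_chord e) = flat_term s c e.
Proof.
by move=> te; rewrite /flat_term linking_revr flat_degree_rev te !mulrNN.
Qed.

Lemma flat_ind_rev s c n : flat_ind s (reverse_chord c) n = flat_ind (- s) c n.
Proof.
rewrite /flat_ind flat_degree_rev; apply: eq_big => [e|e _].
  by rewrite gcdNz.
exact: flat_term_revl.
Qed.

Lemma flat_weight_rev s c :
  flat_weight s (reverse_chord c) = flat_weight (- s) c.
Proof.
rewrite /flat_weight flat_degree_rev abszN; apply: eq_fsbigr => n _.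
by rewrite flat_ind_rev.
Qed.

End Data.

Lemma eq_flat_weight X X' tau tau' s s' c c' :
  flat_degree X' tau' c' = flat_degree X tau c ->
  (forall n, flat_ind X' tau' s' c' n = flat_ind X tau s c n) ->
  flat_weight X' tau' s' c' = flat_weight X tau s c.
Proof.
by move=> dE iE; rewrite /flat_weight dE; apply: eq_fsbigr => n _; rewrite iE.
Qed.

(** Both sums run over the same support, since negation preserves being non-zero. *)
Lemma fsumrN (T : choiceType) (V : zmodType) (F : T -> V) (D : set T) :
  \sum_(n \in D) - F n = - \sum_(n \in D) F n.
Proof.
rewrite -sumrN; congr (bigop _ _ _).
rewrite /finite_support !unlock; congr (fset_set (_ `&` _)%classic).
apply/seteqP; split => x /=; rewrite /preimage/= => H E; apply: H.
  by rewrite E oppr0.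
by apply: oppr_inj; rewrite oppr0.
Qed.

Lemma fsumr_sign (T : choiceType) (V : zmodType) (F : T -> V) (D : set T) (m : int) :
  m = 1 \/ m = -1 -> \sum_(n \in D) (F n *~ m) = (\sum_(n \in D) F n) *~ m.
Proof.
case=> ->; first by under eq_fsbigr do rewrite mulr1z; rewrite mulr1z.
under eq_fsbigr do rewrite mulrN1z.
by rewrite fsumrN mulrN1z.
Qed.

Lemma gt_neq (x y : R) : x != y -> (y < x) = ~~ (x < y).
Proof. by move=> xy; rewrite -leNgt lt_neqAle eq_sym xy. Qed.

Lemma linkingE c e : c.1 != c.2 -> disjoint_ends c e ->
  linking c e = (on_left c e.1 && on_right c e.2)%:Z
                - (on_right c e.1 && on_left c e.2)%:Z.
Proof.
move=> cc; rewrite /linking => ce; rewrite ce; case/and4P: ce.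
rewrite /on_left /on_right /= => n11 n12 n21 n22.
rewrite !(gt_neq n11, gt_neq n12, gt_neq n21, gt_neq n22) (gt_neq cc).
have tr1 x : c.1 < c.2 -> (c.2 < x) ==> (c.1 < x).
  by move=> h; apply/implyP; apply: lt_trans.
have tr2 x : ~~ (c.1 < c.2) -> (c.1 < x) ==> (c.2 < x).
  rewrite -(gt_neq cc) => h; apply/implyP; exact: lt_trans.
case: ltP tr1 tr2 => _ /= tr1 tr2.
  move: (tr1 e.1 isT) (tr1 e.2 isT).
  by do 4 case: (_ < _).
by move: (tr2 e.1 isT) (tr2 e.2 isT); do 4 case: (_ < _).
Qed.

Lemma on_left_right c (x : R) : c.1 != c.2 -> on_left c x -> ~~ on_right c x.
Proof.
rewrite /on_left /on_right /=; case: ltgtP => //= c12 _.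
  by case/andP=> a b; apply/negP => /orP[] h; [have := lt_trans a h|have := lt_trans b h];
    rewrite ltxx.
by case/orP=> h; apply/negP => /andP[a b]; [have := lt_trans a h|have := lt_trans b h];
  rewrite ltxx.
Qed.

End FlatIndex.

(** * From Gauss diagrams to flat data *)

Section Chords.
Variable R : realType.
Implicit Types (D : sdiagram R) (c e : R * R).

Definition flat_sign D c : int := crossing_sign (curve D) c.1 c.2.

Definition over_sign D c : int := if mark D c == Some true then 1 else -1.

Definition weight D := flat_weight (double_points D) (flat_sign D).

Lemma double_pointP D c : c \in double_points D ->
  [/\ 0 < c.1, c.1 < c.2, c.2 < 1 & curve D c.1 = curve D c.2].
Proof.
move=> cD; have gi := curve_generic D.
have [? ?] := gi_ends gi cD.
have := (gi_double gi c.1 c.2).1; rewrite -surjective_pairing.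
by move=> /(_ cD)[].
Qed.

Lemma double_point_neq D c : c \in double_points D -> c.1 != c.2.
Proof. by move=> /double_pointP[_ + _ _]; rewrite lt_neqAle => /andP[]. Qed.

Lemma double_points_disjoint D c e : c \in double_points D ->
  e \in double_points D -> c != e -> disjoint_ends c e.
Proof.
move=> cD eD ce; have nt := gi_no_triple (curve_generic D).
have [_ _ _ gc] := double_pointP cD; have [_ _ _ ge] := double_pointP eD.
by apply/and4P; split; apply: contra ce => /eqP E; apply/eqP;
  apply: nt => //; rewrite ?E // ?ge ?E // ?gc ?E // -?ge -?E -?gc.
Qed.

Lemma det2C (v w : R * R) : det2 w v = - det2 v w.
Proof. by rewrite /det2 opprB (mulrC v.2) (mulrC v.1). Qed.

Lemma crossing_signC (g : R -> R * R) (s t : R) :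
  det2 (velocity g s) (velocity g t) != 0 ->
  crossing_sign g t s = - crossing_sign g s t.
Proof.
rewrite /crossing_sign; move: (det2C (velocity g s) (velocity g t)).
move: (det2 (velocity g t) _) (det2 (velocity g s) _) => x y -> y0.
by rewrite oppr_gt0; case: ltgtP y0 => //; rewrite ?opprK.
Qed.

Lemma flat_sign_rev D c : c \in double_points D ->
  flat_sign D (reverse_chord c) = - flat_sign D c.
Proof.
by move=> cD; apply: crossing_signC; apply: gi_transverse (curve_generic D) _ cD.
Qed.

Lemma flat_sign_unit D c : flat_sign D c = 1 \/ flat_sign D c = -1.
Proof. by rewrite /flat_sign /crossing_sign; case: ifP; [left|right]. Qed.

Lemma over_sign_unit D c : over_sign D c = 1 \/ over_sign D c = -1.
Proof. by rewrite /over_sign; case: ifP; [left|right]. Qed.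

Lemma over_under_linking D c e :
  linking (over_under D c) (over_under D e) =
  over_sign D c * over_sign D e * linking c e.
Proof.
rewrite /over_under /over_sign.
case: ifP => _; case: ifP => _; rewrite ?(linking_revl c) ?linking_revr ?linking_revl;
  by rewrite ?mul1r ?mulN1r ?opprK ?mulrNN ?mul1r.
Qed.

Lemma over_under_sign D c : c \in double_points D ->
  flat_sign D (over_under D c) = over_sign D c * flat_sign D c.
Proof.
move=> cD; rewrite /over_under /over_sign; case: ifP => _; rewrite ?mul1r //.
by rewrite (flat_sign_rev cD) mulN1r.
Qed.

Lemma over_under_inj D :
  {in double_points D &, injective (over_under D)}.
Proof.
move=> [c1 c2] [e1 e2] /double_pointP[_ /= c12 _ _] /double_pointP[_ /= e12 _ _].
by rewrite /over_under; case: ifP => _; case: ifP => _ [] // E1 E2; subst=> //;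
  have := lt_trans c12 e12; rewrite ltxx.
Qed.

Lemma over_under_neq D c : c \in double_points D ->
  (over_under D c).1 != (over_under D c).2.
Proof.
move=> cX; rewrite /over_under; case: ifP => _ /=; rewrite ?(eq_sym c.2);
  exact: double_point_neq cX.
Qed.

Section Gauss.
Variable D : diagram R.
Local Notation G := (gauss_of D).
Local Notation X := (double_points D).
Local Notation ou := (over_under D).
Local Notation tau := (flat_sign D).
Local Notation om := (over_sign D).

Lemma gauss_sum (V : nmodType) (P : pred (R * R)) (F : R * R -> V) :
  \sum_(e <- chords G | P e) F e = \sum_(e <- X | P (ou e)) F (ou e).
Proof.
rewrite big_mkcond /= big_imfset /=; last exact: over_under_inj.
by rewrite -big_mkcond.
Qed.

Lemma chords_over_under e : e \in X -> ou e \in chords G.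
Proof. by move=> eX; apply/imfsetP; exists e. Qed.

Lemma gauss_linking c e : c \in X -> e \in X ->
  (ou e \in r_set G (ou c))%:Z - (ou e \in l_set G (ou c))%:Z
  = om c * om e * linking c e.
Proof.
move=> cX eX; rewrite -over_under_linking.
rewrite !inE /= (chords_over_under eX) /=.
have [->|ec] := eqVneq e c; first by rewrite eqxx /= linking_self subrr.
have -> /= : ou e != ou c.
  by apply: contra ec => /eqP/(over_under_inj eX cX) ->.
rewrite linkingE //.
  exact: over_under_neq.
have := double_points_disjoint cX eX; rewrite eq_sym => /(_ ec).
rewrite /disjoint_ends /over_under.
by case: ifP => _; case: ifP => _ /= /and4P[-> -> -> ->].
Qed.

(** Puts the two sums of a degree or an index into one sum over all chords, where membership in
    [r_set] and [l_set] can be traded for a linking number. *)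
Lemma gauss_split (V : zmodType) (P : pred (R * R)) (F F' : R * R -> V) c :
  \sum_(e <- r_set G c | P e) F e - \sum_(e <- l_set G c | P e) F' e =
  \sum_(e <- chords G | P e)
     ((if e \in r_set G c then F e else 0) - (if e \in l_set G c then F' e else 0)).
Proof.
rewrite [X in X - _ = _]big_mkcond [X in _ - X = _]big_mkcond [RHS]big_mkcond.
rewrite /r_set /l_set !big_fset /= ![X in X - _ = _]big_mkcond.
rewrite ![X in _ - X = _]big_mkcond -sumrB /= !big_seq /=.
apply: eq_bigr => e eG; rewrite !inE eG /=.
by case: (P e); do 2 case: ifP => _; rewrite ?subrr ?subr0 ?sub0r.
Qed.

Lemma gauss_degree c : c \in X ->
  degree G (ou c) = om c * flat_degree X tau c.
Proof.
move=> cX; have signed (A : {fset R * R}) :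
    #|` [fset e in A | chord_sign G e == 1]|%:Z
    - #|` [fset e in A | chord_sign G e == -1]|%:Z = \sum_(e <- A) chord_sign G e.
  rewrite !card_fset_sum1 !big_fset /= -!natz !natr_sum /=.
  rewrite [X in X - _]big_mkcond [X in _ - X]big_mkcond -sumrB.
  apply: eq_bigr => e _; rewrite /crossing_sign; by case: (0 < _)%R; rewrite /= ?subr0 ?sub0r.
transitivity (\sum_(e <- r_set G (ou c)) chord_sign G e
              - \sum_(e <- l_set G (ou c)) chord_sign G e).
  by rewrite -!signed /degree; ring.
rewrite gauss_split gauss_sum /flat_degree mulr_sumr; apply: eq_big_seq => e eX.
transitivity (chord_sign G (ou e) * ((ou e \in r_set G (ou c))%:Z
                                     - (ou e \in l_set G (ou c))%:Z)).
  by do 2 case: ifP => _; rewrite ?subrr ?subr0 ?sub0r ?mulr1 ?mulr0 ?mulrN1.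
rewrite gauss_linking// [chord_sign _ _]over_under_sign//.
case: (over_sign_unit D e) => ->; ring.
Qed.

Lemma gauss_ind c n : c \in X ->
  ind_fun G (ou c) n = flat_ind X tau (om c) c n.
Proof.
move=> cX; rewrite /ind_fun /phi_mod gauss_degree//.
(* With [k e] equal to 1 on r, -1 on l and 0 elsewhere, both kinds of terms of the index take the
   common shape k sgn(e) z^(k d(e)). *)
pose k e : int := (e \in r_set G (ou c))%:Z - (e \in l_set G (ou c))%:Z.
transitivity (\sum_(e <- chords G | gcdz (om c * flat_degree X tau c) (degree G e) == n)
  << k e * chord_sign G e
    *g modz (k e * degree G e) `|om c * flat_degree X tau c| >> : laurent).
  rewrite gauss_split; apply: eq_bigr => e _.
  have : ~~ ((e \in r_set G (ou c)) && (e \in l_set G (ou c))).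
    rewrite !inE; apply/negP => /andP[/and4P[_ _ l1 _] /and4P[_ _ r1 _]].
    by have := on_left_right (over_under_neq cX) l1; rewrite r1.
  rewrite /k; case: (_ \in _); case: (_ \in _) => //= _; rewrite ?subr0 ?sub0r ?mul1r ?mulN1r //.
  + by rewrite freegUN.
  + by rewrite mul0r freegU0.
rewrite gauss_sum /flat_ind [LHS]big_seq_cond [RHS]big_seq_cond.
have gE e : gcdz (om c * flat_degree X tau c) (om e * flat_degree X tau e)
            = gcdz (flat_degree X tau c) (flat_degree X tau e).
  by case: (over_sign_unit D c) => ->; case: (over_sign_unit D e) => ->;
     rewrite ?mul1r ?mulN1r ?gcdNz ?gcdzN.
apply: eq_big => [e|e /andP[eX _]].
  by case: (boolP (e \in X)) => //= eX; rewrite gauss_degree// gE.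
rewrite /flat_term /k gauss_linking// gauss_degree// [chord_sign _ _]over_under_sign//.
congr << _ *g _ >>; first by case: (over_sign_unit D e) => ->; ring.
congr modz; first by case: (over_sign_unit D e) => ->; ring.
by case: (over_sign_unit D c) => ->; rewrite ?mul1r // mulN1r normrN.
Qed.

Lemma H_diagramE :
  H_diagram D = \sum_(c <- X) weight D (om c) c *~ (om c * tau c).
Proof.
rewrite /H_diagram /H_gauss gauss_sum; apply: eq_big_seq => c cX.
rewrite fsumr_sign; last by rewrite /=; exact: flat_sign_unit.
congr (_ *~ _); last by rewrite [LHS]over_under_sign.
apply: eq_fsbigr => n _; rewrite gauss_ind// gauss_degree//.
by rewrite abszM; case: (over_sign_unit D c) => ->; rewrite ?mul1n.
Qed.

End Gauss.
End Chords.

(** * Kinks and bigons *)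

Section FlatInvariance.
Variable R : realType.
Implicit Types (c e x a b : R * R) (X Y : seq (R * R)) (tau : R * R -> int).

(** The weight sees chords only through linking numbers and signs. A planar isotopy relabels the
    chords in this way. *)
Lemma flat_weight_morph f X X' tau tau' s c :
    perm_eq X' (map f X) ->
    {in X, forall e, linking (f c) (f e) = linking c e} ->
    {in X &, forall e e', linking (f e) (f e') = linking e e'} ->
    {in X, forall e, tau' (f e) = tau e} ->
  flat_weight X' tau' s (f c) = flat_weight X tau s c.
Proof.
move=> XE lc lX tE.
have dE c0 : {in X, forall e, linking (f c0) (f e) = linking c0 e} ->
    flat_degree X' tau' (f c0) = flat_degree X tau c0.
  move=> l0; rewrite /flat_degree (perm_big _ XE) big_map.
  by apply: eq_big_seq => e eX; rewrite l0// tE.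
apply: eq_flat_weight => [|n]; first exact: dE.
rewrite /flat_ind (perm_big _ XE) big_map /flat_term (dE c lc).
rewrite [LHS]big_seq_cond [RHS]big_seq_cond; apply: eq_big => e.
  case eX : (e \in X) => //=; rewrite dE// => e' e'X.
  exact: lX.
by move=> /andP[eX _]; rewrite dE ?lc ?tE// => e' e'X; exact: lX.
Qed.

Lemma perm_flat_weight X X' tau tau' s c : perm_eq X' X -> {in X, tau' =1 tau} ->
  flat_weight X' tau' s c = flat_weight X tau s c.
Proof. by move=> XE tE; apply: (@flat_weight_morph id); rewrite ?map_id. Qed.

(** Reversing [x] negates its linking numbers, its sign and its degree, and these enter each term in
    pairs. Chords may thus be directed from strand to strand instead of by time. *)
Lemma flat_weight_flip x X tau s c : tau (reverse_chord x) = - tau x ->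
  flat_weight (reverse_chord x :: X) tau s c = flat_weight (x :: X) tau s c.
Proof.
move=> tx.
have dE y : flat_degree (reverse_chord x :: X) tau y = flat_degree (x :: X) tau y.
  by rewrite /flat_degree !big_cons linking_revr tx mulrNN.
have tE y y' : flat_term (reverse_chord x :: X) tau s y y' = flat_term (x :: X) tau s y y'.
  by rewrite /flat_term !dE.
apply: eq_flat_weight => [|n]; first exact: dE.
rewrite /flat_ind !big_cons !dE flat_degree_rev gcdzN.
congr (if _ then _ + _ else _); do ?[by apply: eq_big => [e|e _]; rewrite ?dE ?tE].
by rewrite tE flat_term_revr.
Qed.

Lemma flat_weight0 X tau s c : flat_degree X tau c = 0 ->
  (forall n, flat_ind X tau s c n = 0) -> flat_weight X tau s c = 0.
Proof.
move=> d0 i0; rewrite /flat_weight; apply: fsbig1 => n _.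
by rewrite i0 d0 /t_pow eqxx subrr.
Qed.

Lemma kink_outer c Y tau s x : {in Y, forall y, linking y c = 0} -> x \in Y ->
  flat_weight (c :: Y) tau s x = flat_weight Y tau s x.
Proof.
move=> l0 xY.
have dE y : y \in Y -> flat_degree (c :: Y) tau y = flat_degree Y tau y.
  by move=> yY; rewrite /flat_degree big_cons l0// mul0r add0r.
apply: eq_flat_weight => [|n]; first exact: dE.
rewrite /flat_ind big_cons /flat_term l0// mul0r mulr0 freegU0 add0r if_same.
rewrite (dE x)// [LHS]big_seq_cond [RHS]big_seq_cond.
apply: eq_big => e; first by case eY : (e \in Y) => //=; rewrite dE.
by move=> /andP[eY _]; rewrite dE.
Qed.

Lemma kink_inner c Y tau s : {in Y, forall y, linking y c = 0} ->
  flat_weight (c :: Y) tau s c = 0.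
Proof.
move=> l0; have l0' y : y \in c :: Y -> linking c y = 0.
  rewrite inE => /predU1P[->|yY]; first exact: linking_self.
  by rewrite linkingC l0 ?oppr0.
apply: flat_weight0 => [|n].
  by rewrite /flat_degree big_seq big1// => e eY; rewrite l0' ?mul0r.
rewrite /flat_ind big_seq_cond big1// => e /andP[eY _].
by rewrite /flat_term l0' // mul0r mulr0 freegU0.
Qed.

Section Bigon.
Variables (Y : seq (R * R)) (c e : R * R) (tau : R * R -> int).
Hypothesis parallel : {in Y, forall y, linking c y = linking e y}.
Hypothesis opposite : tau c = - tau e.
Local Notation X := (c :: e :: Y).

Let parallel' : {in Y, forall y, linking y c = linking y e}.
Proof. by move=> y yY; rewrite linkingC parallel// -linkingC. Qed.

(** The chord [y] links both corners alike, and their signs are opposite. *)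
Lemma bigon_degree_outer y : y \in Y -> flat_degree X tau y = flat_degree Y tau y.
Proof.
move=> yY; rewrite /flat_degree !big_cons parallel'// opposite; ring.
Qed.

(** Exchanging [c] and [e] negates both their linking number and the sign, so each corner
    contributes the same to the degree of the other. *)
Lemma bigon_degree : flat_degree X tau c = flat_degree X tau e.
Proof.
rewrite /flat_degree !big_cons !linking_self (linkingC c e) opposite.
rewrite (@eq_big_seq _ _ _ _ _ _ (fun y => linking e y * tau y)); last first.
  by move=> y yY; rewrite parallel.
by ring.
Qed.

Lemma bigon_outer s y : y \in Y -> flat_weight X tau s y = flat_weight Y tau s y.
Proof.
move=> yY; apply: eq_flat_weight => [|n]; first exact: bigon_degree_outer.
rewrite /flat_ind !big_cons bigon_degree.
have -> : \sum_(j <- Y | gcdz (flat_degree X tau y) (flat_degree X tau j) == n)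
     flat_term X tau s y j =
  \sum_(j <- Y | gcdz (flat_degree Y tau y) (flat_degree Y tau j) == n)
     flat_term Y tau s y j.
  rewrite [LHS]big_seq_cond [RHS]big_seq_cond; apply: eq_big => x.
    by case xY : (x \in Y) => //=; rewrite ?(bigon_degree_outer yY) (bigon_degree_outer xY).
  by move=> /andP[xY _]; rewrite /flat_term ?(bigon_degree_outer yY) (bigon_degree_outer xY).
(* The corners have equal degrees, hence the same [n] and the same exponent, and opposite
   coefficients. *)
case: (_ == _) => //; rewrite addrA /flat_term bigon_degree parallel'// freegUD.
by rewrite opposite !mulrN addNr freegU0 add0r.
Qed.

(** The corner [c] has the degree of [e], which is 0 modulo itself, hence the exponent 0. In this
    form the index depends on [c] only through [linking e c * tau c] and the common degree. *)
Lemma bigon_ind s n : flat_ind X tau s e n =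
  (if gcdz (flat_degree X tau e) (flat_degree X tau e) == n
   then << s * (linking e c * tau c) *g 0 >> else 0) +
  \sum_(j <- Y | gcdz (flat_degree X tau e) (flat_degree Y tau j) == n)
    << s * (linking e j * tau j)
     *g modz (s * (linking e j * flat_degree Y tau j)) `|flat_degree X tau e| >>.
Proof.
rewrite /flat_ind !big_cons bigon_degree.
have -> : flat_term X tau s e e = 0.
  by rewrite /flat_term linking_self mul0r mulr0 freegU0.
rewrite add0r if_same.
have -> : \sum_(j <- Y | gcdz (flat_degree X tau e) (flat_degree X tau j) == n)
     flat_term X tau s e j =
  \sum_(j <- Y | gcdz (flat_degree X tau e) (flat_degree Y tau j) == n)
    << s * (linking e j * tau j)
     *g modz (s * (linking e j * flat_degree Y tau j)) `|flat_degree X tau e| >>.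
  rewrite [LHS]big_seq_cond [RHS]big_seq_cond; apply: eq_big => x.
    by case xY : (x \in Y) => //=; rewrite (bigon_degree_outer xY).
  by move=> /andP[xY _]; rewrite /flat_term (bigon_degree_outer xY).
have -> : flat_term X tau s e c = << s * (linking e c * tau c) *g 0 >>.
  congr << _ *g _ >>; rewrite bigon_degree modz_abs.
  by apply/dvdz_mod0P; do 2 apply: dvdz_mull; exact: dvdzz.
by case: ifP => _; rewrite ?add0r.
Qed.

End Bigon.

Lemma bigon_sym Y c e tau s : {in Y, forall y, linking c y = linking e y} ->
  tau c = - tau e ->
  flat_weight (c :: e :: Y) tau s c = flat_weight (c :: e :: Y) tau s e.
Proof.
move=> par opp.
have par' : {in Y, forall y, linking e y = linking c y} by move=> y /par.
have opp' : tau e = - tau c by rewrite opp opprK.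
have XE : perm_eq (c :: e :: Y) (e :: c :: Y).
  by apply/permP => p /=; rewrite addnCA.
rewrite (@perm_flat_weight (e :: c :: Y) _ tau tau)//.
have dE z : flat_degree (e :: c :: Y) tau z = flat_degree (c :: e :: Y) tau z.
  by rewrite /flat_degree (perm_big _ XE).
apply: eq_flat_weight => [|n]; first by rewrite dE bigon_degree.
rewrite !bigon_ind// dE bigon_degree// -/(flat_degree _ _ _).
congr (_ + _).
  by rewrite opp linkingC mulrN mulNr.
rewrite [LHS]big_seq_cond [RHS]big_seq_cond.
by apply: eq_bigr => y /andP[yY _]; rewrite par.
Qed.

(* The corner c of the first bigon is at the place of the corner e' of the       *)
(* second one, and e at that of c'.                                              *)
Lemma bigon_slide Y c e c' e' tau tau' s : 
  {in Y, forall y, linking c y = linking e y} -> tau c = - tau e ->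
  {in Y, forall y, linking c' y = linking e' y} -> tau' c' = - tau' e' ->
  {in Y, tau' =1 tau} ->
  {in Y, forall y, linking e y = linking c' y} -> tau e = tau' c' ->
  linking e c = linking c' e' ->
  flat_weight (c' :: e' :: Y) tau' s e' = flat_weight (c :: e :: Y) tau s e.
Proof.
move=> par opp par' opp' tY ec tec lec.
have dY y : flat_degree Y tau' y = flat_degree Y tau y.
  by rewrite /flat_degree; apply: eq_big_seq => z zY; rewrite tY.
have corner : linking e' c' * tau' c' = linking e c * tau c.
  by rewrite lec (linkingC c' e') opp tec mulNr mulrN.
have dE : flat_degree (c' :: e' :: Y) tau' e' = flat_degree (c :: e :: Y) tau e.
  rewrite /flat_degree !big_cons !linking_self !mul0r !add0r.
  by rewrite corner; congr (_ + _); apply: eq_big_seq => y yY; rewrite tY// ec// par'.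
apply: eq_flat_weight => // n; rewrite !bigon_ind// dE.
rewrite corner; congr (_ + _).
rewrite [LHS]big_seq_cond [RHS]big_seq_cond; apply: eq_big => y.
  by rewrite dY.
by move=> /andP[yY _]; rewrite dY ec// par'// tY.
Qed.

End FlatInvariance.

(** * Triangles *)

Lemma freeg_mod_term (s l t d m D : int) : l = 0 \/ (D %| l * d - m)%Z ->
  << s * (l * t) *g modz (s * (l * d)) `|D| >> =
  << s * (l * t) *g modz (s * m) `|D| >> :> laurent.
Proof.
case=> [->|Dd]; first by rewrite mul0r mulr0 !freegU0.
congr << _ *g _ >>; rewrite !modz_abs; apply/eqP.
by rewrite eqz_mod_dvd -mulrBr dvdz_mull.
Qed.

(** Monomials with equal gcds and congruent exponents merge, so only the total coefficient matters.
    The index of one corner of a triangle sees the other two corners in this way. *)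
Lemma freeg_pair_term (n : nat) (s l1 t1 d1 l2 t2 d2 m D : int) :
  l1 = 0 \/ (D %| l1 * d1 - m)%Z -> l2 = 0 \/ (D %| l2 * d2 - m)%Z ->
  gcdz D d1 = gcdz D d2 ->
  (if gcdz D d1 == n then << s * (l1 * t1) *g modz (s * (l1 * d1)) `|D| >> else 0)
  + (if gcdz D d2 == n then << s * (l2 * t2) *g modz (s * (l2 * d2)) `|D| >> else 0)
  = (if gcdz D d1 == n then << s * (l1 * t1 + l2 * t2) *g modz (s * m) `|D| >> else 0)
  :> laurent.
Proof.
move=> h1 h2 <-; case: ifP => _; last by rewrite addr0.
by rewrite (freeg_mod_term _ _ h1) (freeg_mod_term _ _ h2) freegUD -mulrDr.
Qed.

Lemma term_residue (e : bool) (l q d m D : int) :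
  (D %| q * d - m)%Z -> l = e%:Z * q -> l = 0 \/ (D %| l * d - m)%Z.
Proof. by case: e => Dd ->; [right; rewrite mul1r|left; rewrite mul0r]. Qed.

Section Triangle.
(* a, b and c are the chords from the strand 1 to 2, from 1 to 3 and from 2 to 3; *)
(* u, v and w tell in which order the strands 1, 2 and 3 meet the other two, and  *)
(* k depends on the order in which the three strands are run through.            *)
Variable R : realType.
Variables (Y : seq (R * R)) (a b c a' b' c' : R * R).
Variables (tau tau' : R * R -> int) (k u v w : bool).
Local Notation X := (a :: b :: c :: Y).
Local Notation X' := (a' :: b' :: c' :: Y).
Local Notation d := (flat_degree X tau).
Local Notation d' := (flat_degree X' tau').

Hypothesis tauY : {in Y, tau' =1 tau}.
Hypothesis parY : {in Y, forall y,
  [/\ linking a' y = linking a y, linking b' y = linking b y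
    & linking c' y = linking c y]}.
Hypothesis additive : {in Y, forall y, linking b y = linking a y + linking c y}.
Hypothesis link_ab : linking a b = 1 - k%:Z - u%:Z.
Hypothesis link_ac : linking a c = v%:Z - k%:Z.
Hypothesis link_bc : linking b c = 1 - k%:Z - w%:Z.
Hypothesis link_ab' : linking a' b' = u%:Z - k%:Z.
Hypothesis link_ac' : linking a' c' = 1 - k%:Z - v%:Z.
Hypothesis link_bc' : linking b' c' = w%:Z - k%:Z.
Hypothesis tau_a : tau a = 1 \/ tau a = -1.
Hypothesis tau_b : tau b = tau a * (2 * v%:Z - 1) * (2 * w%:Z - 1).
Hypothesis tau_c : tau c = tau a * (2 * u%:Z - 1) * (2 * w%:Z - 1).
Hypothesis tau_a' : tau' a' = tau a.
Hypothesis tau_b' : tau' b' = tau b.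
Hypothesis tau_c' : tau' c' = tau c.

(** The individual linking numbers between corners may change, but their sum weighted by flat signs
    does not. This is a finite check on the order bits; the same holds at [b] and [c]. *)
Let inner_a : linking a' b' * tau' b' + linking a' c' * tau' c' =
              linking a b * tau b + linking a c * tau c.
Proof.
rewrite link_ab' link_ac' link_ab link_ac tau_b' tau_c' tau_b tau_c.
by case: tau_a => ->; case: k; case: u; case: v; case: w.
Qed.

Let inner_b : linking b' a' * tau' a' + linking b' c' * tau' c' =
              linking b a * tau a + linking b c * tau c.
Proof.
rewrite !(linkingC a b, linkingC a' b') link_ab' link_bc' link_ab link_bc.
rewrite tau_a' tau_c' tau_c.
by case: tau_a => ->; case: k; case: u; case: v; case: w.
Qed.

Let inner_c : linking c' a' * tau' a' + linking c' b' * tau' b' =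
              linking c a * tau a + linking c b * tau b.
Proof.
rewrite !(linkingC a c, linkingC a' c', linkingC b c, linkingC b' c').
rewrite link_ac' link_bc' link_ac link_bc tau_a' tau_b' tau_b.
by case: tau_a => ->; case: k; case: u; case: v; case: w.
Qed.

Let inner_sum : linking b a * tau a + linking b c * tau c =
  linking a b * tau b + linking a c * tau c
  + (linking c a * tau a + linking c b * tau b).
Proof.
rewrite !(linkingC a b, linkingC a c, linkingC b c).
rewrite link_ab link_ac link_bc tau_b tau_c.
by case: tau_a => ->; case: k; case: u; case: v; case: w.
Qed.

Let sumY z z' : {in Y, forall y, linking z' y = linking z y} ->
  \sum_(y <- Y) linking z' y * tau' y = \sum_(y <- Y) linking z y * tau y.
Proof. by move=> zz; apply: eq_big_seq => y yY; rewrite zz// tauY. Qed.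

Let par_a : {in Y, forall y, linking a' y = linking a y}.
Proof. by move=> y /parY[]. Qed.
Let par_b : {in Y, forall y, linking b' y = linking b y}.
Proof. by move=> y /parY[]. Qed.
Let par_c : {in Y, forall y, linking c' y = linking c y}.
Proof. by move=> y /parY[]. Qed.

Lemma triangle_degree_a : d' a' = d a.
Proof.
rewrite /flat_degree !big_cons !linking_self !mul0r !add0r !addrA inner_a.
by rewrite (sumY par_a).
Qed.

Lemma triangle_degree_b : d' b' = d b.
Proof.
rewrite /flat_degree !big_cons !linking_self !mul0r !add0r !addrA inner_b.
by rewrite (sumY par_b).
Qed.

Lemma triangle_degree_c : d' c' = d c.
Proof.
rewrite /flat_degree !big_cons !linking_self !mul0r !add0r !addrA inner_c.
by rewrite (sumY par_c).
Qed.

Let par_rev z z' : {in Y, forall y, linking z' y = linking z y} ->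
  {in Y, forall y, linking y z' = linking y z}.
Proof. by move=> zz y yY; rewrite linkingC zz// -linkingC. Qed.

Lemma triangle_degree_outer y : y \in Y -> d' y = d y.
Proof.
move=> yY; rewrite /flat_degree !big_cons.
rewrite (par_rev par_a)// (par_rev par_b)// (par_rev par_c)//.
rewrite tau_a' tau_b' tau_c'; do 3 congr (_ + _).
by apply: eq_big_seq => z zY; rewrite tauY.
Qed.

(** Away from the triangle, going from strand 1 to 3 amounts to going from 1 to 2 and then from 2 to
    3; the mutual contributions add up by [inner_sum]. *)
Lemma triangle_degree_sum : d b = d a + d c.
Proof.
rewrite /flat_degree !big_cons !linking_self !mul0r !add0r !addrA inner_sum.
rewrite (eq_big_seq (fun y => linking a y * tau y + linking c y * tau y)); last first.
  by move=> y yY; rewrite additive// mulrDl.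
by rewrite big_split /=; ring.
Qed.

(** A sign: each of the linking numbers of [a] with [b], [a] with [c] and [b] with [c], before and
    after the move, is 0 or [q]. *)
Let q : int := 1 - 2 * k%:Z.

Let ind3 (Z : seq (R * R)) t s x y1 y2 y3 n :
  flat_ind (y1 :: y2 :: y3 :: Z) t s x n =
  (let dd := flat_degree (y1 :: y2 :: y3 :: Z) t in
   let F e := if gcdz (dd x) (dd e) == n
              then flat_term (y1 :: y2 :: y3 :: Z) t s x e else 0 in
   F y1 + (F y2 + (F y3 + \sum_(e <- Z) F e))).
Proof. by rewrite /flat_ind big_mkcond !big_cons. Qed.

Let indY s n z z' : {in Y, forall y, linking z' y = linking z y} -> d' z' = d z ->
  \sum_(e <- Y) (if gcdz (d' z') (d' e) == n then flat_term X' tau' s z' e else 0) =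
  \sum_(e <- Y) (if gcdz (d z) (d e) == n then flat_term X tau s z e else 0).
Proof.
move=> zz dz; apply: eq_big_seq => y yY.
by rewrite /flat_term dz zz// tauY// triangle_degree_outer.
Qed.

Let term_self t s (Z : seq (R * R)) x n :
  (if gcdz (flat_degree Z t x) (flat_degree Z t x) == n then flat_term Z t s x x
   else 0) = 0.
Proof. by rewrite /flat_term linking_self mul0r mulr0 freegU0 if_same. Qed.

Lemma triangle_outer s y : y \in Y ->
  flat_weight X' tau' s y = flat_weight X tau s y.
Proof.
move=> yY; apply: eq_flat_weight => [|n]; first exact: triangle_degree_outer.
rewrite !ind3 /= (@indY _ _ y y)//; last exact: triangle_degree_outer.
rewrite /flat_term (par_rev par_a)// (par_rev par_b)// (par_rev par_c)//.
rewrite triangle_degree_outer// triangle_degree_a triangle_degree_b triangle_degree_c.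
by rewrite tau_a' tau_b' tau_c'.
Qed.

(** Modulo [d a] the degrees of [b] and [c] agree, so both terms have the exponent of [q * d c], and
    [inner_a] preserves the total coefficient. *)
Lemma triangle_a s : flat_weight X' tau' s a' = flat_weight X tau s a.
Proof.
apply: eq_flat_weight => [|n]; first exact: triangle_degree_a.
rewrite !ind3 /= !term_self !add0r !addrA (indY _ _ par_a triangle_degree_a).
congr (_ + _); rewrite /flat_term triangle_degree_a triangle_degree_b triangle_degree_c.
have gE : gcdz (d a) (d b) = gcdz (d a) (d c).
  by rewrite triangle_degree_sum gcdzDl.
have Db : (d a %| q * d b - q * d c)%Z.
  by rewrite -mulrBr triangle_degree_sum addrK dvdz_mull.
have Dc : (d a %| q * d c - q * d c)%Z by rewrite subrr dvdz0.
rewrite !(@freeg_pair_term _ _ _ _ _ _ _ _ (q * d c)) ?inner_a ?link_ab ?link_ac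
  ?link_ab' ?link_ac' //.
- by apply: (term_residue (e := k (+) ~~ u) Db); rewrite /q; case: k; case: u.
- by apply: (term_residue (e := k (+) v) Dc); rewrite /q; case: k; case: v.
- by apply: (term_residue (e := k (+) u) Db); rewrite /q; case: k; case: u.
- by apply: (term_residue (e := k (+) ~~ v) Dc); rewrite /q; case: k; case: v.
Qed.

(** Modulo [d b] the degrees of [a] and [c] are opposite. So are the non-zero values of
    [linking b a] and [linking b c], which makes the exponents congruent. *)
Lemma triangle_b s : flat_weight X' tau' s b' = flat_weight X tau s b.
Proof.
apply: eq_flat_weight => [|n]; first exact: triangle_degree_b.
rewrite !ind3 /= !term_self !add0r !addrA (indY _ _ par_b triangle_degree_b).
congr (_ + _); rewrite /flat_term triangle_degree_a triangle_degree_b triangle_degree_c.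
have gE : gcdz (d b) (d a) = gcdz (d b) (d c).
  by rewrite triangle_degree_sum gcdzC gcdzDl [RHS]gcdzC gcdzDr gcdzC.
have Da : (d b %| - q * d a - q * d c)%Z.
  by rewrite -mulNr -mulrDr -triangle_degree_sum dvdz_mull.
have Dc : (d b %| q * d c - q * d c)%Z by rewrite subrr dvdz0.
rewrite !(@freeg_pair_term _ _ _ _ _ _ _ _ (q * d c)) ?inner_b
  ?(linkingC a b) ?(linkingC a' b') ?link_ab ?link_bc ?link_ab' ?link_bc' //.
- by apply: (term_residue (e := k (+) ~~ u) Da); rewrite /q; case: k; case: u.
- by apply: (term_residue (e := k (+) ~~ w) Dc); rewrite /q; case: k; case: w.
- by apply: (term_residue (e := k (+) u) Da); rewrite /q; case: k; case: u.
- by apply: (term_residue (e := k (+) w) Dc); rewrite /q; case: k; case: w.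
Qed.

(** Modulo [d c] the degrees of [a] and [b] agree, and [c] links both of them by 0 or [- q]. *)
Lemma triangle_c s : flat_weight X' tau' s c' = flat_weight X tau s c.
Proof.
apply: eq_flat_weight => [|n]; first exact: triangle_degree_c.
rewrite !ind3 /= !term_self !add0r !addrA (indY _ _ par_c triangle_degree_c).
congr (_ + _); rewrite /flat_term triangle_degree_a triangle_degree_b triangle_degree_c.
have gE : gcdz (d c) (d a) = gcdz (d c) (d b).
  by rewrite triangle_degree_sum gcdzDr.
have Da : (d c %| - q * d a - - q * d a)%Z by rewrite subrr dvdz0.
have Db : (d c %| - q * d b - - q * d a)%Z.
  by rewrite -mulrBr triangle_degree_sum addrC addKr dvdz_mull.
rewrite !(@freeg_pair_term _ _ _ _ _ _ _ _ (- q * d a)) ?inner_c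
  ?(linkingC a c) ?(linkingC a' c') ?(linkingC b c) ?(linkingC b' c')
  ?link_ac ?link_bc ?link_ac' ?link_bc' //.
- by apply: (term_residue (e := k (+) v) Da); rewrite /q; case: k; case: v.
- by apply: (term_residue (e := k (+) ~~ w) Db); rewrite /q; case: k; case: w.
- by apply: (term_residue (e := k (+) ~~ v) Da); rewrite /q; case: k; case: v.
- by apply: (term_residue (e := k (+) w) Db); rewrite /q; case: k; case: w.
Qed.

End Triangle.

(** * Sign changes of real functions *)

Section SmoothCurve.
Local Open Scope classical_set_scope.
Local Open Scope ring_scope.
Variable R : realType.
Implicit Types (g : R -> R * R) (t : R).

Lemma smooth_differentiable (V W : normedModType R) (f : V -> W) x :
  smooth f -> differentiable f x.
Proof. by move=> /(_ 1)[h _]; exact: h. Qed.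

Lemma velocityE g t : differentiable g t -> velocity g t = 'd g t 1.
Proof. by move=> dg; rewrite /velocity derive1E deriveE. Qed.

Lemma velocity_continuous g : smooth g -> continuous (velocity g).
Proof.
move=> gs; have [_ /(_ 1)] := gs 1; rewrite /=.
have -> : (fun x => 'd g x 1) = velocity g.
  by apply/funext => t; rewrite velocityE//; exact: smooth_differentiable.
exact.
Qed.

Lemma velocity_cvg g t : differentiable g t ->
  h^-1 *: ((g \o shift t) (h *: (1 : R)) - g t) @[h --> 0^'] --> velocity g t.
Proof. by move=> dg; rewrite velocityE// -deriveE//; exact/diff_derivable. Qed.

Lemma is_derive_fst g t : differentiable g t ->
  is_derive t (1 : R) (fun t => (g t).1) (velocity g t).1.
Proof.
move=> dg; have H : h^-1 *: (((fun t => (g t).1) \o shift t) (h *: (1 : R)) - (g t).1)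
    @[h --> 0^'] --> (velocity g t).1.
  apply: (@cvg_comp _ _ _ _ (@fst R R) _ _ _ (velocity_cvg dg)).
  exact: cvg_fst.
by split; [apply/cvg_ex; eexists; exact: H|exact: cvg_lim H].
Qed.

Lemma is_derive_snd g t : differentiable g t ->
  is_derive t (1 : R) (fun t => (g t).2) (velocity g t).2.
Proof.
move=> dg; have H : h^-1 *: (((fun t => (g t).2) \o shift t) (h *: (1 : R)) - (g t).2)
    @[h --> 0^'] --> (velocity g t).2.
  apply: (@cvg_comp _ _ _ _ (@snd R R) _ _ _ (velocity_cvg dg)).
  exact: cvg_snd.
by split; [apply/cvg_ex; eexists; exact: H|exact: cvg_lim H].
Qed.

End SmoothCurve.

Section SignChange.
Local Open Scope classical_set_scope.
Local Open Scope ring_scope.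
Variable R : realType.
Implicit Types (h k : R -> R) (p q l x z : R).

Lemma same_sign_without_zero h p q : p <= q ->
    (forall x, p <= x <= q -> {for x, continuous h}) ->
    (forall x, p <= x <= q -> h x != 0) ->
  0 < h p * h q.
Proof.
move=> pq hc h0.
have hp : h p != 0 by apply: h0; rewrite lexx pq.
have hq : h q != 0 by apply: h0; rewrite lexx pq.
rewrite lt_neqAle eq_sym mulf_neq0//= leNgt; apply/negP => hpq.
have [||c /itvP cpq hc0] := @IVT _ h p q 0 pq.
- by apply: continuous_in_subspaceT => x; rewrite inE/= in_itv /= => /hc.
- move: hpq; case: (ltgtP (h p) 0) hp => // hp _; case: (ltgtP (h q) 0) hq => // hq _.
  + by rewrite ltNge mulr_le0 ?(ltW hp) ?(ltW hq).
  + by move=> _; rewrite ge_min le_max (ltW hp) (ltW hq) orbT.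
  + by move=> _; rewrite ge_min le_max (ltW hp) (ltW hq) orbT.
  + by rewrite ltNge mulr_ge0 ?(ltW hp) ?(ltW hq).
- by have := h0 c; rewrite !cpq hc0 eqxx => /(_ isT).
Qed.

(** Near [p], [h z] is [z - p] times a factor that is continuous at [p] with value [l] there, by the
    characterization of Caratheodory. *)
Lemma is_derive_sign h p l : is_derive p (1 : R) h l -> h p = 0 -> l != 0 ->
  exists2 e, 0 < e & forall z, `|z - p| < e -> z != p -> 0 < h z * (z - p) * l.
Proof.
move=> /is_derive1_caratheodory[r [hr rc rp]] hp l0.
have : \forall z \near p, 0 < r z * l.
  have : {for p, continuous (fun z => r z * l)}.
    by apply: continuousM => //; exact: cst_continuous.
  move=> /(_ _ (@lt_nbhsr R 0 (r p * l) _)); apply.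
  by rewrite rp -expr2 exprn_even_gt0.
move=> /nbhs_ballP[e /= e0 He]; exists e => // z zp znp.
have := hr z; rewrite hp subr0 => ->.
have -> : r z * (z - p) * (z - p) * l = (r z * l) * (z - p) ^+ 2 by ring.
rewrite mulr_gt0//; last by rewrite exprn_even_gt0//= subr_eq0.
by apply: He; rewrite /ball /= distrC.
Qed.

Lemma is_derive_continuous h p l : is_derive p (1 : R) h l -> {for p, continuous h}.
Proof. by move=> [hd _]; exact/differentiable_continuous/derivable1_diffP. Qed.

(** Just after [p] the function has the sign of its derivative, and without a further zero it keeps
    that sign up to [q]. *)
Lemma sg_right_of_zero h k p q : p < q ->
    (forall x, p <= x <= q -> is_derive x (1 : R) h (k x)) -> h p = 0 -> k p != 0 ->
    (forall x, p < x <= q -> h x != 0) ->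
  Num.sg (h q) = Num.sg (k p).
Proof.
move=> pq hd hp kp h0.
have [|e e0 he] := is_derive_sign (hd p _) hp kp; first by rewrite lexx ltW.
pose z := p + Num.min (e / 2) (q - p).
have zp : p < z by rewrite ltrDl lt_min subr_gt0 pq divr_gt0.
have zq : z <= q by rewrite -lerBrDl ge_min lexx orbT.
have : 0 < h z * (z - p) * k p.
  apply: he; last by rewrite gt_eqF.
  rewrite gtr0_norm ?subr_gt0// addrC addKr gt_min.
  by rewrite ltr_pdivrMr// mulr_natr mulr2n ltrDl e0.
rewrite mulrAC pmulr_lgt0 ?subr_gt0// => hz.
have : 0 < h z * h q.
  apply: same_sign_without_zero => // x /andP[zx xq].
    apply: (is_derive_continuous (hd x _)).
    by rewrite xq (le_trans (ltW zp)).
  by apply: h0; rewrite xq (lt_le_trans zp).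
move=> hzq; have hz0 : h z != 0 by apply: h0; rewrite zp zq.
have := mulr_gt0 hz hzq; rewrite mulrACA -expr2 pmulr_rgt0; last first.
  by rewrite exprn_even_gt0.
case: (ltgtP (k p) 0) kp => // kp _.
  by rewrite nmulr_rgt0// => /ltr0_sg ->; rewrite ltr0_sg.
by rewrite pmulr_rgt0// => /gtr0_sg ->; rewrite gtr0_sg.
Qed.

Lemma sg_left_of_zero h k p q : p < q ->
    (forall x, p <= x <= q -> is_derive x (1 : R) h (k x)) -> h q = 0 -> k q != 0 ->
    (forall x, p <= x < q -> h x != 0) ->
  Num.sg (h p) = - Num.sg (k q).
Proof.
move=> pq hd hq kq h0; rewrite -sgrN.
have := @sg_right_of_zero (fun x => h (- x)) (fun x => - k (- x)) (- q) (- p).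
rewrite /= !opprK; apply=> //.
- by rewrite ltrN2.
- move=> x /andP[qx xp].
  have hx : is_derive (- x) (1 : R) h (k (- x)).
    by apply: hd; rewrite lerNr xp lerNl qx.
  by rewrite -mulrN1; apply: is_derive1_comp.
- by rewrite oppr_eq0.
- by move=> x /andP[qx xp]; apply: h0; rewrite lerNr xp ltrNl qx.
Qed.

Lemma sg_single_zero h k p q z x :
    (forall x, p <= x <= q -> is_derive x (1 : R) h (k x)) ->
    (forall x, p <= x <= q -> (h x == 0) = (x == z)) -> p <= z <= q -> k z != 0 ->
    p <= x <= q -> Num.sg (h x) = Num.sg (k z) * Num.sg (x - z).
Proof.
move=> hd h0 /andP[pz zq] kz /andP[px xq].
have hz : h z = 0 by apply/eqP; rewrite h0 ?pz.
case: (ltgtP x z) => [xz|zx|->]; last by rewrite hz subrr sgr0 mulr0.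
- rewrite (ltr0_sg (x := x - z)) ?subr_lt0// mulrN1.
  apply: (sg_left_of_zero xz) => //.
    by move=> y /andP[xy yz]; apply: hd; rewrite (le_trans px)//= (le_trans yz).
  move=> y /andP[xy yz]; rewrite h0 ?lt_eqF//.
  by rewrite (le_trans px)//= (le_trans (ltW yz)).
- rewrite (gtr0_sg (x := x - z)) ?subr_gt0// mulr1.
  apply: (sg_right_of_zero zx) => //.
    by move=> y /andP[xy yz]; apply: hd; rewrite (le_trans pz)//= (le_trans yz).
  move=> y /andP[xy yz]; rewrite h0 ?gt_eqF//.
  by rewrite (le_trans pz (ltW xy)) (le_trans yz).
Qed.

(** Both slopes are compared with the sign of [h] at the midpoint. *)
Lemma sg_consecutive_zeros h k (z1 z2 : R) : z1 < z2 ->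
    (forall x, z1 <= x <= z2 -> is_derive x (1 : R) h (k x)) ->
    h z1 = 0 -> h z2 = 0 -> k z1 != 0 -> k z2 != 0 ->
    (forall x, z1 < x < z2 -> h x != 0) ->
  Num.sg (k z1) = - Num.sg (k z2).
Proof.
move=> z12 hd h1 h2 k1 k2 h0; have [m1 m2] := midf_lt z12.
set m := (z1 + z2) / 2 in m1 m2.
transitivity (Num.sg (h m)).
  symmetry; apply: (sg_right_of_zero m1) => //.
    by move=> x /andP[mx x2]; apply: hd; rewrite mx (le_trans x2)// ltW.
  by move=> x /andP[mx x2]; apply: h0; rewrite mx (le_lt_trans x2).
apply: (sg_left_of_zero m2) => //.
  by move=> x /andP[mx x2]; apply: hd; rewrite x2 (le_trans (ltW m1)).
by move=> x /andP[mx x2]; apply: h0; rewrite x2 (lt_le_trans m1).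
Qed.

(** If the common initial value is not 0, the slope at either first zero has the opposite sign. If
    it is 0, both first zeros are [p], where the slopes agree. *)
Lemma sg_first_zero h k h' k' p q z z' :
    (forall x, p <= x <= q -> is_derive x (1 : R) h (k x)) ->
    (forall x, p <= x <= q -> is_derive x (1 : R) h' (k' x)) ->
    p <= z <= q -> p <= z' <= q -> h z = 0 -> h' z' = 0 -> k z != 0 -> k' z' != 0 ->
    (forall x, p <= x < z -> h x != 0) -> (forall x, p <= x < z' -> h' x != 0) ->
    h p = h' p -> (h p = 0 -> k p = k' p) ->
  Num.sg (k z) = Num.sg (k' z').
Proof.
move=> hd hd' /andP[pz zq] /andP[pz' zq'] hz hz' kz kz' h0 h0' hp kp.
case: (eqVneq (h p) 0) => hp0.
  have E t : p <= t -> (forall x, p <= x < t -> h x != 0) -> t = p.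
    move=> pt ht; apply/eqP; rewrite eq_le pt andbT leNgt; apply/negP => pt'.
    by have := ht p; rewrite lexx pt' hp0 eqxx => /(_ isT).
  have E' t : p <= t -> (forall x, p <= x < t -> h' x != 0) -> t = p.
    move=> pt ht; apply/eqP; rewrite eq_le pt andbT leNgt; apply/negP => pt'.
    by have := ht p; rewrite lexx pt' -hp hp0 eqxx => /(_ isT).
  by rewrite (E _ pz h0) (E' _ pz' h0') kp.
have lt t (f : R -> R) : p <= t -> f t = 0 -> f p != 0 -> p < t.
  by move=> pt ft fp; rewrite lt_neqAle pt andbT; apply: contra fp => /eqP ->; rewrite ft.
apply: oppr_inj; transitivity (Num.sg (h p)).
  symmetry; apply: sg_left_of_zero => //; first exact: (lt _ h).
  by move=> x /andP[px xz]; apply: hd; rewrite px (le_trans xz).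
rewrite hp; apply: sg_left_of_zero => //; first by apply: (lt _ h') => //; rewrite -hp.
by move=> x /andP[px xz]; apply: hd'; rewrite px (le_trans xz).
Qed.

End SignChange.

(** * Strands as graphs *)

Section StrandGraph.
Local Open Scope classical_set_scope.
Local Open Scope ring_scope.
Variable R : realType.

(* The strand s of g as the graph of a function over [-1, 1]: D is its direction *)
(* and P x the parameter at which it passes over x.                              *)
Record strand_graph (g : R -> R * R) (s : R * R) (D : R) (P : R -> R) : Prop := {
  sgr_sign : D = 1 \/ D = -1;
  sgr_start : (g s.1).1 = - D;
  sgr_end : (g s.2).1 = D;
  sgr_velocity : forall t, in_segment s t -> 0 < D * (velocity g t).1;
  sgr_mono : forall t u, in_segment s t -> in_segment s u -> t < u ->
    0 < D * ((g u).1 - (g t).1);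
  sgr_range : forall t, in_segment s t -> -1 <= (g t).1 <= 1;
  sgr_param : forall x : R, -1 <= x <= 1 -> in_segment s (P x) /\ (g (P x)).1 = x;
  sgr_paramK : forall t, in_segment s t -> P (g t).1 = t;
  sgr_derive : forall x : R, -1 <= x <= 1 ->
    is_derive x (1 : R) (fun z => (g (P z)).2)
      ((velocity g (P x)).2 / (velocity g (P x)).1) }.

Lemma sg_neq_mulr_gt0 (x y : R) : x != 0 -> (0 < Num.sg x * y) = (0 < x * y).
Proof.
case: (ltgtP x 0) => // x0 _.
  by rewrite ltr0_sg// mulN1r oppr_gt0 nmulr_rgt0.
by rewrite gtr0_sg// mul1r pmulr_rgt0.
Qed.

Lemma strand_graphP g s : smooth g -> s.1 < s.2 -> strand g s ->
  exists D P, strand_graph g s D P.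
Proof.
move=> gs s12 [n1 n2 hs].
pose x t := (g t).1; pose dx t := (velocity g t).1.
have gd t : differentiable g t by exact: smooth_differentiable.
have xd t : is_derive t (1 : R) x (dx t) by exact: is_derive_fst.
have dxc : continuous dx.
  by move=> t; apply: (continuous_comp (@velocity_continuous _ _ gs t)); exact: cvg_fst.
have s11 : in_segment s s.1 by rewrite /in_segment lexx ltW.
have s22 : in_segment s s.2 by rewrite /in_segment lexx ltW.
have dx1 : dx s.1 != 0 by have [] := hs _ s11.
have dxs t : in_segment s t -> 0 < dx s.1 * dx t.
  move=> /andP[t1 t2]; have := @same_sign_without_zero R dx s.1 t t1.
  apply=> u /andP[u1 u2]; first exact: dxc.
  by have [] := hs u; rewrite // /in_segment u1 (le_trans u2).
have near_pos t : 0 < dx s.1 * dx t ->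
    exists2 e, 0 < e & forall u, `|t - u| < e -> 0 < dx s.1 * dx u.
  move=> ht.
  have : {for t, continuous (fun u => dx s.1 * dx u)}.
    by apply: (@continuousM R R (cst (dx s.1)) dx); [exact: cst_continuous|exact: dxc].
  move=> /(_ _ (@lt_nbhsr R 0 _ ht)) /nbhs_ballP[e /= e0 He].
  by exists e => // u; exact: He.
have [e1 e10 h1] := near_pos _ (dxs _ s11).
have [e2 e20 h2] := near_pos _ (dxs _ s22).
(* The strand is prolonged by [e] at both ends, with a non-vanishing horizontal velocity. Its ends
   become interior points, and the inverse [P] is differentiable also over -1 and 1. *)
pose e := Num.min e1 e2 / 2.
have e0 : 0 < e by rewrite divr_gt0 // lt_min e10.
have le1 : e < e1.
  by have : Num.min e1 e2 <= e1 by [rewrite ge_min lexx]; rewrite /e; lra.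
have le2 : e < e2.
  by have : Num.min e1 e2 <= e2 by [rewrite ge_min lexx orbT]; rewrite /e; lra.
pose a := s.1 - e; pose b := s.2 + e.
have dxab t : a <= t <= b -> 0 < dx s.1 * dx t.
  move=> /andP[at_ tb]; case: (ltP t s.1) => [ts|ts].
    by apply: h1; rewrite gtr0_norm ?subr_gt0//; move: at_; rewrite /a; lra.
  case: (ltP s.2 t) => [ts'|ts']; last by apply: dxs; rewrite /in_segment ts.
  by apply: h2; rewrite distrC gtr0_norm ?subr_gt0//; move: tb; rewrite /b; lra.
have sab t : in_segment s t -> a < t < b.
  by move=> /andP[t1 t2]; rewrite /a /b; apply/andP; split; lra.
have xc : continuous x by move=> t; apply: (is_derive_continuous (xd t)).
have mono t u : a <= t -> u <= b -> t < u -> 0 < dx s.1 * (x u - x t).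
  move=> at_ ub tu.
  have [|c /itvP ctu ->] := @MVT R x dx t u tu (fun z _ => xd z).
    by apply: continuous_subspaceT.
  rewrite mulrA mulr_gt0// ?subr_gt0//; apply: dxab.
  by rewrite (le_trans at_) ?ctu// (le_trans _ ub)// ctu.
have inj t u : a <= t <= b -> a <= u <= b -> x t = x u -> t = u.
  move=> /andP[at_ tb] /andP[au ub] xx; case: (ltgtP t u) => // h.
    by have := mono _ _ at_ ub h; rewrite xx subrr mulr0 ltxx.
  by have := mono _ _ au tb h; rewrite xx subrr mulr0 ltxx.
pose D := Num.sg (dx s.1).
have Dpos z : (0 < D * z) = (0 < dx s.1 * z) by exact: sg_neq_mulr_gt0.
have D1 : D = 1 \/ D = -1.
  rewrite /D; case: (ltgtP (dx s.1) 0) dx1 => // h _.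
    by right; rewrite ltr0_sg. by left; rewrite gtr0_sg.
(* The ends lie on vertical sides; as [x] is monotone in the direction [D], they lie on opposite
   ones. *)
have ends : x s.1 = - D /\ x s.2 = D.
  have : 0 < D * (x s.2 - x s.1).
    by rewrite Dpos mono // ?ltW //; case/andP: (sab _ s11); case/andP: (sab _ s22).
  move/eqP: n1; move/eqP: n2; rewrite -/(x _) -/(x _) !eqr_norml !ler01 !andbT.
  by case: D1 => -> /orP[] /eqP -> /orP[] /eqP ->; rewrite ?opprK; lra.
pose P z := xget s.1 [set t | a <= t <= b /\ x t = z].
have PK t : a <= t <= b -> P (x t) = t.
  move=> tab; rewrite /P; case: xgetP => [u -> [uab xu]|/(_ t)]; first exact: inj.
  by case; split.
have range t : in_segment s t -> -1 <= x t <= 1.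
  move=> ts; case/andP: (ts) => t1 t2; case: ends => e1' e2'.
  have H1 : 0 <= D * (x t + D).
    rewrite -[D in _ + D]opprK -e1' -/(x _).
    move: t1; rewrite le_eqVlt => /predU1P[->|t1]; first by rewrite subrr mulr0.
    rewrite ltW // Dpos mono //; first by case/andP: (sab _ s11) => /ltW.
    by case/andP: (sab _ ts) => _ /ltW.
  have H2 : 0 <= D * (D - x t).
    rewrite -{2}e2' -/(x _).
    move: t2; rewrite le_eqVlt => /predU1P[->|t2]; first by rewrite subrr mulr0.
    rewrite ltW // Dpos mono //; first by case/andP: (sab _ ts) => /ltW.
    by case/andP: (sab _ s22) => _ /ltW.
  by case: D1 H1 H2 => -> H1 H2; apply/andP; split; lra.
have surj z : -1 <= z <= 1 -> exists2 t, in_segment s t & x t = z.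
  move=> /andP[z1 z2].
  have [||t /itvP ts xt] := @IVT R x s.1 s.2 z (ltW s12).
  - exact: continuous_subspaceT.
  - case: ends => -> ->; rewrite ge_min le_max.
    by case: D1 => ->; rewrite ?opprK z1 z2 ?orbT.
  by exists t => //; rewrite /in_segment !ts.
have param z : -1 <= z <= 1 -> in_segment s (P z) /\ x (P z) = z.
  move=> /surj[t ts <-]; rewrite PK //.
  by case/andP: (sab _ ts) => /ltW -> /ltW ->.
exists D, P; split => //.
- exact: ends.1.
- exact: ends.2.
- by move=> t ts; rewrite Dpos dxs.
- move=> t u ts us tu; rewrite Dpos mono//; first by case/andP: (sab _ ts) => /ltW.
  by case/andP: (sab _ us) => _ /ltW.
- by move=> t ts; apply: PK; case/andP: (sab _ ts) => /ltW -> /ltW ->.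
move=> z /param[Ps Pz].
have Pab := sab _ Ps.
have dP : is_derive z (1 : R) P (dx (P z))^-1.
  rewrite -{1}Pz; apply: (@is_derive_inverse _ x).
  - have : \forall t \near P z, t \in `]a, b[.
      by apply: near_in_itvoo; rewrite in_itv.
    apply: filterS => t; rewrite in_itv /= => /andP[h1' h2'].
    by rewrite PK // !ltW.
  - by near=> t; exact: xc.
  - by have [] := hs _ Ps.
have := is_derive1_comp (is_derive_snd (gd (P z))) dP.
exact.
Unshelve. all: by end_near.
Qed.

End StrandGraph.

(** * Segments and local changes *)

Section Segments.
Variable R : realType.
Implicit Types (s : R * R) (c y : R * R) (t u z : R).

Definition segments_apart s s' := (s.2 < s'.1) || (s'.2 < s.1).

Lemma segments_apartC s s' : segments_apart s s' = segments_apart s' s.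
Proof. by rewrite /segments_apart orbC. Qed.

Lemma segments_apart_in s s' t :
  segments_apart s s' -> in_segment s t -> ~~ in_segment s' t.
Proof.
rewrite /segments_apart /in_segment => /orP[] h /andP[t1 t2]; apply/negP => /andP[t3 t4].
  by have := lt_le_trans (le_lt_trans t2 h) t3; rewrite ltxx.
by have := lt_le_trans (le_lt_trans t4 h) t1; rewrite ltxx.
Qed.

Lemma segment_lt s t z : in_segment s t -> ~~ in_segment s z -> (t < z) = (s.1 < z).
Proof.
rewrite /in_segment => /andP[t1 t2]; rewrite negb_and -!ltNge => /orP[zs|sz].
  by rewrite !ltNge (ltW zs) (le_trans (ltW zs)).
by rewrite (le_lt_trans t2 sz) (le_lt_trans (le_trans t1 t2)).
Qed.

Lemma segment_gt s t z : in_segment s t -> ~~ in_segment s z -> (z < t) = ~~ (s.1 < z).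
Proof.
move=> ts zs; rewrite -(segment_lt ts zs) -leNgt lt_neqAle; case: eqP => // zt.
by rewrite zt ts in zs.
Qed.

Lemma segments_lt s s' t u : segments_apart s s' ->
  in_segment s t -> in_segment s' u -> s.1 <= s.2 -> s'.1 <= s'.2 -> (t < u) = (s.1 < s'.1).
Proof.
move=> ss ts us' s12 s12'.
have s1s : in_segment s s.1 by rewrite /in_segment lexx.
have s1s' : in_segment s' s'.1 by rewrite /in_segment lexx.
rewrite (segment_lt ts); last by apply: segments_apart_in us'; rewrite segments_apartC.
have h := segments_apart_in ss s1s.
have ne : s.1 != s'.1 by apply: contra h => /eqP ->.
by rewrite (segment_gt us' h) (gt_neq ne) negbK.
Qed.

(** A point outside a segment compares with all its points alike. Since the right-hand side does not
    mention [c], all crossings of the same two strands are parallel as seen from outside. *)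
Lemma linking_segments s s' c y : in_segment s c.1 -> in_segment s' c.2 ->
    ~~ in_segment s y.1 -> ~~ in_segment s y.2 ->
    ~~ in_segment s' y.1 -> ~~ in_segment s' y.2 ->
  linking c y = (s.1 < y.2)%R%:Z - (s'.1 < y.2)%R%:Z
                - (s.1 < y.1)%R%:Z + (s'.1 < y.1)%R%:Z.
Proof.
move=> c1 c2 y1 y2 y1' y2'; rewrite /linking.
have ne r t z : in_segment r t -> ~~ in_segment r z -> t != z.
  by move=> rt; apply: contra => /eqP <-.
rewrite /disjoint_ends (ne s)// (ne s)// (ne s')// (ne s')//=.
by rewrite (segment_lt c1 y2) (segment_lt c1 y1) (segment_lt c2 y1') (segment_lt c2 y2').
Qed.

Definition joins s s' c :=
  (in_segment s c.1 && in_segment s' c.2) || (in_segment s' c.1 && in_segment s c.2).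

(** The chord directed away from the strand [s]. Unlike the direction by time, this allows crossings
    of two given strands to be compared without knowing which is run through first. *)
Definition orient s c := if in_segment s c.1 then c else reverse_chord c.

Lemma orientP s s' c : segments_apart s s' -> joins s s' c ->
  in_segment s (orient s c).1 /\ in_segment s' (orient s c).2.
Proof.
rewrite /joins /orient => ss; case: ifP => sc /=; last by case/andP.
by rewrite (negbTE (segments_apart_in ss sc)) /= orbF.
Qed.

Lemma param_on1 s c : param_on s c = (orient s c).1.
Proof. by rewrite /param_on /orient; case: ifP. Qed.

Lemma param_on2 s s' c : segments_apart s s' -> joins s s' c ->
  param_on s' c = (orient s c).2.
Proof.
rewrite /param_on /orient => ss j; case: ifP => sc; case: ifP => sc' //.
  by have := segments_apart_in ss sc'; rewrite sc.
by move: j; rewrite /joins sc sc'.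
Qed.

End Segments.

(** * What a local change preserves outside the square *)

Section LocalChange.
Variable R : realType.
Variables (L : seq (R * R)) (D D' : sdiagram R).
Hypothesis lc : local_change L D D'.
Implicit Types (c e : R * R) (t u : R).

Definition outer (K : seq (R * R)) (E : sdiagram R) : {fset R * R} :=
  [fset c in double_points E | ~~ has (@in_segment R ^~ c.1) K].

(** Both passages are at one point of the plane, and lying over a segment means that this point is
    in the square. *)
Lemma double_point_segments K (E : sdiagram R) c : meets_square_along K (curve E) ->
  c \in double_points E -> has (@in_segment R ^~ c.2) K = has (@in_segment R ^~ c.1) K.
Proof.
move=> sq cE; have [c0 c12 c1 gc] := double_pointP cE.
have h1 : 0 <= c.1 <= 1 by rewrite (ltW c0) ltW// (lt_trans c12).
have h2 : 0 <= c.2 <= 1 by rewrite (ltW c1) ltW// (lt_trans c0).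
by rewrite -(sq _ h1).1 -(sq _ h2).1 gc.
Qed.

Lemma interior_in_segment (s : R * R) t : in_interior s t -> in_segment s t.
Proof. by rewrite /in_segment => /andP[h1 h2]; rewrite !ltW. Qed.

Lemma not_interior K t : ~~ has (@in_segment R ^~ t) K -> ~~ has (@in_interior R ^~ t) K.
Proof.
by apply: contra => /hasP[s sK ts]; apply/hasP; exists s => //; exact: interior_in_segment.
Qed.

Lemma outer_sub K (E E' : sdiagram R) : meets_square_along K (curve E) ->
    (forall t, 0 <= t <= 1 -> ~~ has (@in_interior R ^~ t) K -> curve E' t = curve E t) ->
  {subset outer K E <= outer K E'}.
Proof.
move=> sq EE' c; rewrite !inE /= => /andP[cE cK]; rewrite cK andbT.
have [c0 c12 c1 gc] := double_pointP cE.
have h1 : 0 <= c.1 <= 1 by rewrite (ltW c0) ltW// (lt_trans c12).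
have h2 : 0 <= c.2 <= 1 by rewrite (ltW c1) ltW// (lt_trans c0).
rewrite [c]surjective_pairing; apply/(gi_double (curve_generic E')).
split=> //; [by rewrite ltW|by rewrite ltW|].
rewrite !EE' // not_interior//.
by rewrite (double_point_segments sq cE).
Qed.

Lemma outer_local : outer L D' = outer L D.
Proof.
apply/fsetP => c; apply/idP/idP; apply: outer_sub.
- exact: lc_square' lc.
- by move=> t t01 tL; rewrite (lc_curve lc).
- exact: lc_square lc.
- exact: lc_curve lc.
Qed.

Lemma local_apart s s' : s \in L -> s' \in L -> s = s' \/ segments_apart s s'.
Proof.
have := lc_disjoint lc; elim: L => // r K IH /= /andP[/allP rK pK].
rewrite !inE => /predU1P[->|sK] /predU1P[->|s'K]; [by left| | |exact: IH].
- by right; apply: rK.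
- by right; rewrite segments_apartC; apply: rK.
Qed.

Lemma local_segment s : s \in L -> [/\ 0 < s.1, s.1 < s.2 & s.2 < 1].
Proof. by move=> sL; have /allP/(_ _ sL)/and3P[] := lc_segments lc. Qed.

Lemma free_left (K : seq (R * R)) t : (forall s, s \in K -> t <= s.1 \/ s.2 < t) ->
  exists2 e, 0 < e & forall u, t - e < u < t -> ~~ has (@in_interior R ^~ u) K.
Proof.
elim: K => [|s K IH] h; first by exists 1.
have [|e e0 he] := IH; first by move=> r rK; apply: h; rewrite inE rK orbT.
have [ts|st] := h s (mem_head _ _).
  exists e => // u hu /=; rewrite negb_or he// andbT /in_interior.
  case/andP: hu => _ ut; apply/negP => /andP[su _].
  by have := lt_trans (lt_le_trans ut ts) su; rewrite ltxx.
exists (Num.min e (t - s.2)); first by rewrite lt_min e0 subr_gt0.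
move=> u /andP[hu ut] /=; rewrite negb_or; apply/andP; split.
  apply/negP => /andP[_ us]; move: hu; rewrite ltNge => /negP; apply.
  have : Num.min e (t - s.2) <= t - s.2 by rewrite ge_min lexx orbT.
  by move: us; set m := Num.min _ _; lra.
apply: he; rewrite ut andbT; apply: le_lt_trans hu.
by rewrite lerD2l lerN2 ge_min lexx.
Qed.

Lemma free_right (K : seq (R * R)) t : (forall s, s \in K -> t < s.1 \/ s.2 <= t) ->
  exists2 e, 0 < e & forall u, t < u < t + e -> ~~ has (@in_interior R ^~ u) K.
Proof.
elim: K => [|s K IH] h; first by exists 1.
have [|e e0 he] := IH; first by move=> r rK; apply: h; rewrite inE rK orbT.
have [ts|st] := h s (mem_head _ _); last first.
  exists e => // u hu /=; rewrite negb_or he// andbT /in_interior.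
  case/andP: hu => tu _; apply/negP => /andP[_ su].
  by have := lt_trans (le_lt_trans st tu) su; rewrite ltxx.
exists (Num.min e (s.1 - t)); first by rewrite lt_min e0 subr_gt0.
move=> u /andP[tu hu] /=; rewrite negb_or; apply/andP; split.
  apply/negP => /andP[us _]; move: hu; rewrite ltNge => /negP; apply.
  have : Num.min e (s.1 - t) <= s.1 - t by rewrite ge_min lexx orbT.
  by move: us; set m := Num.min _ _; lra.
apply: he; rewrite tu /=; apply: lt_le_trans hu _.
by rewrite lerD2l ge_min lexx.
Qed.

(** Otherwise [f - k] would have a simple zero at [t] and be non-zero on both sides nearby. *)
Lemma derive_one_sided (f k : R -> R) (t e l m : R) : 0 < e ->
    is_derive t (1 : R) f l -> is_derive t (1 : R) k m -> f t = k t ->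
    (forall u, t - e < u < t -> f u = k u) \/ (forall u, t < u < t + e -> f u = k u) ->
  l = m.
Proof.
move=> e0 hf hk fk side; apply/eqP; rewrite -subr_eq0; apply/negPn/negP => lm.
have hd : is_derive t (1 : R) (fun z => f z - k z) (l - m) by exact: is_deriveB.
have [|d d0 H] := is_derive_sign hd _ lm; first by rewrite fk subrr.
pose r := Num.min e d / 2.
have re : r < e.
  by have : Num.min e d <= e by [rewrite ge_min lexx]; rewrite /r; lra.
have rd : r < d.
  by have : Num.min e d <= d by [rewrite ge_min lexx orbT]; rewrite /r; lra.
have r0 : 0 < r by rewrite divr_gt0// lt_min e0.
case: side => side.
  have z1 : `|t - r - t| < d by rewrite addrAC subrr add0r normrN gtr0_norm.
  have z2 : t - r != t by rewrite lt_eqF//; lra.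
  have := H _ z1 z2; rewrite side; last by apply/andP; split; lra.
  by rewrite subrr !mul0r ltxx.
have z1 : `|t + r - t| < d by rewrite addrAC subrr add0r gtr0_norm.
have z2 : t + r != t by rewrite gt_eqF//; lra.
have := H _ z1 z2; rewrite side; last by apply/andP; split; lra.
by rewrite subrr !mul0r ltxx.
Qed.

(** At an end of a segment the curves are known to agree on one side only, but this determines the
    velocity. *)
Lemma velocity_local t : 0 < t < 1 -> ~~ has (@in_interior R ^~ t) L ->
  velocity (curve D') t = velocity (curve D) t.
Proof.
move=> /andP[t0 t1] tL.
have [e e0 side] : exists2 e, 0 < e &
    (forall u, t - e < u < t -> ~~ has (@in_interior R ^~ u) L) \/
    (forall u, t < u < t + e -> ~~ has (@in_interior R ^~ u) L).
  (* The right end of a segment is followed by an interval free of segment interiors; any other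
     point outside the interiors is preceded by one. *)
  case tE : (has (fun s => t == s.2) L).
    move/hasP : tE => [s sL /eqP ts].
    have [|e e0 he] := @free_right L t; last by exists e => //; right.
    move=> r rL; case: (local_apart sL rL) => [<-|]; first by right; rewrite ts.
    rewrite /segments_apart -ts => /orP[|rs]; [by left|right].
    by have [_ + _] := local_segment sL; rewrite -ts => /(lt_trans rs)/ltW.
  have [|e e0 he] := @free_left L t; last by exists e => //; left.
  move=> r rL; case: (leP t r.1) => [|rt]; first by left.
  right; rewrite lt_neqAle; apply/andP; split.
    by apply: contraFN tE => /eqP <-; apply/hasP; exists r.
  by rewrite leNgt; apply: contra tL => tr; apply/hasP; exists r; rewrite // /in_interior rt.
pose d := Num.min e (Num.min t (1 - t)).
have d0 : 0 < d by rewrite !lt_min e0 t0 subr_gt0.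
have [de dt dt1] : [/\ d <= e, d <= t & d <= 1 - t].
  by rewrite /d !ge_min !lexx !orbT.
have eqc : (forall u, t - d < u < t -> curve D' u = curve D u) \/
           (forall u, t < u < t + d -> curve D' u = curve D u).
  case: side => side; [left|right] => u /andP[u1 u2]; apply: (lc_curve lc).
  - by apply/andP; split; lra.
  - by apply: side; apply/andP; split; lra.
  - by apply/andP; split; lra.
  - by apply: side; apply/andP; split; lra.
have eqt : curve D' t = curve D t by apply: (lc_curve lc) => //; rewrite !ltW.
have gs := smooth_differentiable t (gi_smooth (curve_generic D)).
have gs' := smooth_differentiable t (gi_smooth (curve_generic D')).
apply: injective_projections.
  apply: (derive_one_sided d0 (is_derive_fst gs') (is_derive_fst gs)).
    by rewrite eqt.
  by case: eqc => H; [left|right] => u /H ->.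
apply: (derive_one_sided d0 (is_derive_snd gs') (is_derive_snd gs)).
  by rewrite eqt.
by case: eqc => H; [left|right] => u /H ->.
Qed.

Lemma outer_interior c : c \in outer L D ->
  [/\ c \in double_points D, ~~ has (@in_segment R ^~ c.1) L & ~~ has (@in_segment R ^~ c.2) L].
Proof.
rewrite !inE /= => /andP[cD cL]; split=> //.
by rewrite (double_point_segments (lc_square lc) cD).
Qed.

Lemma flat_sign_local c : c \in outer L D -> flat_sign D' c = flat_sign D c.
Proof.
move=> /outer_interior[cD c1 c2]; have [? ? ? _] := double_pointP cD.
rewrite /flat_sign /crossing_sign !velocity_local ?not_interior//.
  by apply/andP; split; lra.
by apply/andP; split; lra.
Qed.

Lemma mark_local c : c \in outer L D -> mark D' c = mark D c.
Proof. by move=> /outer_interior[cD c1 _]; by apply: (lc_mark lc). Qed.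

End LocalChange.

(** * Crossings of two strands as zeros of their height difference *)

Section Gap.
Variable R : realType.
Implicit Types (g : R -> R * R) (P Q : R -> R) (x : R).

Definition gap g P Q x : R := (g (P x)).2 - (g (Q x)).2.

Definition slope g (P : R -> R) x : R := (velocity g (P x)).2 / (velocity g (P x)).1.

Definition gap_slope g P Q x : R := slope g P x - slope g Q x.

End Gap.

Section StrandPair.
Variable R : realType.
Variables (D : sdiagram R) (s s' : R * R) (d d' : R) (P P' : R -> R).
Local Notation g := (curve D).
Local Notation X := (double_points D).
Hypothesis apart : segments_apart s s'.
Hypothesis bounds : 0 < s.1 /\ s.2 < 1.
Hypothesis bounds' : 0 < s'.1 /\ s'.2 < 1.
Hypothesis graph : strand_graph g s d P.
Hypothesis graph' : strand_graph g s' d' P'.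
Implicit Types (c e : R * R) (x : R).

Definition position c : R := (g (orient s c).1).1.

Lemma gap_derive x : -1 <= x <= 1 -> 
  is_derive x (1 : R) (gap g P P') (gap_slope g P P' x).
Proof.
move=> x1; have h := sgr_derive graph x1; have h' := sgr_derive graph' x1.
exact: (is_deriveB h h').
Qed.

Lemma curve_orient c : c \in X -> g (orient s c).1 = g (orient s c).2.
Proof. by move=> /double_pointP[_ _ _ gc]; rewrite /orient; case: ifP. Qed.

Lemma gap_zeroP x : -1 <= x <= 1 -> gap g P P' x = 0 ->
  exists c, [/\ c \in X, joins s s' c & orient s c = (P x, P' x)].
Proof.
move=> x1 gx; have [Ps Px] := sgr_param graph x1; have [Ps' Px'] := sgr_param graph' x1.
have gE : g (P x) = g (P' x).
  rewrite [LHS]surjective_pairing [RHS]surjective_pairing Px Px'.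
  by congr pair; apply/eqP; rewrite -subr_eq0; apply/eqP.
have PsN := segments_apart_in apart Ps.
have [/andP[a1 a2] /andP[b1 b2]] := (Ps, Ps').
have gi := gi_double (curve_generic D); move: bounds bounds' => [? ?] [? ?].
case: (ltgtP (P x) (P' x)) => h.
- exists (P x, P' x); split.
  + by apply/gi; split=> //; lra.
  + by rewrite /joins /= Ps Ps'.
  + by rewrite /orient /= Ps.
- exists (P' x, P x); split.
  + by apply/gi; split=> //; lra.
  + by rewrite /joins /= Ps Ps' orbT.
  + have apart' : segments_apart s' s by rewrite segments_apartC.
    by rewrite /orient /= (negbTE (segments_apart_in apart' Ps')).
- by rewrite h Ps' in PsN.
Qed.

Lemma orient_neq c e : c \in X -> e \in X -> c != e ->
  disjoint_ends (orient s c) (orient s e).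
Proof.
move=> cX eX ce; have := double_points_disjoint cX eX ce.
rewrite /disjoint_ends /orient.
by case: ifP => _; case: ifP => _ /and4P[-> -> -> ->].
Qed.

(** The determinant of the two velocities is minus the product of their horizontal components, of
    signs [d] and [d'], and of the difference of the slopes. *)
Lemma crossingP c : c \in X -> joins s s' c ->
  [/\ -1 <= position c <= 1, P (position c) = (orient s c).1,
      P' (position c) = (orient s c).2, gap g P P' (position c) = 0
    & gap_slope g P P' (position c) != 0 /\
      (flat_sign D (orient s c))%:~R = - (d * d' * Num.sg (gap_slope g P P' (position c)))].
Proof.
move=> cX j; have [o1 o2] := orientP apart j.
have x1 := sgr_range graph o1; rewrite -/(position c) in x1.
have P1 : P (position c) = (orient s c).1 by exact: sgr_paramK graph _ o1.
have P2 : P' (position c) = (orient s c).2.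
  by rewrite /position curve_orient//; exact: sgr_paramK graph' _ o2.
split=> //; first by rewrite /gap P1 P2 curve_orient// subrr.
have v1 := sgr_velocity graph o1; have v2 := sgr_velocity graph' o2.
have det0 : det2 (velocity g (orient s c).1) (velocity g (orient s c).2) != 0.
  have := gi_transverse (curve_generic D) cX.
  rewrite /orient; case: ifP => _ H; first exact: H.
  by rewrite /= det2C oppr_eq0; exact: H.
rewrite /gap_slope /slope P1 P2 /flat_sign /crossing_sign.
move: v1 v2 det0; rewrite /det2.
case: (velocity g (orient s c).1) => a b; case: (velocity g (orient s c).2) => a' b' /=.
have [dE dE'] := (sgr_sign graph, sgr_sign graph').
move=> da da'.
have a0 : a != 0 by apply: contraTneq da => ->; rewrite mulr0 ltxx.
have a0' : a' != 0 by apply: contraTneq da' => ->; rewrite mulr0 ltxx.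
have -> : a * b' - b * a' = - (a * a' * (b / a - b' / a')).
  by field; rewrite a0 a0'.
rewrite oppr_eq0 !mulf_eq0 !negb_or => /andP[_ k0]; split=> //.
set k := b / a - b' / a' in k0 *.
have -> : d * d' * Num.sg k = Num.sg (a * a' * k).
  rewrite !sgrM; congr (_ * _ * _).
    by case: dE da => ->; rewrite ?mul1r ?mulN1r ?oppr_gt0; [move/gtr0_sg|move/ltr0_sg].
  by case: dE' da' => ->; rewrite ?mul1r ?mulN1r ?oppr_gt0; [move/gtr0_sg|move/ltr0_sg].
rewrite oppr_gt0; have : a * a' * k != 0 by rewrite !mulf_neq0.
by case: (ltgtP (a * a' * k) 0) => // h _; [rewrite ltr0_sg// opprK|rewrite gtr0_sg].
Qed.

Lemma position_neq c e : c \in X -> e \in X -> joins s s' c -> joins s s' e ->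
  c != e -> position c != position e.
Proof.
move=> cX eX jc je /(orient_neq cX eX)/and4P[h _ _ _]; apply: contra h => /eqP E.
have [_ <- _ _ _] := crossingP cX jc; have [_ <- _ _ _] := crossingP eX je.
by rewrite E.
Qed.

End StrandPair.

Lemma strand_order (R : realType) (g : R -> R * R) (s : R * R) d P t u :
  strand_graph g s d P -> in_segment s t -> in_segment s u -> t != u ->
  ((t < u)%R%:Z * 2 - 1)%:~R = d * Num.sg ((g u).1 - (g t).1).
Proof.
move=> G ts us; case: (ltgtP t u) => // h _.
  have := sgr_mono G ts us h.
  by case: (sgr_sign G) => ->; rewrite ?mul1r ?mulN1r ?oppr_gt0;
    [move/gtr0_sg ->|move/ltr0_sg ->]; rewrite ?opprK.
have := sgr_mono G us ts h.
rewrite -[X in Num.sg X]opprB sgrN.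
by case: (sgr_sign G) => ->; rewrite ?mul1r ?mulN1r ?oppr_gt0;
  [move/gtr0_sg ->|move/ltr0_sg ->]; rewrite ?opprK.
Qed.

Section PairInDiagram.
Variable R : realType.
Variables (D : sdiagram R) (s s' : R * R) (d d' : R) (P P' : R -> R).
Local Notation g := (curve D).
Local Notation X := (double_points D).
Hypothesis apart : segments_apart s s'.
Hypothesis bounds : 0 < s.1 /\ s.2 < 1.
Hypothesis bounds' : 0 < s'.1 /\ s'.2 < 1.
Hypothesis graph : strand_graph g s d P.
Hypothesis graph' : strand_graph g s' d' P'.
Implicit Types (c e : R * R) (x : R).
Local Notation pos := (position D s).

Lemma zero_position x : -1 <= x <= 1 -> gap g P P' x = 0 ->
  exists c, [/\ c \in X, joins s s' c & pos c = x].
Proof.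
move=> x1 gx; have [c [cX j oc]] := gap_zeroP apart bounds bounds' graph graph' x1 gx.
exists c; split=> //; rewrite /position oc /=.
by have [_ ->] := sgr_param graph x1.
Qed.

(** The two crossings are consecutive zeros of the height difference, hence have slopes of opposite
    signs. *)
Lemma opposite_flat_signs c e : c \in X -> e \in X -> joins s s' c -> joins s s' e ->
    c != e -> (forall f, f \in X -> joins s s' f -> f = c \/ f = e) ->
  flat_sign D (orient s c) = - flat_sign D (orient s e).
Proof.
move=> + + + + ce; wlog lt_ce : c e ce / pos c < pos e => [W cX eX jc je only|].
  case: (ltgtP (pos c) (pos e)) => h.
  - exact: W.
  - rewrite (W e c) ?opprK// 1?eq_sym// => f fX jf; case: (only f fX jf); by [left|right].
  - by have := position_neq apart graph graph' cX eX jc je ce; rewrite h eqxx.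
move=> cX eX jc je only; apply: (@intr_inj R).
have [/andP[c1 c2] _ _ zc [kc ->]] := crossingP apart graph graph' cX jc.
have [/andP[e1 e2] _ _ ze [ke E]] := crossingP apart graph graph' eX je.
rewrite rmorphN /= E opprK.
have aux (q a b : R) : a = - b -> - (q * a) = q * b by move=> ->; rewrite mulrN opprK.
apply: aux; apply: (@sg_consecutive_zeros _ (gap g P P') _ _ _ lt_ce) => //.
  by move=> x /andP[cx xe]; apply: (gap_derive graph graph');
    rewrite (le_trans c1 cx) (le_trans xe e2).
move=> x /andP[cx xe]; apply/eqP => gx.
have x1 : -1 <= x <= 1 by rewrite (le_trans c1 (ltW cx)) (le_trans (ltW xe) e2).
have [f [fX jf px]] := zero_position x1 gx.
by case: (only f fX jf) => fE; [move: cx|move: xe]; rewrite -px fE ltxx.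
Qed.

Lemma single_gap_sign c x : c \in X -> joins s s' c ->
    (forall f, f \in X -> joins s s' f -> f = c) -> -1 <= x <= 1 ->
  Num.sg (gap g P P' x) = Num.sg (gap_slope g P P' (pos c)) * Num.sg (x - pos c).
Proof.
move=> cX jc only x1.
have [c1 _ _ zc [kc _]] := crossingP apart graph graph' cX jc.
apply: sg_single_zero (x1) => //.
  by move=> y y1; apply: (gap_derive graph graph').
move=> y y1; apply/eqP/eqP => [gy|->//].
by have [f [fX jf <-]] := zero_position y1 gy; rewrite (only f).
Qed.

End PairInDiagram.

(** * Two strands before and after a move *)

Section LocalPair.
Variable R : realType.
Variables (L : seq (R * R)) (D D' : sdiagram R).
Hypothesis lc : local_change L D D'.
Implicit Types (c e s : R * R) (x : R).

Lemma endpoint_free s t : s \in L -> t = s.1 \/ t = s.2 ->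
  ~~ has (@in_interior R ^~ t) L.
Proof.
move=> sL st; apply/hasPn => r rL; apply/negP => tr.
have [_ s12 _] := local_segment lc sL.
have ts : in_segment s t by case: st => ->; rewrite /in_segment lexx ltW.
case: (local_apart lc sL rL) => [E|ap]; last first.
  by have := segments_apart_in ap ts; rewrite (interior_in_segment tr).
by move: tr; rewrite -E /in_interior; case: st => ->; rewrite ltxx ?andbF.
Qed.

Lemma endpoint_in s t : s \in L -> t = s.1 \/ t = s.2 -> 0 < t < 1.
Proof.
by move=> sL; have [? ? ?] := local_segment lc sL; case=> ->; apply/andP; split; lra.
Qed.

Lemma curve_endpoint s t : s \in L -> t = s.1 \/ t = s.2 -> curve D' t = curve D t.
Proof.
move=> sL st; apply: (lc_curve lc); last exact: endpoint_free st.
by have /andP[? ?] := endpoint_in sL st; rewrite !ltW.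
Qed.

Lemma velocity_endpoint s t : s \in L -> t = s.1 \/ t = s.2 ->
  velocity (curve D') t = velocity (curve D) t.
Proof.
move=> sL st; apply: (velocity_local lc); first exact: endpoint_in st.
exact: endpoint_free st.
Qed.

Lemma strand_graph_local s : s \in L -> strand (curve D) s -> strand (curve D') s ->
  exists d P P', strand_graph (curve D) s d P /\ strand_graph (curve D') s d P'.
Proof.
move=> sL st st'; have [_ s12 _] := local_segment lc sL.
have [d [P G]] := strand_graphP (gi_smooth (curve_generic D)) s12 st.
have [d' [P' G']] := strand_graphP (gi_smooth (curve_generic D')) s12 st'.
exists d, P, P'; split=> //.
have <- // : d' = d.
by rewrite -(sgr_end G) -(sgr_end G') (curve_endpoint sL)//; right.
Qed.

Lemma local_bounds s : s \in L -> 0 < s.1 /\ s.2 < 1.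
Proof. by move=> /(local_segment lc)[]. Qed.

Lemma strand_start s d P P' : s \in L -> strand_graph (curve D) s d P ->
    strand_graph (curve D') s d P' ->
  exists t, [/\ t = s.1 \/ t = s.2, P (-1) = t & P' (-1) = t].
Proof.
move=> sL G G'; have [_ s12 _] := local_segment lc sL.
have s1 : in_segment s s.1 by rewrite /in_segment lexx ltW.
have s2 : in_segment s s.2 by rewrite /in_segment lexx ltW.
case: (sgr_sign G) => dE.
  exists s.1; split; first by left.
    by rewrite -[RHS](sgr_paramK G s1) (sgr_start G) dE.
  by rewrite -[RHS](sgr_paramK G' s1) (sgr_start G') dE.
exists s.2; split; first by right.
  by rewrite -[RHS](sgr_paramK G s2) (sgr_end G) dE.
by rewrite -[RHS](sgr_paramK G' s2) (sgr_end G') dE.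
Qed.

(** Over -1 both strands are at segment ends, where the move changes neither position nor velocity.
    Hence the two height differences start alike and [sg_first_zero] applies. *)
Lemma first_flat_sign s s' d d' P1 P2 P1' P2' c c' : s \in L -> s' \in L ->
    segments_apart s s' ->
    strand_graph (curve D) s d P1 -> strand_graph (curve D) s' d' P2 ->
    strand_graph (curve D') s d P1' -> strand_graph (curve D') s' d' P2' ->
    c \in double_points D -> c' \in double_points D' ->
    joins s s' c -> joins s s' c' ->
    (forall f, f \in double_points D -> joins s s' f -> position D s c <= position D s f) ->
    (forall f, f \in double_points D' -> joins s s' f -> position D' s c' <= position D' s f) ->
  flat_sign D' (orient s c') = flat_sign D (orient s c).
Proof.
move=> sL sL' ap G1 G2 G1' G2' cX cX' j j' first_c first_c'.
have [b b'] := (local_bounds sL, local_bounds sL').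
apply: (@intr_inj R).
have [c1 _ _ zc [kc E]] := crossingP ap G1 G2 cX j.
have [c1' _ _ zc' [kc' E']] := crossingP ap G1' G2' cX' j'.
have aux (q k k1 : R) : k1 = k -> - (q * k) = - (q * k1) by move=> ->.
apply: (etrans E'); apply: (etrans _ (esym E)); apply: aux.
have [t1 [e1 P1E P1E']] := strand_start sL G1 G1'.
have [t2 [e2 P2E P2E']] := strand_start sL' G2 G2'.
have hd x : -1 <= x <= 1 ->
    is_derive x (1 : R) (gap (curve D) P1 P2) (gap_slope (curve D) P1 P2 x).
  exact: (gap_derive G1 G2).
have hd' x : -1 <= x <= 1 ->
    is_derive x (1 : R) (gap (curve D') P1' P2') (gap_slope (curve D') P1' P2' x).
  exact: (gap_derive G1' G2').
apply: (sg_first_zero hd hd' c1 c1' zc zc' kc kc').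
- move=> x /andP[x1 xc]; apply/eqP => gx; have x2 : -1 <= x <= 1.
    by rewrite x1 (le_trans (ltW xc))//; case/andP: c1.
  have [f [fX jf px]] := zero_position ap b b' G1 G2 x2 gx.
  by have := first_c f fX jf; rewrite px leNgt xc.
- move=> x /andP[x1 xc]; apply/eqP => gx; have x2 : -1 <= x <= 1.
    by rewrite x1 (le_trans (ltW xc))//; case/andP: c1'.
  have [f [fX jf px]] := zero_position ap b b' G1' G2' x2 gx.
  by have := first_c' f fX jf; rewrite px leNgt xc.
- by rewrite /gap P1E P1E' P2E P2E' (curve_endpoint sL e1) (curve_endpoint sL' e2).
- move=> _; rewrite /gap_slope /slope P1E P1E' P2E P2E'.
  by rewrite (velocity_endpoint sL e1) (velocity_endpoint sL' e2).
Qed.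

End LocalPair.

(** * The extension to singular diagrams *)

Section Extension.
Variable R : realType.
Implicit Types (D : sdiagram R) (c e s : R * R) (L : seq (R * R)).

Definition crossing_term D c : H_values :=
  weight D 1 (over_under D c) *~ flat_sign D (over_under D c).

Definition singular_term D c : H_values := weight D 1 c + weight D (-1) c.

(** The three cases are H itself, its first differences, and its vanishing second and higher
    differences. *)
Definition H_extension D : H_values :=
  if #|` singular D| == 0 then \sum_(c <- double_points D) crossing_term D c
  else if #|` singular D| == 1 then
    \sum_(c <- double_points D | mark D c == None) singular_term D c
  else 0.

Lemma weight_rev D r c : weight D r (reverse_chord c) = weight D (- r) c.
Proof. exact: flat_weight_rev. Qed.

Lemma crossing_termE D c : c \in double_points D ->
  crossing_term D c = weight D (over_sign D c) c *~ (over_sign D c * flat_sign D c).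
Proof.
move=> cX; rewrite /crossing_term /over_under /over_sign.
case: ifP => _; first by rewrite mul1r.
by rewrite weight_rev -/(reverse_chord c) flat_sign_rev// mulN1r.
Qed.

Lemma H_extension_diagram (D : diagram R) : H_extension D = H_diagram D.
Proof.
rewrite /H_extension nonsingular cardfs0 eqxx H_diagramE.
by apply: eq_big_seq => c cX; rewrite crossing_termE.
Qed.

Lemma singular_term_orient D s c : singular_term D (orient s c) = singular_term D c.
Proof.
rewrite /singular_term /orient; case: ifP => // _.
by rewrite !weight_rev opprK addrC.
Qed.

Lemma card_singular D :
  #|` singular D| = (\sum_(c <- double_points D | mark D c == None) 1)%N.
Proof. by rewrite card_fset_sum1 big_fset. Qed.

Lemma sum_inner_outer (V : nmodType) L D (Q : pred (R * R)) (F : R * R -> V) :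
  \sum_(c <- double_points D | Q c) F c =
  \sum_(c <- inner L D | Q c) F c + \sum_(c <- outer L D | Q c) F c.
Proof.
rewrite big_mkcond (big_fsetID _ (fun c => has (@in_segment R ^~ c.1) L)) /=.
by rewrite -!big_mkcond.
Qed.

(** Crossings outside the square keep their mark and flat sign, so with equal weights their terms
    agree. Crossing terms are compared only if no inner point is singular, since otherwise the
    extension does not use them. *)
Lemma H_extension_local L D D' : local_change L D D' ->
    (forall r c, c \in outer L D -> weight D' r c = weight D r c) ->
    (\sum_(c <- inner L D' | mark D' c == None) 1 =
     \sum_(c <- inner L D | mark D c == None) 1)%N ->
    \sum_(c <- inner L D' | mark D' c == None) singular_term D' c =
    \sum_(c <- inner L D | mark D c == None) singular_term D c ->
    ((\sum_(c <- inner L D | mark D c == None) 1)%N = 0%N ->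
     \sum_(c <- inner L D') crossing_term D' c =
     \sum_(c <- inner L D) crossing_term D c) ->
  H_extension D' = H_extension D.
Proof.
have addE (V : nmodType) (a b b' : V) : b = b' -> a + b = a + b' by move=> ->.
move=> lc wE nE sE cE; have oE := outer_local lc.
have mE : {in outer L D, mark D' =1 mark D} by move=> c; exact: mark_local lc c.
have nsE : #|` singular D'| = #|` singular D|.
  rewrite !card_singular !(sum_inner_outer L) nE oE; congr (_ + _).
  rewrite [LHS]big_seq_cond [RHS]big_seq_cond; apply: eq_bigl => c.
  by case cO : (c \in outer L D); [rewrite (mE _ cO)|].
rewrite /H_extension nsE; case: eqP => n0.
  rewrite !(sum_inner_outer L) oE cE; last first.
    have := card_singular D; rewrite n0 (sum_inner_outer L) => /esym/eqP.
    by rewrite addn_eq0 => /andP[/eqP].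
  apply: addE; apply: eq_big_seq => c cO.
  have [cX _ _] := outer_interior lc cO.
  have cX' : c \in double_points D'.
    by have := cO; rewrite -oE !inE /= => /andP[].
  apply: (etrans (crossing_termE cX')); apply: (etrans _ (esym (crossing_termE cX))).
  have -> : over_sign D' c = over_sign D c by rewrite /over_sign mE.
  by rewrite (wE _ _ cO) (flat_sign_local lc cO).
case: eqP => [_|_]; last by [].
rewrite !(sum_inner_outer L) oE sE; apply: addE.
rewrite [LHS]big_seq_cond [RHS]big_seq_cond; apply: eq_big => c.
  by case cO : (c \in outer L D); [rewrite (mE _ cO)|].
by move=> /andP[cO _]; rewrite /singular_term (wE _ _ cO) (wE _ _ cO).
Qed.

Lemma weight_list L D (Z : seq (R * R)) r x : uniq Z -> inner L D =i Z ->
  weight D r x = flat_weight (Z ++ outer L D) (flat_sign D) r x.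
Proof.
move=> uZ ZE; apply/esym/perm_flat_weight => //; apply: uniq_perm.
- rewrite cat_uniq uZ fset_uniq andbT /=; apply/hasPn => c cO.
  by rewrite /= -ZE; move: cO; rewrite !inE /= => /andP[-> /negbTE ->].
- exact: fset_uniq.
move=> c; rewrite mem_cat -ZE !inE /=.
by case: (c \in double_points D) => //=; case: has.
Qed.

Lemma flat_weight_orient Z1 Z2 tau s c r x : tau (reverse_chord c) = - tau c ->
  flat_weight (Z1 ++ orient s c :: Z2) tau r x = flat_weight (Z1 ++ c :: Z2) tau r x.
Proof.
move=> tc; have mv y : perm_eq (Z1 ++ y :: Z2) (y :: Z1 ++ Z2).
  by rewrite -cat1s perm_catCA.
rewrite !(perm_flat_weight (tau := tau) _ _ (mv _))//.
by rewrite /orient; case: ifP => // _; exact: flat_weight_flip.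
Qed.

End Extension.

(** * The moves *)

Section ExplicitSums.
Variables (T : choiceType) (V : nmodType) (Q : pred T) (F : T -> V).

Lemma sum_fset0 : \sum_(x <- (fset0 : {fset T}) | Q x) F x = 0.
Proof. by rewrite big_mkcond big_seq_fset0. Qed.

Lemma sum_fset1 a : \sum_(x <- [fset a] | Q x) F x = if Q a then F a else 0.
Proof. by rewrite big_mkcond big_seq_fset1. Qed.

Lemma sum_fset2 a b : a != b -> \sum_(x <- [fset a; b] | Q x) F x =
  (if Q a then F a else 0) + (if Q b then F b else 0).
Proof.
by move=> ab; rewrite big_mkcond big_fsetU1 ?inE// big_seq_fset1.
Qed.

Lemma sum_fset3 a b c : a != b -> a != c -> b != c ->
  \sum_(x <- [fset a; b; c] | Q x) F x =
  (if Q a then F a else 0) + ((if Q b then F b else 0) + (if Q c then F c else 0)).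
Proof.
move=> ab ac bc; rewrite big_mkcond -fsetUA big_fsetU1; last first.
  by rewrite !inE negb_or ab.
by rewrite big_fsetU1 ?inE// big_seq_fset1.
Qed.

End ExplicitSums.

(** * The first two Reidemeister moves *)

Section Kinds.
Variable R : realType.
Implicit Types (D : sdiagram R) (c e s : R * R) (L : seq (R * R)).

Lemma joinsC s s' c : joins s s' c = joins s' s c.
Proof. by rewrite /joins orbC. Qed.

Lemma over_atP D s s' c : segments_apart s s' -> over_at D s s' c ->
  [/\ c \in double_points D, joins s s' c, mark D c != None
    & over_under D c = orient s c].
Proof.
move=> ap /and4P[cX mc]; rewrite /over_under /joins /orient.
case: ifP => _ /= h1 h2; rewrite h1 h2 ?orbT; split=> //.
have ap' : segments_apart s' s by rewrite segments_apartC.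
by rewrite (negbTE (segments_apart_in ap' h2)).
Qed.

Lemma sing_atP D s s' c : sing_at D s s' c ->
  [/\ c \in double_points D, joins s s' c & mark D c = None].
Proof. by move=> /and3P[cX /eqP]. Qed.

Lemma joins_inner L D s s' c : s \in L -> s' \in L -> c \in double_points D ->
  joins s s' c -> c \in inner L D.
Proof.
move=> sL sL' cX j; rewrite !inE /= cX /=; apply/hasP.
by case/orP: j => /andP[h _]; [exists s|exists s'].
Qed.

Lemma outer_not_in L D D' c s : local_change L D D' -> c \in outer L D -> s \in L ->
  ~~ in_segment s c.1 /\ ~~ in_segment s c.2.
Proof.
by move=> lc cO sL; have [_ /hasPn/(_ s sL) ? /hasPn/(_ s sL) ?] := outer_interior lc cO.
Qed.

Lemma linking_outer L D D' s s' x y : local_change L D D' -> s \in L -> s' \in L ->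
  in_segment s x.1 -> in_segment s' x.2 -> y \in outer L D ->
  linking x y = (s.1 < y.2)%R%:Z - (s'.1 < y.2)%R%:Z
                - (s.1 < y.1)%R%:Z + (s'.1 < y.1)%R%:Z.
Proof.
move=> lc sL sL' x1 x2 yO; have [h1 h2] := outer_not_in lc yO sL.
by have [h3 h4] := outer_not_in lc yO sL'; apply: linking_segments.
Qed.

Lemma Omega1_extension D D' : Omega1 D D' -> H_extension D' = H_extension D.
Proof.
move=> [s [c [lc iD mc iD']]].
have sL : s \in [:: s] by rewrite inE.
have cI : c \in inner [:: s] D by rewrite iD inE.
have cX : c \in double_points D by move: cI; rewrite !inE /= => /andP[].
have c1 : in_segment s c.1 by move: cI; rewrite !inE /= orbF => /andP[].
have c2 : in_segment s c.2.
  by have := double_point_segments (lc_square lc) cX; rewrite /= !orbF c1 => ->.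
(* Both ends of the chord of the kink lie in one segment, so an outside chord cannot separate
   them. *)
have l0 : {in outer [:: s] D, forall y, linking y c = 0}.
  move=> y yO; rewrite linkingC (linking_outer lc sL sL c1 c2 yO); ring.
have wD r x : weight D r x = flat_weight (c :: outer [:: s] D) (flat_sign D) r x.
  by apply: (weight_list (Z := [:: c])) => // y; rewrite iD !inE.
apply: (H_extension_local lc).
- move=> r x xO; apply: (etrans _ (esym (wD r x))).
  apply: (etrans _ (esym (kink_outer _ _ l0 xO))).
  have iD'0 : inner [:: s] D' =i [::] by move=> y; rewrite iD' !inE.
  apply: (etrans (weight_list (Z := [::]) r x isT iD'0)).
  rewrite (outer_local lc); apply: perm_flat_weight; first exact: perm_refl.
  by move=> y; exact: flat_sign_local lc y.
- by rewrite iD iD' sum_fset0 sum_fset1 (negbTE mc).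
- by rewrite iD iD' sum_fset0 sum_fset1 (negbTE mc).
- move=> _; rewrite iD iD' sum_fset0 sum_fset1 crossing_termE//.
  by rewrite wD kink_inner// mul0rz.
Qed.

Section TwoStrands.
Variables (L : seq (R * R)) (D D' : sdiagram R) (s1 s2 : R * R).
Hypothesis lc : local_change L D D'.
Hypothesis s1L : s1 \in L.
Hypothesis s2L : s2 \in L.
Hypothesis ap : segments_apart s1 s2.
Hypothesis st1 : strand (curve D) s1.
Hypothesis st2 : strand (curve D) s2.
Hypothesis st1' : strand (curve D') s1.
Hypothesis st2' : strand (curve D') s2.

Lemma two_strand_weight E c e r x : c != e -> 
    c \in double_points E -> e \in double_points E -> inner L E = [fset c; e] ->
  weight E r x =
  flat_weight (orient s1 c :: orient s1 e :: outer L E) (flat_sign E) r x.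
Proof.
move=> ce cX eX iE.
rewrite (@flat_weight_orient _ [::] (orient s1 e :: outer L E) _ s1 c) ?flat_sign_rev//.
rewrite (@flat_weight_orient _ [:: c] (outer L E) _ s1 e) ?flat_sign_rev//.
apply: (weight_list (Z := [:: c; e])); first by rewrite /= inE ce.
by move=> y; rewrite iE !inE.
Qed.

Lemma two_strand_signs c e : c != e -> 
    c \in double_points D -> e \in double_points D -> inner L D = [fset c; e] ->
    joins s1 s2 c -> joins s1 s2 e ->
  flat_sign D (orient s1 c) = - flat_sign D (orient s1 e).
Proof.
move=> ce cX eX iD jc je.
have [d1 [P1 [_ [G1 _]]]] := strand_graph_local lc s1L st1 st1'.
have [d2 [P2 [_ [G2 _]]]] := strand_graph_local lc s2L st2 st2'.
apply: (opposite_flat_signs ap (local_bounds lc s1L) (local_bounds lc s2L) G1 G2) => //.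
move=> f fX jf; have := joins_inner s1L s2L fX jf.
by rewrite iD !inE => /orP[]/eqP; [left|right].
Qed.

Lemma two_strand_parallel c e : joins s1 s2 c -> joins s1 s2 e ->
  {in outer L D, forall y, linking (orient s1 c) y = linking (orient s1 e) y}.
Proof.
move=> jc je y yO; have [c1 c2] := orientP ap jc; have [e1 e2] := orientP ap je.
by rewrite (linking_outer lc s1L s2L c1 c2 yO) (linking_outer lc s1L s2L e1 e2 yO).
Qed.

Lemma bigon_local_outer c e r x : c != e ->
    c \in double_points D -> e \in double_points D -> inner L D = [fset c; e] ->
    joins s1 s2 c -> joins s1 s2 e -> x \in outer L D ->
  weight D r x = flat_weight (outer L D) (flat_sign D) r x.
Proof.
move=> ce cX eX iD jc je xO; rewrite (two_strand_weight _ _ ce cX eX iD).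
by apply: bigon_outer => //; [exact: two_strand_parallel|exact: two_strand_signs].
Qed.

Lemma bigon_local_inner c e r : c != e ->
    c \in double_points D -> e \in double_points D -> inner L D = [fset c; e] ->
    joins s1 s2 c -> joins s1 s2 e ->
  weight D r (orient s1 c) = weight D r (orient s1 e).
Proof.
move=> ce cX eX iD jc je; rewrite !(two_strand_weight _ _ ce cX eX iD).
by apply: bigon_sym => //; [exact: two_strand_parallel|exact: two_strand_signs].
Qed.

End TwoStrands.

Lemma Omega2_extension D D' : Omega2 D D' -> H_extension D' = H_extension D.
Proof.
move=> [s1 [s2 [c [e /= [lc [sD sD'] [ce iD] /andP[oc oe] iD']]]]].
have s1L : s1 \in [:: s1; s2] by rewrite !inE eqxx.
have s2L : s2 \in [:: s1; s2] by rewrite !inE eqxx orbT.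
have ap : segments_apart s1 s2 by have := lc_disjoint lc; rewrite /= andbT => /andP[].
have [cX jc mc ouc] := over_atP ap oc; have [eX je me oue] := over_atP ap oe.
have st1 := sD _ s1L; have st2 := sD _ s2L.
have st1' := sD' _ s1L; have st2' := sD' _ s2L.
apply: (H_extension_local lc).
- move=> r x xO.
  apply: (etrans _ (esym (bigon_local_outer lc s1L s2L ap st1 st2 st1' st2' r
    ce cX eX iD jc je xO))).
  have iD'0 : inner [:: s1; s2] D' =i [::] by move=> y; rewrite iD' !inE.
  apply: (etrans (weight_list (Z := [::]) r x isT iD'0)).
  rewrite (outer_local lc); apply: perm_flat_weight; first exact: perm_refl.
  by move=> y; exact: flat_sign_local lc y.
- by rewrite iD iD' sum_fset0 sum_fset2// (negbTE mc) (negbTE me).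
- by rewrite iD iD' sum_fset0 sum_fset2// (negbTE mc) (negbTE me) addr0.
(* As [s1] is the over strand at both corners, [orient s1] directs both chords from over to under:
   equal weights come with opposite signs. *)
- move=> _; rewrite iD iD' sum_fset0 sum_fset2// /crossing_term ouc oue.
  rewrite (bigon_local_inner lc s1L s2L ap st1 st2 st1' st2' _ ce cX eX iD jc je).
  rewrite (two_strand_signs lc s1L s2L ap st1 st2 st1' st2' ce cX eX iD jc je).
  by rewrite mulrNz addNr.
Qed.

End Kinds.

(** * Sliding a crossing through a singular one *)

Section Slide.
Variable R : realType.
Implicit Types (D : sdiagram R) (c e s : R * R) (L : seq (R * R)).

Lemma disjoint_endsC c e : disjoint_ends c e -> disjoint_ends e c.
Proof.
by move=> /and4P[h1 h2 h3 h4]; apply/and4P; split; rewrite eq_sym.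
Qed.

Lemma linking_crossings s1 s2 c e : segments_apart s1 s2 ->
    s1.1 <= s1.2 -> s2.1 <= s2.2 -> disjoint_ends c e ->
    in_segment s1 c.1 -> in_segment s2 c.2 -> in_segment s1 e.1 -> in_segment s2 e.2 ->
  linking c e = (s1.1 < s2.1)%R%:Z - (c.2 < e.2)%R%:Z
                - (c.1 < e.1)%R%:Z + (s2.1 < s1.1)%R%:Z.
Proof.
move=> ap s11 s22 ce c1 c2 e1 e2; rewrite /linking ce.
have ap' : segments_apart s2 s1 by rewrite segments_apartC.
by rewrite (segments_lt ap c1 e2)// (segments_lt ap' c2 e1).
Qed.

Section SlidePair.
Variables (L : seq (R * R)) (D D' : sdiagram R) (s1 s2 : R * R) (c e c' e' : R * R).
Hypothesis lc : local_change L D D'.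
Hypothesis s1L : s1 \in L.
Hypothesis s2L : s2 \in L.
Hypothesis ap : segments_apart s1 s2.
Hypothesis st1 : strand (curve D) s1.
Hypothesis st2 : strand (curve D) s2.
Hypothesis st1' : strand (curve D') s1.
Hypothesis st2' : strand (curve D') s2.
Hypothesis ce : c != e.
Hypothesis ce' : c' != e'.
Hypothesis iD : inner L D = [fset c; e].
Hypothesis iD' : inner L D' = [fset c'; e'].
Hypothesis jc : joins s1 s2 c.
Hypothesis je : joins s1 s2 e.
Hypothesis jc' : joins s1 s2 c'.
Hypothesis je' : joins s1 s2 e'.
Hypothesis order : before s1 c e = before s1 e' c'.

Let inX (E : sdiagram R) x : x \in inner L E -> x \in double_points E.
Proof. by rewrite !inE /= => /andP[]. Qed.
Let cX : c \in double_points D. Proof. by apply: inX; rewrite iD !inE eqxx. Qed.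
Let eX : e \in double_points D. Proof. by apply: inX; rewrite iD !inE eqxx orbT. Qed.
Let cX' : c' \in double_points D'. Proof. by apply: inX; rewrite iD' !inE eqxx. Qed.
Let eX' : e' \in double_points D'. Proof. by apply: inX; rewrite iD' !inE eqxx orbT. Qed.

Lemma opposite_inner E d1 d2 P1 P2 x y : strand_graph (curve E) s1 d1 P1 ->
    strand_graph (curve E) s2 d2 P2 -> inner L E = [fset x; y] -> x != y ->
    joins s1 s2 x -> joins s1 s2 y ->
  flat_sign E (orient s1 x) = - flat_sign E (orient s1 y).
Proof.
move=> G1 G2 iE xy jx jy.
have xX : x \in double_points E by apply: inX; rewrite iE !inE eqxx.
have yX : y \in double_points E by apply: inX; rewrite iE !inE eqxx orbT.
apply: (opposite_flat_signs ap (local_bounds lc s1L) (local_bounds lc s2L) G1 G2) => //.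
move=> f fX jf; have := joins_inner s1L s2L fX jf.
by rewrite iE !inE => /orP[]/eqP; [left|right].
Qed.

Lemma first_of_two E d1 d2 P1 P2 x y f : strand_graph (curve E) s1 d1 P1 ->
    strand_graph (curve E) s2 d2 P2 -> inner L E =i [fset x; y] ->
    position E s1 x < position E s1 y ->
    f \in double_points E -> joins s1 s2 f -> position E s1 x <= position E s1 f.
Proof.
move=> G1 G2 iE xy fX jf; have := joins_inner s1L s2L fX jf.
by rewrite iE !inE => /orP[]/eqP ->; rewrite ?lexx// ltW.
Qed.

(** The corners change places along [s1]. Since time order and abscissa order differ by a fixed
    direction on each strand, they do so from left to right and along [s2] as well. Comparing the
    leftmost corners gives the signs, the other corners having opposite ones. *)
Lemma slide_orders :
  [/\ flat_sign D (orient s1 e) = flat_sign D' (orient s1 c'),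
      ((orient s1 c).1 < (orient s1 e).1) = ((orient s1 e').1 < (orient s1 c').1)
    & ((orient s1 c).2 < (orient s1 e).2) = ((orient s1 e').2 < (orient s1 c').2)].
Proof.
have [d1 [P1 [P1' [G1 G1']]]] := strand_graph_local lc s1L st1 st1'.
have [d2 [P2 [P2' [G2 G2']]]] := strand_graph_local lc s2L st2 st2'.
have [oc1 oc2] := orientP ap jc; have [oe1 oe2] := orientP ap je.
have [oc1' oc2'] := orientP ap jc'; have [oe1' oe2'] := orientP ap je'.
have /and4P[n1 _ _ n2] := orient_neq s1 cX eX ce.
have ec' : e' != c' by rewrite eq_sym.
have /and4P[n1' _ _ n2'] := orient_neq s1 eX' cX' ec'.
have o1 : ((orient s1 c).1 < (orient s1 e).1) = ((orient s1 e').1 < (orient s1 c').1).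
  by have := order; rewrite /before !param_on1.
pose x := position D s1; pose x' := position D' s1.
have E1 := strand_order G1 oc1 oe1 n1; have E1' := strand_order G1' oe1' oc1' n1'.
have E2 := strand_order G2 oc2 oe2 n2; have E2' := strand_order G2' oe2' oc2' n2'.
rewrite -(curve_orient s1 cX) -(curve_orient s1 eX) in E2.
rewrite -(curve_orient s1 cX') -(curve_orient s1 eX') in E2'.
have sgx : Num.sg (x e - x c) = Num.sg (x' c' - x' e').
  have d0 : d1 != 0 by case: (sgr_sign G1) => ->; rewrite ?oppr_eq0 oner_eq0.
  apply: (mulfI d0); apply: (etrans (esym E1)); apply: (etrans _ E1').
  by rewrite o1.
have o2 : ((orient s1 c).2 < (orient s1 e).2) = ((orient s1 e').2 < (orient s1 c').2).
  have : ((((orient s1 c).2 < (orient s1 e).2)%R%:Z * 2 - 1)%:~R : R)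
       = ((((orient s1 e').2 < (orient s1 c').2)%R%:Z * 2 - 1)%:~R : R).
    apply: (etrans E2); apply: (etrans _ (esym E2')).
    by congr (_ * _); exact: sgx.
  by move/intr_inj; do 2 case: (_ < _).
split; [|exact: o1|exact: o2].
have aux (a b a' b' : int) : a = - b -> a' = - b' -> b' = a -> b = a'.
  by move=> -> -> ->; rewrite opprK.
have opp : flat_sign D (orient s1 c) = - flat_sign D (orient s1 e).
  exact: (opposite_inner G1 G2 iD ce jc je).
have opp' : flat_sign D' (orient s1 c') = - flat_sign D' (orient s1 e').
  exact: (opposite_inner G1' G2' iD' ce' jc' je').
have iDs : inner L D =i [fset e; c] by move=> y; rewrite iD !inE orbC.
have iDs' : inner L D' =i [fset e'; c'] by move=> y; rewrite iD' !inE orbC.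
have iDi : inner L D =i [fset c; e] by move=> y; rewrite iD.
have iDi' : inner L D' =i [fset c'; e'] by move=> y; rewrite iD'.
case: (ltgtP (x c) (x e)) => xce.
- have xce' : x' e' < x' c'.
    by move: xce; rewrite -subr_gt0 -sgr_gt0 sgx sgr_gt0 subr_gt0.
  have E := first_flat_sign lc s1L s2L ap G1 G2 G1' G2' cX eX' jc je'
    (fun f => first_of_two G1 G2 iDi xce) (fun f => first_of_two G1' G2' iDs' xce').
  exact: (aux _ _ _ _ opp opp' E).
- have xce' : x' c' < x' e'.
    by move: xce; rewrite -subr_lt0 -sgr_lt0 sgx sgr_lt0 subr_lt0.
  exact: (esym (first_flat_sign lc s1L s2L ap G1 G2 G1' G2' eX cX' je jc'
    (fun f => first_of_two G1 G2 iDs xce) (fun f => first_of_two G1' G2' iDi' xce'))).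
- by case/eqP: (position_neq ap G1 G2 cX eX jc je ce); exact: xce.
Qed.

Lemma slide_weight_outer r x : x \in outer L D -> weight D' r x = weight D r x.
Proof.
move=> xO.
have [d1 [P1 [P1' [G1 G1']]]] := strand_graph_local lc s1L st1 st1'.
have [d2 [P2 [P2' [G2 G2']]]] := strand_graph_local lc s2L st2 st2'.
apply: (etrans _ (esym (bigon_local_outer lc s1L s2L ap st1 st2 st1' st2' r
  ce cX eX iD jc je xO))).
have -> : weight D' r x = flat_weight (outer L D) (flat_sign D') r x.
  apply: (etrans (two_strand_weight s1 r x ce' cX' eX' iD')).
  rewrite (outer_local lc); apply: bigon_outer => //.
    exact: (two_strand_parallel lc s1L s2L ap jc' je').
  exact: (opposite_inner G1' G2' iD' ce' jc' je').
apply: perm_flat_weight; first exact: perm_refl.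
by move=> y; exact: flat_sign_local lc y.
Qed.

Lemma slide_weight_inner r : weight D' r (orient s1 e') = weight D r (orient s1 e).
Proof.
have [d1 [P1 [P1' [G1 G1']]]] := strand_graph_local lc s1L st1 st1'.
have [d2 [P2 [P2' [G2 G2']]]] := strand_graph_local lc s2L st2 st2'.
have [tE o1 o2] := slide_orders.
apply: (etrans (two_strand_weight s1 r _ ce' cX' eX' iD')).
apply: (etrans _ (esym (two_strand_weight s1 r _ ce cX eX iD))).
rewrite (outer_local lc); apply: bigon_slide.
- exact: (two_strand_parallel lc s1L s2L ap jc je).
- exact: (opposite_inner G1 G2 iD ce jc je).
- exact: (two_strand_parallel lc s1L s2L ap jc' je').
- exact: (opposite_inner G1' G2' iD' ce' jc' je').
- by move=> y; exact: flat_sign_local lc y.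
- exact: (two_strand_parallel lc s1L s2L ap je jc').
- exact: tE.
have [oc1 oc2] := orientP ap jc; have [oe1 oe2] := orientP ap je.
have [oc1' oc2'] := orientP ap jc'; have [oe1' oe2'] := orientP ap je'.
have [_ /ltW l1 _] := local_segment lc s1L; have [_ /ltW l2 _] := local_segment lc s2L.
have n := orient_neq s1 cX eX ce; have n' := orient_neq s1 cX' eX' ce'.
rewrite (linking_crossings ap l1 l2 (disjoint_endsC n) oe1 oe2 oc1 oc2).
rewrite (linking_crossings ap l1 l2 n' oc1' oc2' oe1' oe2').
move: n n' => /and4P[n1 _ _ n2] /and4P[n1' _ _ n2'].
rewrite (gt_neq n1) (gt_neq n2) o1 o2.
have ge1 : (orient s1 e').1 != (orient s1 c').1 by rewrite eq_sym.
have ge2 : (orient s1 e').2 != (orient s1 c').2 by rewrite eq_sym.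
by rewrite (gt_neq ge1) (gt_neq ge2).
Qed.

End SlidePair.

Lemma sing_slide_extension D D' : sing_slide D D' -> H_extension D' = H_extension D.
Proof.
move=> [s1 [s2 [c [e [c' [e' /= [lc [sD sD'] [iD oc se] [iD' oc' se'] ord]]]]]]].
have s1L : s1 \in [:: s1; s2] by rewrite !inE eqxx.
have s2L : s2 \in [:: s1; s2] by rewrite !inE eqxx orbT.
have ap : segments_apart s1 s2 by have := lc_disjoint lc; rewrite /= andbT => /andP[].
have ap' : segments_apart s2 s1 by rewrite segments_apartC.
have [cX jc mc _] := over_atP ap oc; have [eX je me] := sing_atP se.
have [cX' jc' mc' _] := over_atP ap' oc'; have [eX' je' me'] := sing_atP se'.
rewrite joinsC in jc'.
have ce : c != e by apply: contra mc => /eqP ->; rewrite me.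
have ce' : c' != e' by apply: contra mc' => /eqP ->; rewrite me'.
have st1 := sD _ s1L; have st2 := sD _ s2L.
have st1' := sD' _ s1L; have st2' := sD' _ s2L.
apply: (H_extension_local lc).
- move=> r x; exact: (slide_weight_outer lc s1L s2L ap st1 st2 st1' st2'
    ce ce' iD iD' jc je jc' je').
- by rewrite iD iD' (sum_fset2 _ _ ce) (sum_fset2 _ _ ce') (negbTE mc) (negbTE mc') me me' eqxx.
- have sumE (E : sdiagram R) x y (V : nmodType) (F : R * R -> V) :
      inner [:: s1; s2] E = [fset x; y] -> x != y ->
      mark E x != None -> mark E y = None ->
      \sum_(z <- inner [:: s1; s2] E | mark E z == None) F z = F y.
    by move=> -> xy mx my; rewrite (sum_fset2 _ _ xy) (negbTE mx) my eqxx add0r.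
  rewrite (sumE _ _ _ _ _ iD ce mc me) (sumE _ _ _ _ _ iD' ce' mc' me').
  rewrite -(singular_term_orient D' s1) -(singular_term_orient D s1).
  have W := slide_weight_inner lc s1L s2L ap st1 st2 st1' st2' ce ce' iD iD' jc je jc' je' ord.
  by rewrite /singular_term (W 1) (W (-1)).
- by move=> n0; exfalso; move: n0; rewrite iD (sum_fset2 _ _ ce) (negbTE mc) me eqxx.
Qed.

End Slide.

(** * The third Reidemeister move and its singular versions *)

Section TriangleMoves.
Variable R : realType.
Implicit Types (D : sdiagram R) (c e s : R * R) (L : seq (R * R)).

Lemma joins_neq s s' r c e : segments_apart s s' -> segments_apart s r ->
  segments_apart s' r -> joins s s' c -> joins s r e -> c != e.
Proof.
move=> ap apr apr' jc je; apply/eqP => ce; rewrite -{}ce in je.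
have [_ c2] := orientP ap jc; have [_ c2'] := orientP apr je.
by have := segments_apart_in apr' c2; rewrite c2'.
Qed.

(* k, l and m are the signs of the differences of slopes of the strands 1 and 2,  *)
(* 1 and 3, and 2 and 3 at their crossings, and al, be and ga those of x13 - x12, *)
(* x23 - x12 and x23 - x13 for the abscissae of these crossings; comparing the    *)
(* heights of the strands at x23 and at x13 gives the two relations.              *)
Lemma three_signs (k l m : R) (d1 d2 d3 : R) (al be ga : R) (u v w : bool) (ta tb tc : int) :
  d1 = 1 \/ d1 = -1 -> d2 = 1 \/ d2 = -1 -> d3 = 1 \/ d3 = -1 ->
  (u%:Z * 2 - 1)%:~R = d1 * al -> (v%:Z * 2 - 1)%:~R = d2 * be ->
  (w%:Z * 2 - 1)%:~R = d3 * ga -> k * be = l * ga -> k * al = m * ga ->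
  ta%:~R = - (d1 * d2 * k) -> tb%:~R = - (d1 * d3 * l) -> tc%:~R = - (d2 * d3 * m) ->
  tb = ta * (2 * v%:Z - 1) * (2 * w%:Z - 1) /\ tc = ta * (2 * u%:Z - 1) * (2 * w%:Z - 1).
Proof.
have sq (d : R) : d = 1 \/ d = -1 -> d * d = 1 by case=> ->; rewrite ?mulrNN mulr1.
move=> /sq d1E /sq d2E /sq d3E U V W kl km A B C.
have bE (b : bool) : (2 * b%:Z - 1 : int) = b%:Z * 2 - 1 by rewrite mulrC.
have WW : (d3 * ga) * (d3 * ga) = 1.
  by rewrite -W -intrM; case: (w).
split; apply: (@intr_inj R); rewrite !bE 2!intrM.
  rewrite A B V W; transitivity (- (d1 * d3 * l) * ((d3 * ga) * (d3 * ga))).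
    by rewrite WW mulr1.
  have -> : - (d1 * d3 * l) * (d3 * ga * (d3 * ga)) = - (d1 * d3) * (d3 * d3) * (l * ga) * ga.
    by ring.
  rewrite -kl d3E.
  have -> : - (d1 * d2 * k) * (d2 * be) * (d3 * ga) = - (d1 * d3) * (d2 * d2) * (k * be) * ga.
    by ring.
  by rewrite d2E.
rewrite A C U W; transitivity (- (d2 * d3 * m) * ((d3 * ga) * (d3 * ga))).
  by rewrite WW mulr1.
have -> : - (d2 * d3 * m) * (d3 * ga * (d3 * ga)) = - (d2 * d3) * (d3 * d3) * (m * ga) * ga.
  by ring.
rewrite -km d3E.
have -> : - (d1 * d2 * k) * (d1 * al) * (d3 * ga) = - (d2 * d3) * (d1 * d1) * (k * al) * ga.
  by ring.
by rewrite d1E.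
Qed.

Section OneTriangle.
Variables (D : sdiagram R) (s1 s2 s3 : R * R) (d1 d2 d3 : R) (P1 P2 P3 : R -> R).
Variables (c12 c13 c23 : R * R).
Local Notation g := (curve D).
Local Notation X := (double_points D).
Hypothesis ap12 : segments_apart s1 s2.
Hypothesis ap13 : segments_apart s1 s3.
Hypothesis ap23 : segments_apart s2 s3.
Hypothesis b1 : 0 < s1.1 /\ s1.2 < 1.
Hypothesis b2 : 0 < s2.1 /\ s2.2 < 1.
Hypothesis b3 : 0 < s3.1 /\ s3.2 < 1.
Hypothesis G1 : strand_graph g s1 d1 P1.
Hypothesis G2 : strand_graph g s2 d2 P2.
Hypothesis G3 : strand_graph g s3 d3 P3.
Hypothesis X12 : c12 \in X.
Hypothesis X13 : c13 \in X.
Hypothesis X23 : c23 \in X.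
Hypothesis j12 : joins s1 s2 c12.
Hypothesis j13 : joins s1 s3 c13.
Hypothesis j23 : joins s2 s3 c23.
Hypothesis only12 : forall f, f \in X -> joins s1 s2 f -> f = c12.
Hypothesis only13 : forall f, f \in X -> joins s1 s3 f -> f = c13.
Hypothesis only23 : forall f, f \in X -> joins s2 s3 f -> f = c23.
Local Notation a := (orient s1 c12).
Local Notation b := (orient s1 c13).
Local Notation c := (orient s2 c23).

Let ap21 : segments_apart s2 s1. Proof. by rewrite segments_apartC. Qed.
Let ap31 : segments_apart s3 s1. Proof. by rewrite segments_apartC. Qed.
Let ap32 : segments_apart s3 s2. Proof. by rewrite segments_apartC. Qed.

Lemma triangle_neq : [/\ c12 != c13, c12 != c23 & c13 != c23].
Proof.
split.
- exact: (joins_neq ap12 ap13 ap23 j12 j13).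
- by apply: (joins_neq ap21 ap23 ap13 _ j23); rewrite joinsC.
- by apply: (joins_neq ap31 ap32 ap12); rewrite joinsC.
Qed.

Lemma orient_disjoint s s' x y : x \in X -> y \in X -> x != y ->
  disjoint_ends (orient s x) (orient s' y).
Proof.
move=> xX yX xy; have := double_points_disjoint xX yX xy.
rewrite /disjoint_ends /orient.
by case: ifP => _; case: ifP => _ /and4P[-> -> -> ->].
Qed.

Lemma triangle_disjoint : [/\ disjoint_ends a b, disjoint_ends a c & disjoint_ends b c].
Proof. by have [? ? ?] := triangle_neq; split; apply: orient_disjoint. Qed.

(** Here [k] tells whether the three strands are run through in the cyclic order 1, 2, 3. *)
Lemma triangle_linking :
  let T12 := s1.1 < s2.1 in let T23 := s2.1 < s3.1 in let T13 := s1.1 < s3.1 in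
  let k := if T12 == T23 then T12 else ~~ T13 in
  [/\ linking a b = 1 - k%:Z - (a.1 < b.1)%R%:Z,
      linking a c = (a.2 < c.1)%R%:Z - k%:Z
    & linking b c = 1 - k%:Z - (b.2 < c.2)%R%:Z].
Proof.
move=> T12 T23 T13 k; have [dab dac dbc] := triangle_disjoint.
have [a1 a2] := orientP ap12 j12; have [e1 e2] := orientP ap13 j13.
have [f1 f2] := orientP ap23 j23.
have le s t : in_segment s t -> s.1 <= s.2 by move=> /andP[/le_trans]; apply.
have [l1 l2 l3] := And3 (le _ _ a1) (le _ _ a2) (le _ _ f2).
rewrite /linking dab dac dbc.
case/and4P: dab => _ _ ab21 _; case/and4P: dbc => _ _ bc21 _.
have ba : b.1 != a.2 by rewrite eq_sym.
have cb : c.1 != b.2 by rewrite eq_sym.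
rewrite (gt_neq ba) (gt_neq cb).
rewrite (segments_lt ap13 a1 e2) // (segments_lt ap23 a2 e2) // (segments_lt ap12 e1 a2) //.
rewrite (segments_lt ap13 a1 f2) // (segments_lt ap23 a2 f2) // (segments_lt ap12 a1 f1) //.
rewrite (segments_lt ap13 e1 f2) // (segments_lt ap12 e1 f1) // (segments_lt ap23 f1 e2) //.
(* Transitivity discards the two impossible combinations of comparisons before the case check. *)
have tr1 : T12 ==> T23 ==> T13 by apply/implyP => h; apply/implyP; exact: lt_trans h.
have tr2 : T13 ==> T12 || T23.
  apply/implyP => h; rewrite /T12 /T23; case: (ltP s1.1 s2.1) => //= h'.
  exact: le_lt_trans h.
rewrite -/T12 -/T23 -/T13 /k; clear k; move: T12 T23 T13 tr1 tr2 (_ < b.1) (a.2 < c.1) (b.2 < c.2).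
by case; case; case=> // _ _; case; case; case.
Qed.

Lemma triangle_signs :
  flat_sign D b = flat_sign D a * (2 * (a.2 < c.1)%R%:Z - 1) * (2 * (b.2 < c.2)%R%:Z - 1) /\
  flat_sign D c = flat_sign D a * (2 * (a.1 < b.1)%R%:Z - 1) * (2 * (b.2 < c.2)%R%:Z - 1).
Proof.
have [/and4P[ab1 _ _ _] /and4P[_ _ ac21 _] /and4P[_ _ _ bc22]] := triangle_disjoint.
have [a1 a2] := orientP ap12 j12; have [e1 e2] := orientP ap13 j13.
have [f1 f2] := orientP ap23 j23.
have U := strand_order G1 a1 e1 ab1.
have V := strand_order G2 a2 f1 ac21.
have W := strand_order G3 e2 f2 bc22.
have [x12 _ _ z12 [_ A]] := crossingP ap12 G1 G2 X12 j12.
have [x13 _ _ z13 [_ B]] := crossingP ap13 G1 G3 X13 j13.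
have [x23 _ _ z23 [_ C]] := crossingP ap23 G2 G3 X23 j23.
apply: (three_signs (sgr_sign G1) (sgr_sign G2) (sgr_sign G3) U V W _ _ A B C).
- have E12 := single_gap_sign ap12 b1 b2 G1 G2 X12 j12 only12 x23.
  have E13 := single_gap_sign ap13 b1 b3 G1 G3 X13 j13 only13 x23.
  have gE : gap g P1 P2 (position D s2 c23) = gap g P1 P3 (position D s2 c23).
    by move: z23; rewrite /gap => /subr0_eq ->.
  rewrite gE E13 in E12.
  rewrite -(curve_orient s1 X12) -(curve_orient s1 X13) -(curve_orient s2 X23).
  exact: (esym E12).
- have E12 := single_gap_sign ap12 b1 b2 G1 G2 X12 j12 only12 x13.
  have E23 := single_gap_sign ap23 b2 b3 G2 G3 X23 j23 only23 x13.
  have gE : gap g P1 P2 (position D s1 c13) = - gap g P2 P3 (position D s1 c13).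
    by move: z13; rewrite /gap => /subr0_eq ->; rewrite opprB.
  rewrite gE sgrN E23 -mulrN -sgrN opprB in E12.
  rewrite -(curve_orient s1 X13) -(curve_orient s2 X23).
  exact: (esym E12).
Qed.

End OneTriangle.

(** The boolean tells whether the double point is singular, so that all three triangle moves are
    instances of one argument. *)
Definition has_kind (n : bool) D s s' c := [/\ c \in double_points D, joins s s' c,
  (mark D c == None) = n & ~~ n -> over_under D c = orient s c].

Lemma count3_eq0 (p q r : bool) : ((if p then 1 else 0) + ((if q then 1 else 0)
  + (if r then 1 else 0)))%N = 0%N -> [/\ p = false, q = false & r = false].
Proof. by case: p; case: q; case: r. Qed.

Section LocalTriangle.
Variables (D D' : sdiagram R) (s1 s2 s3 : R * R).
Variables (c12 c13 c23 c12' c13' c23' : R * R).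
Variables n12 n13 n23 : bool.
Local Notation L := [:: s1; s2; s3].
Hypothesis lc : local_change L D D'.
Hypothesis sD : strands L D.
Hypothesis sD' : strands L D'.
Hypothesis iD : inner L D = [fset c12; c13; c23].
Hypothesis iD' : inner L D' = [fset c12'; c13'; c23'].
Hypothesis k12 : has_kind n12 D s1 s2 c12.
Hypothesis k13 : has_kind n13 D s1 s3 c13.
Hypothesis k23 : has_kind n23 D s2 s3 c23.
Hypothesis k12' : has_kind n12 D' s1 s2 c12'.
Hypothesis k13' : has_kind n13 D' s1 s3 c13'.
Hypothesis k23' : has_kind n23 D' s2 s3 c23'.
Hypothesis o1 : before s1 c12 c13 = before s1 c13' c12'.
Hypothesis o2 : before s2 c12 c23 = before s2 c23' c12'.
Hypothesis o3 : before s3 c13 c23 = before s3 c23' c13'.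

Let s1L : s1 \in L. Proof. by rewrite !inE eqxx. Qed.
Let s2L : s2 \in L. Proof. by rewrite !inE eqxx orbT. Qed.
Let s3L : s3 \in L. Proof. by rewrite !inE eqxx !orbT. Qed.
Let ap12 : segments_apart s1 s2.
Proof. by have := lc_disjoint lc; rewrite /= !andbT => /andP[/andP[]]. Qed.
Let ap13 : segments_apart s1 s3.
Proof. by have := lc_disjoint lc; rewrite /= !andbT => /andP[/andP[]]. Qed.
Let ap23 : segments_apart s2 s3.
Proof. by have := lc_disjoint lc; rewrite /= !andbT => /andP[_]. Qed.
Let ap21 : segments_apart s2 s1. Proof. by rewrite segments_apartC. Qed.
Let ap31 : segments_apart s3 s1. Proof. by rewrite segments_apartC. Qed.
Let ap32 : segments_apart s3 s2. Proof. by rewrite segments_apartC. Qed.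

Lemma three_strand_only E x12 x13 x23 : inner L E = [fset x12; x13; x23] ->
    joins s1 s2 x12 -> joins s1 s3 x13 -> joins s2 s3 x23 ->
  [/\ forall f, f \in double_points E -> joins s1 s2 f -> f = x12,
      forall f, f \in double_points E -> joins s1 s3 f -> f = x13
    & forall f, f \in double_points E -> joins s2 s3 f -> f = x23].
Proof.
move=> iE j12 j13 j23; split=> f fX jf.
- have := joins_inner s1L s2L fX jf; rewrite iE !inE -orbA => /or3P[]/eqP // E'; subst f.
    by have := joins_neq ap12 ap13 ap23 jf j13; rewrite eqxx.
  rewrite joinsC in jf; by have := joins_neq ap21 ap23 ap13 jf j23; rewrite eqxx.
- have := joins_inner s1L s3L fX jf; rewrite iE !inE -orbA => /or3P[]/eqP // E'; subst f.
    by have := joins_neq ap13 ap12 ap32 jf j12; rewrite eqxx.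
  have j23' : joins s3 s2 x23 by rewrite joinsC.
  rewrite joinsC in jf; by have := joins_neq ap31 ap32 ap12 jf j23'; rewrite eqxx.
- have := joins_inner s2L s3L fX jf; rewrite iE !inE -orbA => /or3P[]/eqP // E'; subst f.
    have j12' : joins s2 s1 x12 by rewrite joinsC.
    by have := joins_neq ap23 ap21 ap31 jf j12'; rewrite eqxx.
  have j13' : joins s3 s1 x13 by rewrite joinsC.
  rewrite joinsC in jf; by have := joins_neq ap32 ap31 ap21 jf j13'; rewrite eqxx.
Qed.

Lemma three_strand_weight E x12 x13 x23 r x : inner L E = [fset x12; x13; x23] ->
    joins s1 s2 x12 -> joins s1 s3 x13 -> joins s2 s3 x23 ->
    x12 \in double_points E -> x13 \in double_points E -> x23 \in double_points E ->
  weight E r x = flat_weight (orient s1 x12 :: orient s1 x13 :: orient s2 x23 :: outer L E)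
                             (flat_sign E) r x.
Proof.
move=> iE j12 j13 j23 X12 X13 X23.
have [n1 n2 n3] := triangle_neq ap12 ap13 ap23 j12 j13 j23.
rewrite (@flat_weight_orient _ [::] (orient s1 x13 :: orient s2 x23 :: outer L E) _ s1 x12)
  ?flat_sign_rev//.
rewrite (@flat_weight_orient _ [:: x12] (orient s2 x23 :: outer L E) _ s1 x13) ?flat_sign_rev//.
rewrite (@flat_weight_orient _ [:: x12; x13] (outer L E) _ s2 x23) ?flat_sign_rev//.
apply: (weight_list (Z := [:: x12; x13; x23])).
  by rewrite /= !inE negb_or n1 n2 n3.
by move=> y; rewrite iE !inE orbA.
Qed.

Local Notation a := (orient s1 c12).
Local Notation b := (orient s1 c13).
Local Notation c := (orient s2 c23).
Local Notation a' := (orient s1 c12').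
Local Notation b' := (orient s1 c13').
Local Notation c' := (orient s2 c23').

Lemma triangle_flips : [/\ (a'.1 < b'.1) = ~~ (a.1 < b.1),
  (a'.2 < c'.1) = ~~ (a.2 < c.1) & (b'.2 < c'.2) = ~~ (b.2 < c.2)].
Proof.
have [X12 j12 _ _] := k12; have [X13 j13 _ _] := k13; have [X23 j23 _ _] := k23.
have [X12' j12' _ _] := k12'; have [X13' j13' _ _] := k13'; have [X23' j23' _ _] := k23'.
have [/and4P[ab1 _ _ _] /and4P[_ _ ac21 _] /and4P[_ _ _ bc22]] :=
  triangle_disjoint ap12 ap13 ap23 X12' X13' X23' j12' j13' j23'.
move: o1 o2 o3; rewrite /before (param_on2 ap12 j12) (param_on2 ap12 j12').
rewrite (param_on2 ap13 j13) (param_on2 ap13 j13') (param_on2 ap23 j23) (param_on2 ap23 j23').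
rewrite !param_on1.
by move=> -> -> ->; rewrite (gt_neq ab1) (gt_neq ac21) (gt_neq bc22) !negbK.
Qed.

Lemma triangle_local :
  [/\ flat_sign D' a' = flat_sign D a, flat_sign D' b' = flat_sign D b
    & flat_sign D' c' = flat_sign D c] /\
  [/\ forall r, weight D' r a' = weight D r a, forall r, weight D' r b' = weight D r b,
      forall r, weight D' r c' = weight D r c
    & forall r x, x \in outer L D -> weight D' r x = weight D r x].
Proof.
have [X12 j12 _ _] := k12; have [X13 j13 _ _] := k13; have [X23 j23 _ _] := k23.
have [X12' j12' _ _] := k12'; have [X13' j13' _ _] := k13'; have [X23' j23' _ _] := k23'.
have [d1 [P1 [P1' [G1 G1']]]] := strand_graph_local lc s1L (sD s1L) (sD' s1L).
have [d2 [P2 [P2' [G2 G2']]]] := strand_graph_local lc s2L (sD s2L) (sD' s2L).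
have [d3 [P3 [P3' [G3 G3']]]] := strand_graph_local lc s3L (sD s3L) (sD' s3L).
have [only12 only13 only23] := three_strand_only iD j12 j13 j23.
have [only12' only13' only23'] := three_strand_only iD' j12' j13' j23'.
have le_only E s y (J : R * R -> bool) :
    (forall f, f \in double_points E -> J f -> f = y) ->
    forall f, f \in double_points E -> J f -> position E s y <= position E s f.
  by move=> H f fX jf; rewrite (H f fX jf) lexx.
have ta : flat_sign D' a' = flat_sign D a.
  exact: (first_flat_sign lc s1L s2L ap12 G1 G2 G1' G2' X12 X12' j12 j12'
    (le_only D s1 _ _ only12) (le_only D' s1 _ _ only12')).
have tb : flat_sign D' b' = flat_sign D b.
  exact: (first_flat_sign lc s1L s3L ap13 G1 G3 G1' G3' X13 X13' j13 j13'
    (le_only D s1 _ _ only13) (le_only D' s1 _ _ only13')).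
have tc : flat_sign D' c' = flat_sign D c.
  exact: (first_flat_sign lc s2L s3L ap23 G2 G3 G2' G3' X23 X23' j23 j23'
    (le_only D s2 _ _ only23) (le_only D' s2 _ _ only23')).
split; first by split; [exact: ta|exact: tb|exact: tc].
have [tbE tcE] := triangle_signs ap12 ap13 ap23 (local_bounds lc s1L) (local_bounds lc s2L)
  (local_bounds lc s3L) G1 G2 G3 X12 X13 X23 j12 j13 j23 only12 only13 only23.
have := triangle_linking ap12 ap13 ap23 X12 X13 X23 j12 j13 j23.
have := triangle_linking ap12 ap13 ap23 X12' X13' X23' j12' j13' j23'.
rewrite /=; set k := if _ then _ else _.
have [-> -> ->] := triangle_flips.
move: tbE tcE; set u := (a.1 < b.1); set v := (a.2 < c.1); set w := (b.2 < c.2).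
move=> tbE tcE [lab' lac' lbc'] [lab lac lbc].
have neg (z : bool) : (~~ z)%:Z = 1 - z%:Z by case: z.
rewrite !neg in lab' lac' lbc'.
have lab2 : linking a' b' = u%:Z - k%:Z by rewrite lab'; ring.
have lac2 : linking a' c' = 1 - k%:Z - v%:Z by rewrite lac'; ring.
have lbc2 : linking b' c' = w%:Z - k%:Z by rewrite lbc'; ring.
have [a1 a2] := orientP ap12 j12; have [e1 e2] := orientP ap13 j13.
have [f1 f2] := orientP ap23 j23.
have [a1' a2'] := orientP ap12 j12'; have [e1' e2'] := orientP ap13 j13'.
have [f1' f2'] := orientP ap23 j23'.
have par : {in outer L D, forall y, [/\ linking a' y = linking a y,
    linking b' y = linking b y & linking c' y = linking c y]}.
  move=> y yO; split.
  - by rewrite (linking_outer lc s1L s2L a1 a2 yO) (linking_outer lc s1L s2L a1' a2' yO).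
  - by rewrite (linking_outer lc s1L s3L e1 e2 yO) (linking_outer lc s1L s3L e1' e2' yO).
  - by rewrite (linking_outer lc s2L s3L f1 f2 yO) (linking_outer lc s2L s3L f1' f2' yO).
have addY : {in outer L D, forall y, linking b y = linking a y + linking c y}.
  move=> y yO; rewrite (linking_outer lc s1L s2L a1 a2 yO).
  by rewrite (linking_outer lc s1L s3L e1 e2 yO) (linking_outer lc s2L s3L f1 f2 yO); ring.
have tY : {in outer L D, flat_sign D' =1 flat_sign D}.
  by move=> y; exact: flat_sign_local lc y.
have tau_a := flat_sign_unit D a.
have wD r x := three_strand_weight r x iD j12 j13 j23 X12 X13 X23.
have wD' r x := three_strand_weight r x iD' j12' j13' j23' X12' X13' X23'.
rewrite (outer_local lc) in wD'.
split=> [r|r|r|r x xO]; apply: (etrans (wD' r _)); apply: (etrans _ (esym (wD r _))).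
- exact: (triangle_a tY par addY lab lac lbc lab2 lac2 lbc2 tau_a tbE tcE ta tb tc).
- exact: (triangle_b tY par addY lab lac lbc lab2 lac2 lbc2 tau_a tbE tcE ta tb tc).
- exact: (triangle_c tY par addY lab lac lbc lab2 lac2 lbc2 tau_a tbE tcE ta tb tc).
- exact: (triangle_outer tY par lab lac lbc lab2 lac2 lbc2 tau_a tbE tcE ta tb tc).
Qed.

Lemma kind_crossing_term n s s' x x' : has_kind n D s s' x -> has_kind n D' s s' x' ->
    flat_sign D' (orient s x') = flat_sign D (orient s x) ->
    (forall r, weight D' r (orient s x') = weight D r (orient s x)) -> n = false ->
  crossing_term D' x' = crossing_term D x.
Proof.
move=> [_ _ _ ox] [_ _ _ ox'] tE wE n0; rewrite n0 in ox ox'.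
by rewrite /crossing_term (ox' isT) (ox isT) (wE 1) tE.
Qed.

Lemma kind_singular_term n s s' x x' : has_kind n D s s' x -> has_kind n D' s s' x' ->
    (forall r, weight D' r (orient s x') = weight D r (orient s x)) ->
  (if mark D' x' == None then singular_term D' x' else 0) =
  (if mark D x == None then singular_term D x else 0).
Proof.
move=> [_ _ mx _] [_ _ mx' _] wE; rewrite mx mx'; case: n {mx mx'}; last by [].
rewrite -(singular_term_orient D' s) -(singular_term_orient D s) /singular_term.
by rewrite (wE 1) (wE (-1)).
Qed.

Lemma local_triangle_extension : H_extension D' = H_extension D.
Proof.
have [[ta tb tc] [wa wb wc wo]] := triangle_local.
have [X12 j12 m12 _] := k12; have [X13 j13 m13 _] := k13; have [X23 j23 m23 _] := k23.
have [X12' j12' m12' _] := k12'; have [X13' j13' m13' _] := k13'.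
have [X23' j23' m23' _] := k23'.
have [n1 n2 n3] := triangle_neq ap12 ap13 ap23 j12 j13 j23.
have [n1' n2' n3'] := triangle_neq ap12 ap13 ap23 j12' j13' j23'.
have sumE (V : nmodType) (F : R * R -> V) : \sum_(x <- inner L D | mark D x == None) F x =
   (if mark D c12 == None then F c12 else 0)
   + ((if mark D c13 == None then F c13 else 0) + (if mark D c23 == None then F c23 else 0)).
  by rewrite iD (sum_fset3 _ _ n1 n2 n3).
have sumE' (V : nmodType) (F : R * R -> V) : \sum_(x <- inner L D' | mark D' x == None) F x =
   (if mark D' c12' == None then F c12' else 0)
   + ((if mark D' c13' == None then F c13' else 0)
      + (if mark D' c23' == None then F c23' else 0)).
  by rewrite iD' (sum_fset3 _ _ n1' n2' n3').
have congr3 (V : nmodType) (x y z x' y' z' : V) : x' = x -> y' = y -> z' = z ->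
  x' + (y' + z') = x + (y + z) by move=> -> -> ->.
apply: (H_extension_local lc).
- exact: wo.
- apply: (etrans (sumE' _ _)); apply: (etrans _ (esym (sumE _ _))).
  by rewrite m12 m13 m23 m12' m13' m23'.
- apply: (etrans (sumE' _ _)); apply: (etrans _ (esym (sumE _ _))); apply: congr3.
  + exact: (kind_singular_term k12 k12' wa).
  + exact: (kind_singular_term k13 k13' wb).
  + exact: (kind_singular_term k23 k23' wc).
move=> n0; have {n0} [n120 n130 n230] : [/\ n12 = false, n13 = false & n23 = false].
  move: n0 => /(etrans (esym (sumE _ _))); rewrite m12 m13 m23.
  exact: count3_eq0.
have tE (E : sdiagram R) x y z : x != y -> x != z -> y != z -> inner L E = [fset x; y; z] ->
   \sum_(v <- inner L E) crossing_term E v =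
   crossing_term E x + (crossing_term E y + crossing_term E z).
  by move=> xy xz yz ->; rewrite (sum_fset3 _ _ xy xz yz).
apply: (etrans (tE _ _ _ _ n1' n2' n3' iD')).
apply: (etrans _ (esym (tE _ _ _ _ n1 n2 n3 iD))); apply: congr3.
- exact: (kind_crossing_term k12 k12' ta wa n120).
- exact: (kind_crossing_term k13 k13' tb wb n130).
- exact: (kind_crossing_term k23 k23' tc wc n230).
Qed.

End LocalTriangle.

Lemma triangle_move_extension
    (f12 f13 f23 : sdiagram R -> R * R -> R * R -> R * R -> bool) n12 n13 n23 D D' :
  (forall E s s' c, segments_apart s s' -> f12 E s s' c -> has_kind n12 E s s' c) ->
  (forall E s s' c, segments_apart s s' -> f13 E s s' c -> has_kind n13 E s s' c) ->
  (forall E s s' c, segments_apart s s' -> f23 E s s' c -> has_kind n23 E s s' c) ->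
  triangle_move f12 f13 f23 D D' -> H_extension D' = H_extension D.
Proof.
move=> K12 K13 K23.
move=> [s1 [s2 [s3 [c12 [c13 [c23 [c12' [c13' [c23' /= [lc [sD sD']]]]]]]]]]].
move=> [iD f1 f2 f3] [iD' f1' f2' f3'] [o1 o2 o3].
have := lc_disjoint lc; rewrite /= !andbT => /andP[/andP[ap12 ap13] ap23].
exact: (local_triangle_extension lc sD sD' iD iD' (K12 _ _ _ _ ap12 f1) (K13 _ _ _ _ ap13 f2)
  (K23 _ _ _ _ ap23 f3) (K12 _ _ _ _ ap12 f1') (K13 _ _ _ _ ap13 f2')
  (K23 _ _ _ _ ap23 f3') o1 o2 o3).
Qed.

Lemma over_at_kind D s s' c : segments_apart s s' -> over_at D s s' c ->
  has_kind false D s s' c.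
Proof. by move=> ap /(over_atP ap)[cX j /negbTE mc ou]; split. Qed.

Lemma sing_at_kind D s s' c : segments_apart s s' -> sing_at D s s' c ->
  has_kind true D s s' c.
Proof. by move=> ap /sing_atP[cX j mc]; split=> //; rewrite mc. Qed.

Lemma Omega3_extension D D' : Omega3 D D' -> H_extension D' = H_extension D.
Proof. by apply: triangle_move_extension => *; apply: over_at_kind. Qed.

Lemma sing_under_arc_extension D D' : sing_under_arc D D' -> H_extension D' = H_extension D.
Proof.
by apply: triangle_move_extension => *; first [exact: over_at_kind|exact: sing_at_kind].
Qed.

Lemma sing_over_arc_extension D D' : sing_over_arc D D' -> H_extension D' = H_extension D.
Proof.
by apply: triangle_move_extension => *; first [exact: over_at_kind|exact: sing_at_kind].
Qed.

End TriangleMoves.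

(** * Planar isotopy *)

Section AmbientIsotopy.
Variable R : realType.
Implicit Types (p q v w : R * R) (s t : R).

Lemma fst_lin (a b : R) v w : (a *: v + b *: w).1 = a * v.1 + b * w.1.
Proof. by []. Qed.

Lemma snd_lin (a b : R) v w : (a *: v + b *: w).2 = a * v.2 + b * w.2.
Proof. by []. Qed.

Lemma det2_linear (M : R * R -> R * R) v w :
    (forall a b v w, M (a *: v + b *: w) = a *: M v + b *: M w) ->
  det2 (M v) (M w) = det2 (M (1, 0)) (M (0, 1)) * det2 v w.
Proof.
move=> Mlin.
have ME u : M u = u.1 *: M (1, 0) + u.2 *: M (0, 1).
  rewrite -Mlin; congr M; apply: injective_projections; rewrite (fst_lin, snd_lin) /=.
    by rewrite mulr1 mulr0 addr0.
  by rewrite mulr1 mulr0 add0r.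
rewrite (ME v) (ME w) /det2 !(fst_lin, snd_lin).
move: (M (1, 0)) (M (0, 1)) => [x y] [z u]; case: v w => [a b] [c d] /=.
by ring.
Qed.

Lemma det2_basis : det2 (1, 0) (0, 1) = 1 :> R.
Proof. by rewrite /det2 /= mulr1 mulr0 subr0. Qed.

Lemma is_diff_identity (f df : R * R -> R * R) p :
  is_diff p f df -> (forall q, f q = q) -> forall v, df v = v.
Proof.
move=> h fE v; have -> : df = 'd f p by rewrite (@diff_val _ _ _ _ _ _ _ h).
have -> : f = id by apply/funext.
by rewrite (@diff_val _ _ _ _ _ _ _ (is_diff_id p)).
Qed.

Variables F G : R * (R * R) -> R * R.
Hypothesis F_smooth : smooth F.
Hypothesis G_smooth : smooth G.
Hypothesis F0 : forall p, F (0, p) = p.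
Hypothesis GF : forall s p, 0 <= s <= 1 -> G (s, F (s, p)) = p.

Definition slice_diff (H : R * (R * R) -> R * R) s p v : R * R :=
  'd H (s, p) ((0, v) : R * (R * R)).

Lemma slice_diff_linear H s p (a b : R) v w :
  slice_diff H s p (a *: v + b *: w) = a *: slice_diff H s p v + b *: slice_diff H s p w.
Proof.
have E : ((0, a *: v + b *: w) : R * (R * R)) = a *: (0, v) + b *: (0, w).
  apply: injective_projections => //.
  by rewrite -[RHS]/(a * 0 + b * 0) !mulr0 addr0.
by rewrite /slice_diff E linearD !linearZ.
Qed.

Lemma slice_is_diff (H : R * (R * R) -> R * R) s p : smooth H ->
  is_diff p (fun q => H (s, q)) (slice_diff H s p).
Proof.
move=> Hs; have h1 : is_diff (s, p) H ('d H (s, p)).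
  by split=> //; exact: smooth_differentiable.
have h2 : is_diff p (fun q => (s, q)) (fun v => (0, v)).
  exact: is_diff_pair.
exact: (is_diff_comp h2 h1).
Qed.

Lemma slice_det_start p : det2 (slice_diff F 0 p (1, 0)) (slice_diff F 0 p (0, 1)) = 1.
Proof.
have h := slice_is_diff 0 p F_smooth.
by rewrite (is_diff_identity h F0 (1, 0)) (is_diff_identity h F0 (0, 1)) det2_basis.
Qed.

(** By the chain rule the differential of the slice of [F] is inverted by that of [G], and
    determinants multiply. *)
Lemma slice_det_neq0 s p : 0 <= s <= 1 ->
  det2 (slice_diff F s p (1, 0)) (slice_diff F s p (0, 1)) != 0.
Proof.
move=> s01; have hF := slice_is_diff s p F_smooth.
have hG := slice_is_diff s (F (s, p)) G_smooth.
have hGF := is_diff_comp hF hG.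
have Ev v : slice_diff G s (F (s, p)) (slice_diff F s p v) = v.
  by apply: (is_diff_identity hGF) => q /=; rewrite GF.
have D1 := det2_linear (slice_diff F s p (1, 0)) (slice_diff F s p (0, 1))
  (slice_diff_linear G s (F (s, p))).
have D2 := etrans (congr2 (@det2 R) (Ev (1, 0)) (Ev (0, 1))) det2_basis.
have aux (b c : R) : 1 = b * c -> c != 0.
  by move=> bc; apply/eqP => c0; move/eqP: bc; rewrite c0 mulr0 oner_eq0.
exact: aux (etrans (esym D2) D1).
Qed.

Lemma slice_det_continuous p :
  continuous (fun s => det2 (slice_diff F s p (1, 0)) (slice_diff F s p (0, 1))).
Proof.
have [_ dc] := F_smooth 1.
have c v : continuous (fun s => slice_diff F s p v).
  move=> s; apply: (@continuous_comp _ _ _ (fun s => (s, p)) (fun x => 'd F x (0, v))).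
    by apply: differentiable_continuous; apply: differentiable_pair.
  exact: (dc (0, v)).
have c1 v : continuous (fun s => (slice_diff F s p v).1).
  by move=> s; apply: (continuous_comp (c v s)); exact: cvg_fst.
have c2 v : continuous (fun s => (slice_diff F s p v).2).
  by move=> s; apply: (continuous_comp (c v s)); exact: cvg_snd.
move=> s; apply: (@continuousB _ _ _
  (fun s => (slice_diff F s p (1, 0)).1 * (slice_diff F s p (0, 1)).2)
  (fun s => (slice_diff F s p (1, 0)).2 * (slice_diff F s p (0, 1)).1)).
- apply: (@continuousM _ _ (fun s => (slice_diff F s p (1, 0)).1)
    (fun s => (slice_diff F s p (0, 1)).2)); [exact: c1|exact: c2].
- apply: (@continuousM _ _ (fun s => (slice_diff F s p (1, 0)).2)
    (fun s => (slice_diff F s p (0, 1)).1)); [exact: c2|exact: c1].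
Qed.

(** The determinant is 1 at time 0 and continuous in time; having no zero on [0, 1], it stays
    positive. *)
Lemma slice_det_gt0 p : 0 < det2 (slice_diff F 1 p (1, 0)) (slice_diff F 1 p (0, 1)).
Proof.
have aux (a b : R) : a = 1 -> 0 < a * b -> 0 < b by move=> ->; rewrite mul1r.
apply: (aux _ _ (slice_det_start p)).
exact: (@same_sign_without_zero R
  (fun s => det2 (slice_diff F s p (1, 0)) (slice_diff F s p (0, 1))) 0 1 ler01
  (fun s _ => @slice_det_continuous p s) (fun s => @slice_det_neq0 s p)).
Qed.

End AmbientIsotopy.

Section IsotopyInvariance.
Variable R : realType.
Variables (D D' : sdiagram R).
Variables (F G : R * (R * R) -> R * R) (phi : R -> R).
Hypothesis F_smooth : smooth F.
Hypothesis G_smooth : smooth G.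
Hypothesis F0 : forall p, F (0, p) = p.
Hypothesis GF : forall s p, 0 <= s <= 1 -> G (s, F (s, p)) = p.
Hypothesis phi_smooth : smooth phi.
Hypothesis phi0 : phi 0 = 0.
Hypothesis phi1 : phi 1 = 1.
Hypothesis phi_gt0 : forall t, 0 <= t <= 1 -> 0 < derive1 phi t.
Hypothesis curveE : forall t, 0 <= t <= 1 -> curve D' (phi t) = F (1, curve D t).
Hypothesis markE : forall c, c \in double_points D ->
  mark D' (phi c.1, phi c.2) = mark D c.
Implicit Types (s t u : R) (c e : R * R).

Let phid t : is_derive t (1 : R) phi (derive1 phi t).
Proof.
rewrite derive1E; apply: derivableP; apply: diff_derivable.
exact: (smooth_differentiable t phi_smooth).
Qed.

Let phic t : {for t, continuous phi}.
Proof. exact: is_derive_continuous (phid t). Qed.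

Lemma reparam_lt s t : 0 <= s <= 1 -> 0 <= t <= 1 -> (phi s < phi t) = (s < t).
Proof.
have mono u v : 0 <= u -> v <= 1 -> u < v -> phi u < phi v.
  move=> u0 v1 uv.
  have [|c /itvP cuv E] := @MVT R phi (derive1 phi) u v uv (fun z _ => phid z).
    apply: continuous_in_subspaceT => x _; exact: phic.
  rewrite -subr_gt0 E mulr_gt0 ?subr_gt0// phi_gt0// (le_trans u0) ?cuv//=.
  by rewrite (le_trans _ v1) ?cuv.
move=> /andP[s0 s1] /andP[t0 t1]; case: (ltgtP s t) => st.
- exact: mono.
- by apply/negbTE; rewrite -leNgt ltW// mono.
- by rewrite st ltxx.
Qed.

Lemma reparam_inj s t : 0 <= s <= 1 -> 0 <= t <= 1 -> (phi s == phi t) = (s == t).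
Proof.
move=> s01 t01; have := reparam_lt s01 t01; have := reparam_lt t01 s01.
by case: (ltgtP s t) => // [_ _|_|->]; rewrite ?eqxx//; case: ltgtP.
Qed.

Lemma reparam_range t : 0 <= t <= 1 -> 0 <= phi t <= 1.
Proof.
move=> t01; have z : 0 <= (0 : R) <= 1 by rewrite lexx ler01.
have o : 0 <= (1 : R) <= 1 by rewrite lexx ler01.
have := reparam_lt t01 z; have := reparam_lt o t01; rewrite phi0 phi1.
by case/andP: t01; rewrite !leNgt => /negbTE -> /negbTE -> -> ->.
Qed.

Lemma reparam_surj s : 0 <= s <= 1 -> exists2 t, 0 <= t <= 1 & phi t = s.
Proof.
move=> /andP[s0 s1].
have [||t /itvP ts <-] := @IVT R phi 0 1 s ler01.
- apply: continuous_in_subspaceT => x _; exact: phic.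
- by rewrite phi0 phi1 ge_min le_max s0 s1 orbT.
by exists t; rewrite ?ts.
Qed.

Let F1_inj : injective (fun p => F (1, p)).
Proof.
move=> p q /= E; have o : 0 <= (1 : R) <= 1 by rewrite lexx ler01.
by rewrite -(GF p o) E GF.
Qed.

Definition transport c : R * R := (phi c.1, phi c.2).

Lemma double_point_range (E : sdiagram R) c : c \in double_points E ->
  0 <= c.1 <= 1 /\ 0 <= c.2 <= 1.
Proof. by move=> /double_pointP[? ? ? _]; split; apply/andP; split; lra. Qed.

Lemma transport_double_points :
  perm_eq (double_points D') (map transport (double_points D)).
Proof.
have gi := gi_double (curve_generic D); have gi' := gi_double (curve_generic D').
apply: uniq_perm; first exact: fset_uniq.
  rewrite map_inj_in_uniq ?fset_uniq// => c e.
  move=> /double_point_range[c1 c2] /double_point_range[e1 e2] [].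
  move=> /eqP; rewrite (reparam_inj c1 e1) => /eqP E1.
  move=> /eqP; rewrite (reparam_inj c2 e2) => /eqP E2.
  by rewrite [c]surjective_pairing E1 E2 -surjective_pairing.
move=> c'; apply/idP/mapP.
  move=> cX; have [c1 c2] := double_point_range cX.
  have [_ c12 _ gc] := double_pointP cX.
  have [s s01 sE] := reparam_surj c1; have [t t01 tE] := reparam_surj c2.
  exists (s, t); last by rewrite /transport /= sE tE -surjective_pairing.
  move: (s01) (t01) => /andP[s0 s1] /andP[t0 t1]; apply/gi; split=> //.
    by rewrite -(reparam_lt s01 t01) sE tE.
  apply: F1_inj; apply: (etrans (esym (curveE s01))); apply: (etrans _ (curveE t01)).
  by rewrite sE tE.
move=> [[s t] cX ->]; rewrite /transport /=.
have [/= s01 t01] := double_point_range cX; have [_ /= st _ gst] := double_pointP cX.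
have [/andP[s0 _] /andP[_ t1]] := (reparam_range s01, reparam_range t01).
apply/gi'; split=> //; first by rewrite (reparam_lt s01 t01).
by rewrite (curveE s01) (curveE t01) gst.
Qed.

Lemma transport_linking : {in double_points D &, forall c e,
  linking (transport c) (transport e) = linking c e}.
Proof.
move=> c e /double_point_range[c1 c2] /double_point_range[e1 e2].
rewrite /linking /disjoint_ends /= !reparam_inj // !reparam_lt //.
Qed.

(** Chain rule on both sides of [curveE], which is used on an interval to the left of [t]; one-sided
    agreement fixes the derivative. *)
Lemma transport_velocity t : 0 < t < 1 ->
  derive1 phi t *: velocity (curve D') (phi t) =
  slice_diff F 1 (curve D t) (velocity (curve D) t).
Proof.
move=> /andP[t0 t1].
have gs := gi_smooth (curve_generic D); have gs' := gi_smooth (curve_generic D').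
have hg : is_diff t (curve D) ('d (curve D) t) by split=> //; exact: smooth_differentiable.
have hk := is_diff_comp hg (slice_is_diff 1 (curve D t) F_smooth).
set k := _ \o _ in hk.
have kd : differentiable k t by exact: (@ex_diff _ _ _ _ _ _ _ hk).
have gd : differentiable (curve D) t by exact: smooth_differentiable.
have gd' : differentiable (curve D') (phi t) by exact: smooth_differentiable.
have kE : velocity k t = slice_diff F 1 (curve D t) (velocity (curve D) t).
  apply: (etrans (velocityE kd)).
  apply: (etrans (congr1 (fun h => h (1 : R)) (@diff_val _ _ _ _ _ _ _ hk))).
  exact: (congr1 (slice_diff F 1 (curve D t)) (esym (velocityE gd))).
have e0 : 0 < Num.min t (1 - t) by rewrite lt_min t0 subr_gt0.
have near u : t - Num.min t (1 - t) < u < t -> curve D' (phi u) = k u.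
  have m : Num.min t (1 - t) <= t by rewrite ge_min lexx.
  by move=> /andP[u1 u2]; apply: curveE; apply/andP; split; lra.
have at_t : curve D' (phi t) = k t by apply: curveE; apply/andP; split; lra.
apply: (etrans _ kE); apply: injective_projections.
  have h1 := is_derive1_comp (is_derive_fst gd') (phid t).
  have := derive_one_sided e0 h1 (is_derive_fst kd).
  rewrite /= at_t => /(_ erefl (or_introl (fun u hu => congr1 fst (near u hu)))) <-.
  by rewrite mulrC.
have h1 := is_derive1_comp (is_derive_snd gd') (phid t).
have := derive_one_sided e0 h1 (is_derive_snd kd).
rewrite /= at_t => /(_ erefl (or_introl (fun u hu => congr1 snd (near u hu)))) <-.
by rewrite mulrC.
Qed.

Lemma det2_scale (a b : R) (v w : R * R) : det2 (a *: v) (b *: w) = a * b * det2 v w.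
Proof.
rewrite /det2 -[(a *: v).1]/(a * v.1) -[(a *: v).2]/(a * v.2).
rewrite -[(b *: w).1]/(b * w.1) -[(b *: w).2]/(b * w.2).
by case: v w => [x y] [z u] /=; ring.
Qed.

(** The two velocities undergo one linear map of positive determinant and positive rescalings. *)
Lemma transport_sign c : c \in double_points D ->
  flat_sign D' (transport c) = flat_sign D c.
Proof.
move=> cX; have [c0 c12 c1 gc] := double_pointP cX.
have r1 : 0 < c.1 < 1 by apply/andP; split; lra.
have r2 : 0 < c.2 < 1 by apply/andP; split; lra.
have [q1 q2] := double_point_range cX.
rewrite /flat_sign /crossing_sign /=.
have V1 := transport_velocity r1; have V2 := transport_velocity r2.
rewrite -gc in V2.
have E := det2_linear (velocity (curve D) c.1) (velocity (curve D) c.2)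
  (slice_diff_linear F 1 (curve D c.1)).
have E' := etrans (esym (congr2 (@det2 R) V1 V2)) (det2_scale _ _ _ _).
have J := slice_det_gt0 F_smooth G_smooth F0 GF (curve D c.1).
have aux (x y m p : R) : 0 < x -> 0 < y -> x * m = y * p -> (0 < m) = (0 < p).
  by move=> x0 y0 xy; rewrite -(pmulr_rgt0 m x0) xy pmulr_rgt0.
have pp : 0 < derive1 phi c.1 * derive1 phi c.2 by rewrite mulr_gt0 ?phi_gt0.
have S := aux _ _ _ _ pp J (etrans (esym E') E).
exact: (congr1 (fun b : bool => if b then 1 else -1) S).
Qed.

Lemma transport_weight r c : c \in double_points D ->
  weight D' r (transport c) = weight D r c.
Proof.
move=> cX; apply: (flat_weight_morph (f := transport)).
- exact: transport_double_points.
- by move=> e eX; exact: transport_linking.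
- exact: transport_linking.
- exact: transport_sign.
Qed.

Lemma transport_sum (V : nmodType) (Q Q' : pred (R * R)) (f f' : R * R -> V) :
  {in double_points D, forall c, Q' (transport c) = Q c} ->
  {in double_points D, forall c, f' (transport c) = f c} ->
  \sum_(c <- double_points D' | Q' c) f' c = \sum_(c <- double_points D | Q c) f c.
Proof.
move=> QE fE; rewrite (perm_big _ transport_double_points) big_map.
rewrite [LHS]big_seq_cond [RHS]big_seq_cond; apply: eq_big => [c|c /andP[cX _]].
  by case cX : (c \in double_points D) => //=; exact: QE.
exact: fE.
Qed.

Lemma transport_extension : H_extension D' = H_extension D.
Proof.
have QE : {in double_points D,
    forall c, (mark D' (transport c) == None) = (mark D c == None)}.
  by move=> c cX; rewrite markE.
have nE : #|` singular D'| = #|` singular D|.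
  rewrite !card_singular; apply: (transport_sum (V := nat)); [exact: QE|by []].
have inX c : c \in double_points D -> transport c \in double_points D'.
  by move=> cX; rewrite (perm_mem transport_double_points) map_f.
have sE : {in double_points D, forall c,
    singular_term D' (transport c) = singular_term D c}.
  move=> c cX; rewrite /singular_term.
  by rewrite (transport_weight 1 cX) (transport_weight (-1) cX).
have cE : {in double_points D, forall c,
    crossing_term D' (transport c) = crossing_term D c}.
  move=> c cX; apply: (etrans (crossing_termE (inX c cX))).
  apply: (etrans _ (esym (crossing_termE cX))).
  have -> : over_sign D' (transport c) = over_sign D c by rewrite /over_sign markE.
  by rewrite (transport_weight _ cX) (transport_sign cX).
have s1 := @transport_sum _ (fun c => mark D c == None) (fun c => mark D' c == None)
  _ _ QE sE.
have s0 : \sum_(c <- double_points D') crossing_term D' c =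
          \sum_(c <- double_points D) crossing_term D c.
  by apply: transport_sum; [|exact: cE].
by rewrite /H_extension nE s0 s1.
Qed.

End IsotopyInvariance.

(** * The skein relation *)

Section Skein.
Variable R : realType.
Variables (D : sdiagram R) (c : R * R).
Hypothesis c_sing : c \in singular D.
Local Notation Dr := (resolve D c).

Let cX : c \in double_points D.
Proof. by move: c_sing; rewrite !inE /= => /andP[]. Qed.

Lemma resolve_mark b x : (mark (Dr b) x == None) = (x != c) && (mark D x == None).
Proof. by rewrite /=; case: (x == c). Qed.

Lemma singular_resolve b : singular (Dr b) = singular D `\ c.
Proof.
apply/fsetP => x; rewrite !inE /=; case: (x == c) => /=; last by [].
by rewrite andbF.
Qed.

Lemma card_singular_resolve b : #|` singular D| = #|` singular (Dr b)|.+1.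
Proof. by rewrite singular_resolve (cardfsD1 c) c_sing. Qed.

(** The resolution is positive exactly when the over sign of [c] equals its flat sign. *)
Lemma crossing_term_resolve b :
  crossing_term (Dr b) c =
  if b then weight D (flat_sign D c) c else - weight D (- flat_sign D c) c.
Proof.
rewrite (@crossing_termE R (Dr b) c cX) /over_sign /= eqxx.
rewrite -[weight (Dr b)]/(weight D) -[flat_sign (Dr b) c]/(flat_sign D c).
rewrite -[crossing_sign _ _ _]/(flat_sign D c).
by case: (flat_sign_unit D c) => ->; case: b => /=;
  rewrite ?opprK ?mul1r ?mulr1 ?mulrN1z ?mulr1z ?mulN1r ?opprK ?mulr1z ?mulrN1z.
Qed.

(** Weights ignore marks, so every term except that of [c] cancels. For one singular crossing the
    two weights of [c] remain; for two, both resolutions give the same singular sum. *)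
Lemma H_extension_skein : H_extension D = H_extension (Dr true) - H_extension (Dr false).
Proof.
have n1 := card_singular_resolve true; have n2 := card_singular_resolve false.
have n12 : #|` singular (Dr true)| = #|` singular (Dr false)|.
  by move: n1; rewrite n2 => -[].
rewrite /H_extension n12 n2 /=.
case: eqP => [[n0]|n0].
  have sE : singular D = [fset c].
    apply/esym/eqP; rewrite eqEfcard fsub1set c_sing cardfs1 n2.
    by rewrite n0.
  rewrite n0 /=.
  have -> : \sum_(x <- double_points D | mark D x == None) singular_term D x = singular_term D c.
    transitivity (\sum_(x <- singular D) singular_term D x); first by rewrite big_fset.
    by rewrite sE big_seq_fset1.
  rewrite -[double_points (Dr true)]/(double_points D).
  rewrite -[double_points (Dr false)]/(double_points D).
  rewrite [X in _ = X - _](big_fsetD1 c cX) [X in _ = _ - X](big_fsetD1 c cX).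
  have -> : \sum_(x <- double_points D `\ c) crossing_term (Dr true) x =
            \sum_(x <- double_points D `\ c) crossing_term (Dr false) x.
    apply: eq_big_seq => x; rewrite !inE => /andP[xc _].
    by rewrite /crossing_term /over_under /= (negbTE xc).
  rewrite !crossing_term_resolve opprD opprK addrACA subrr addr0 /singular_term.
  by case: (flat_sign_unit D c) => ->; rewrite ?opprK // addrC.
have -> : (#|` singular (Dr false)| == 0) = false by apply/eqP => E; apply: n0; rewrite E.
case: eqP => n1'; last by rewrite subrr.
apply/esym/eqP; rewrite subr_eq0; apply/eqP.
apply: eq_bigl => x.
by rewrite !resolve_mark.
Qed.

End Skein.

(** * A singular diagram on which the extension does not vanish *)

Section LinkedPair.
Variable R : realType.

Lemma flat_degree_pair (tau : R * R -> int) (c e x : R * R) :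
  flat_degree [:: c; e] tau x = linking x c * tau c + linking x e * tau e.
Proof. by rewrite /flat_degree !big_cons big_nil addr0. Qed.

(** Both degrees are 1 or -1, so the index of [c] is a unit of the ring of integers for [n = 1] and
    0 otherwise. Each weight is a non-trivial power of [t] times [y], minus [y]. *)
Lemma linked_pair_extension (D : sdiagram R) (c e : R * R) :
    double_points D = [fset c; e] -> c != e ->
    linking c e = 1 \/ linking c e = -1 -> mark D c = None -> mark D e != None ->
  #|` singular D| = 1%N /\ H_extension D != 0.
Proof.
move=> XE ce lce mc me.
have n1 : #|` singular D| = 1%N.
  by rewrite card_singular XE (sum_fset2 (V := nat) _ _ ce) mc (negbTE me).
split=> //; rewrite /H_extension n1 /= XE (sum_fset2 _ _ ce) mc (negbTE me) addr0.
have WE r x : weight D r x = flat_weight [:: c; e] (flat_sign D) r x.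
  apply/esym/perm_flat_weight => //; apply: uniq_perm; rewrite ?fset_uniq//= ?inE ?ce//.
  by move=> y; rewrite XE !inE.
set tau := flat_sign D in WE *.
have tc : tau c = 1 \/ tau c = -1 by exact: flat_sign_unit.
have te : tau e = 1 \/ tau e = -1 by exact: flat_sign_unit.
have lec : linking e c = - linking c e by exact: linkingC.
have dc : flat_degree [:: c; e] tau c = linking c e * tau e.
  by rewrite flat_degree_pair linking_self mul0r add0r.
have de : flat_degree [:: c; e] tau e = linking e c * tau c.
  have aux (x y z : int) : z = 0 -> x + z * y = x by move=> ->; rewrite mul0r addr0.
  by apply: (etrans (flat_degree_pair tau c e e)); exact: aux (linking_self e).
have dc1 : `|flat_degree [:: c; e] tau c|%N = 1%N.
  by rewrite dc; case: lce => ->; case: te => ->.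
have de1 : `|flat_degree [:: c; e] tau e|%N = 1%N.
  by rewrite de lec; case: lce => ->; case: tc => ->.
have indE r n : flat_ind [:: c; e] tau r c n =
    if n == 1%N then << r * (linking c e * tau e) *g 0 >> else 0.
  rewrite /flat_ind !big_cons big_nil /flat_term linking_self mul0r mulr0 freegU0 add0r.
  rewrite if_same /gcdz dc1 de1 gcdn1 eqz_nat eq_sym addr0.
  case: ifP => // _; congr << _ *g _ >>.
  by rewrite -abszE dc1 modz1.
(* The symbol [t^0 y] occurs only in the subtracted part, so the two weights of [c] cannot
   cancel. *)
have wE r : r = 1 \/ r = -1 -> coeff (None, 1%N) (weight D r c) = -1.
  move=> r1; rewrite WE /flat_weight.
  rewrite (fsbigTE [fset 1%N]); last first.
    by move=> n; rewrite inE => /negbTE n0; rewrite indE n0 /t_pow eqxx subrr.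
  rewrite big_seq_fset1 indE eqxx coeffB !coeffU /t_pow freegU_eq0.
  have -> : (r * (linking c e * tau e) == 0) = false.
    by case: r1 => ->; case: lce => ->; case: te => ->.
  by rewrite eqxx /= mulr0 mulr1 sub0r.
apply/eqP => /(congr1 (coeff (None, 1%N))).
by rewrite /singular_term coeffD coeff0 !wE; [|right|left].
Qed.

End LinkedPair.

(** * Polynomial curves and the explicit example *)

Section PolynomialCurve.
Variable R : realType.

Definition poly_curve (p q : {poly R}) (t : R) : R * R := (p.[t], q.[t]).

Lemma poly_curve_is_diff p q t :
  is_diff t (poly_curve p q) (fun v => (v * p^`().[t], v * q^`().[t])).
Proof.
have hd (r : {poly R}) : is_diff t (horner r) (fun v => v * r^`().[t]).
  have dr : differentiable (horner r) t by apply/derivable1_diffP/derivable_horner.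
  split=> //; apply/funext => v.
  have := deriveE (1 : R) dr; rewrite -derive1E -derivE => ->.
  by rewrite -[v in LHS]mulr1 -[v * 1]/(v *: (1 : R)) linearZ.
exact: is_diff_pair.
Qed.

(** The derivative of a polynomial curve in a fixed direction is again a polynomial curve. *)
Lemma poly_curve_smooth p q : smooth (poly_curve p q).
Proof.
move=> k; elim: k p q => [|k IH] p q /=.
  move=> t; apply: differentiable_continuous.
  exact: (@ex_diff _ _ _ _ _ _ _ (poly_curve_is_diff p q t)).
split=> [t|v].
  exact: (@ex_diff _ _ _ _ _ _ _ (poly_curve_is_diff p q t)).
have -> : (fun t => 'd (poly_curve p q) t v) = poly_curve (v *: p^`()) (v *: q^`()).
  apply/funext => t; rewrite (@diff_val _ _ _ _ _ _ _ (poly_curve_is_diff p q t)).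
  by rewrite /poly_curve !hornerZ.
exact: IH.
Qed.

Lemma poly_curve_velocity p q t : velocity (poly_curve p q) t = (p^`().[t], q^`().[t]).
Proof.
have h := poly_curve_is_diff p q t.
rewrite velocityE; last exact: (@ex_diff _ _ _ _ _ _ _ h).
by rewrite (@diff_val _ _ _ _ _ _ _ h) !mul1r.
Qed.

End PolynomialCurve.

Section LinkedCurve.
Variable R : realType.

(* The curve (T^3 - 49 T, T^4 - 73 T^2) has the double points (-8, 3), (-7, 7)  *)
(* and (-3, 8); the affine parameter T = 33 t / 2 - 9 runs from -9 to 15/2, so   *)
(* that the third one disappears.                                               *)
Definition linked_time : {poly R} := (33 / 2) *: 'X - 9%:P.

Definition linked_x : {poly R} := linked_time ^+ 3 - 49 *: linked_time.

Definition linked_y : {poly R} := linked_time ^+ 4 - 73 *: linked_time ^+ 2.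

Definition linked_curve := poly_curve linked_x linked_y.

Definition linked_chord1 : R * R := (2 / 33, 8 / 11).

Definition linked_chord2 : R * R := (4 / 33, 32 / 33).

Lemma linked_curveE t : let T := 33 / 2 * t - 9 in
  linked_curve t = (T ^+ 3 - 49 * T, T ^+ 4 - 73 * T ^+ 2).
Proof.
by rewrite /linked_curve /poly_curve /linked_x /linked_y /linked_time !hornerE.
Qed.

Lemma linked_velocity t : let T := 33 / 2 * t - 9 in
  velocity linked_curve t =
  (33 / 2 * (3 * T ^+ 2 - 49), 33 / 2 * (4 * T ^+ 3 - 146 * T)).
Proof.
rewrite /linked_curve poly_curve_velocity /linked_x /linked_y /linked_time.
rewrite !poly.derivE !hornerE /=.
by congr pair; field.
Qed.

Lemma linked_double_points s t :
  [/\ 0 <= s, s < t, t <= 1 & linked_curve s = linked_curve t] <->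
  (s, t) = linked_chord1 \/ (s, t) = linked_chord2.
Proof.
split; last first.
  case=> -[-> ->]; rewrite !linked_curveE; (split; [lra|lra|lra|]);
    by congr pair; field.
move=> [s0 st t1]; rewrite !linked_curveE => -[].
set S := 33 / 2 * s - 9; set T := 33 / 2 * t - 9.
have ST : S < T by rewrite /S /T; lra.
have T1 : T <= 15 / 2 by rewrite /T; lra.
have sE : s = 2 / 33 * (S + 9) by rewrite /S; field.
have tE : t = 2 / 33 * (T + 9) by rewrite /T; field.
move: S T ST T1 sE tE => S T ST T1 sE tE ex ey {s0 st t1}.
have TS0 : T - S != 0 by rewrite subr_eq0 gt_eqF.
(* Equality of the coordinates, divided by the factor [T - S]. *)
have hx : S ^+ 2 + S * T + T ^+ 2 = 49.
  apply: (mulfI TS0); apply/eqP; rewrite -subr_eq0; apply/eqP.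
  transitivity ((T ^+ 3 - 49 * T) - (S ^+ 3 - 49 * S)); first by ring.
  by rewrite ex subrr.
have hy : (S + T) * (S ^+ 2 + T ^+ 2 - 73) = 0.
  apply: (mulfI TS0); rewrite mulr0.
  transitivity ((T ^+ 4 - 73 * T ^+ 2) - (S ^+ 4 - 73 * S ^+ 2)); first by ring.
  by rewrite ey subrr.
move/eqP: hy; rewrite mulf_eq0 => /orP[/eqP h|/eqP h].
  have SE : S = - T by lra.
  have : (T - 7) * (T + 7) = 0.
    by rewrite SE in hx; rewrite -[RHS](subrr 49) -[X in _ = X - _]hx; ring.
  move/eqP; rewrite mulf_eq0 => /orP[]/eqP T7; last by exfalso; lra.
  right; rewrite sE tE SE /linked_chord2; congr pair.
    by have -> : T = 7 by [lra]; field.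
  by have -> : T = 7 by [lra]; field.
(* Subtracting S^2 + T^2 = 73 from [hx] gives the product, and then (S + T)^2 = 73 - 48 = 25. *)
have hp : S * T = - 24 by lra.
have : (S + T - 5) * (S + T + 5) = 0.
  transitivity (S ^+ 2 + T ^+ 2 + 2 * (S * T) - 25); first by ring.
  by rewrite hp; lra.
move/eqP; rewrite mulf_eq0 => /orP[]/eqP hs.
  (* The pair (-3, 8) is excluded by T <= 15/2, and the other root by S < T. *)
  have : (T - 8) * (T + 3) = 0.
    by transitivity (- (S * T) - 24 + (S + T - 5) * T); [ring|rewrite hp hs; ring].
  by move/eqP; rewrite mulf_eq0 => /orP[]/eqP T8; exfalso; lra.
have : (T - 3) * (T + 8) = 0.
  by transitivity (- (S * T) - 24 + (S + T + 5) * T); [ring|rewrite hp hs; ring].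
move/eqP; rewrite mulf_eq0 => /orP[]/eqP T8; last by exfalso; lra.
left; rewrite sE tE /linked_chord1.
have -> : T = 3 by lra.
have -> : S = - 8 by lra.
by congr pair; field.
Qed.

Lemma linked_chord_neq : linked_chord1 != linked_chord2.
Proof. by apply/eqP => -[] h _; move: h; lra. Qed.

Lemma linked_curve_generic : generic_immersion linked_curve [fset linked_chord1; linked_chord2].
Proof.
have inX c : c \in [fset linked_chord1; linked_chord2] ->
    c = linked_chord1 \/ c = linked_chord2.
  by rewrite !inE => /orP[]/eqP ->; [left|right].
split.
- exact: poly_curve_smooth.
- move=> t _; rewrite linked_velocity; apply/eqP => -[].
  set T := 33 / 2 * t - 9 => h1 h2.
  have {}h1 : T ^+ 2 = 49 / 3 by lra.
  have {}h2 : T * (4 * T ^+ 2 - 146) = 0 by lra.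
  by move/eqP: h2; rewrite h1 mulf_eq0 => /orP[]/eqP h; [move: h1; rewrite h|]; lra.
- move=> s t; rewrite linked_double_points !inE.
  by split=> [/orP[]/eqP ->|[]->]; [left|right|rewrite eqxx|rewrite eqxx orbT].
- move=> c /inX[] ->; rewrite !linked_velocity /det2 /=; apply/eqP; lra.
- move=> c e /inX[] -> /inX[] -> //; rewrite !linked_curveE /= => -[] h _; exfalso; move: h; lra.
- by move=> c /inX[] -> /=; split; lra.
Qed.

Definition linked_diagram : sdiagram R :=
  SDiagram (fun c => if c == linked_chord1 then None else Some true) linked_curve_generic.

Lemma linked_diagram_extension :
  #|` singular linked_diagram| = 1%N /\ H_extension linked_diagram != 0.
Proof.
apply: (@linked_pair_extension _ linked_diagram linked_chord1 linked_chord2).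
- by [].
- exact: linked_chord_neq.
- rewrite /linking /disjoint_ends /=.
  have [n1 n2 n3 n4] : [/\ (2 / 33 : R) < 4 / 33, (2 / 33 : R) < 32 / 33,
    (4 / 33 : R) < 8 / 11 & (8 / 11 : R) < 32 / 33] by split; lra.
  rewrite (lt_eqF n1) (lt_eqF n2) (gt_eqF n3) (lt_eqF n4) /= n1 n2 n4.
  by rewrite (lt_gtF n3); right.
- by rewrite /= eqxx.
- by rewrite /= [X in if X then _ else _]eq_sym (negbTE linked_chord_neq).
Qed.

End LinkedCurve.

(** * Invariance under all moves and conclusion *)

Section Vassiliev.
Variable R : realType.
Implicit Types D : sdiagram R.

Lemma planar_isotopy_extension D D' : planar_isotopy D D' -> H_extension D' = H_extension D.
Proof.
move=> [F [G [phi [[Fs Gs] [F0 FG] [ps p0 p1 pd] cE mE]]]].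
apply: (transport_extension Fs Gs F0 _ ps p0 p1 pd cE mE).
by move=> s p /(FG s p)[].
Qed.

Lemma reidemeister_extension D D' : reidemeister_move D D' -> H_extension D' = H_extension D.
Proof.
by case; [exact: planar_isotopy_extension|exact: Omega1_extension
         |exact: Omega2_extension|exact: Omega3_extension].
Qed.

Lemma sing_move_extension D D' : sing_move D D' -> H_extension D' = H_extension D.
Proof.
by case; [exact: reidemeister_extension|exact: sing_under_arc_extension
         |exact: sing_over_arc_extension|exact: sing_slide_extension].
Qed.

Lemma sing_knotoid_equiv_extension D D' : sing_knotoid_equiv D D' ->
  H_extension D = H_extension D'.
Proof.
elim=> {D D'} [D D' h|D|D D' _|D E D' _ h1 _ h2].
- exact: (esym (sing_move_extension h)).
- by [].
- by move/esym.
- exact: (etrans h1 h2).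
Qed.

Lemma knotoid_equiv_H (D D' : diagram R) : knotoid_equiv D D' ->
  H_diagram D = H_diagram D'.
Proof.
elim=> {D D'} [D D' h|D|D D' _|D E D' _ h1 _ h2].
- apply: (etrans (esym (H_extension_diagram D))).
  exact: (etrans (esym (reidemeister_extension h)) (H_extension_diagram D')).
- by [].
- by move/esym.
- exact: (etrans h1 h2).
Qed.

End Vassiliev.

Theorem theorem1p3 (R : realType) : vassiliev_of_order (@H_diagram R) 1.
Proof.
split; first exact: knotoid_equiv_H.
exists (@H_extension R); split.
- exact: sing_knotoid_equiv_extension.
- exact: H_extension_diagram.
- exact: H_extension_skein.
- by move=> D; rewrite /H_extension; case: #|` _| => [|[]].
- by exists (linked_diagram R); exact: linked_diagram_extension.
Qed.
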